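(* The following conditions determine a well-defined family of maps $\Phi:\mathcal{P}(B,\lambda)\to\mathrm{RC}(L,\lambda)$ (i.e. there is exactly one such family), indexed by all finite tensor products $B=B^{r_k,s_k}\otimes\cdots\otimes B^{r_1,s_1}$ (including the empty one), with $L$ the multiplicity array of $B$, and all $n$-tuples $\lambda$ of nonnegative integers: (0) the empty path is mapped to the empty rigged configuration; (1) if $B=B^{1,1}\otimes B'$, then $\delta\circ\Phi=\Phi\circ\mathrm{lh}$ as maps $\mathcal{P}(B,\lambda)\to\bigcup_{\mu\in\lambda^-}\mathrm{RC}(\mathrm{lh}(L),\mu)$; (2) if $B=B^{r,s}\otimes B'$ with $s\ge2$, then $\mathrm{ls}_{rc}\circ\Phi=\Phi\circ\mathrm{ls}$ as maps $\mathcal{P}(B,\lambda)\to\mathrm{RC}(\mathrm{ls}(L),\lambda)$; (3) if $B=B^{r,1}\otimes B'$ with $r\ge2$, then $\mathrm{lb}_{rc}\circ\Phi=\Phi\circ\mathrm{lb}$ as maps $\mathcal{P}(B,\lambda)\to\mathrm{RC}(\mathrm{lb}(L),\lambda)$. Moreover, each $\Phi:\mathcal{P}(B,\lambda)\to\mathrm{RC}(L,\lambda)$ is a bijection.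
   Context: Fix an integer $n\ge 2$, $I=\{1,\ldots,n-1\}$, $\mathcal{H}=I\times\mathbb{Z}_{>0}$; $\epsilon_1,\dots,\epsilon_n$ is the standard basis of $\mathbb{Z}^n$. **Paths.** For $r\in I$, $s\ge1$, $B^{r,s}$ is the set of column-strict Young tableaux of shape $(s^r)$ ($r$ rows, $s$ columns; rows weakly increasing, columns strictly increasing downward) with entries in $\{1,\ldots,n\}$. $B=B^{r_k,s_k}\otimes\cdots\otimes B^{r_1,s_1}$ is the Cartesian product; $\mathrm{wt}(b)=(w_1,\ldots,w_n)$ with $w_i$ the number of letters $i$ in $b$; $\mathcal{P}(B,\lambda)=\{b\in B\mid\mathrm{wt}(b)=\lambda\}$. **Unrestricted rigged configurations.** The multiplicity array of $B$ is $L=(L_i^{(a)})_{(a,i)\in\mathcal{H}}$, with $L_i^{(a)}$ the number of factors $B^{a,i}$ in $B$. Let $\alpha_a=\epsilon_a-\epsilon_{a+1}$, $\Lambda_a=\epsilon_1+\cdots+\epsilon_a$, $(\alpha_a|\alpha_b)$ the Cartan matrix of type $A_{n-1}$. $\mathrm{C}(L,\lambda)$ is the set of sequences of partitions $\nu=(\nu^{(a)})_{a\in I}$ with $\sum_{(a,i)}i\,m_i^{(a)}\alpha_a=\sum_{(a,i)}i\,L_i^{(a)}\Lambda_a-\lambda$, where $m_i^{(a)}=m_i^{(a)}(\nu)$ is the number of parts $i$ in $\nu^{(a)}$. Vacancy numbers: $p_i^{(a)}=p_i^{(a)}(\nu)=\sum_{j\ge1}\min(i,j)L_j^{(a)}-\sum_{(b,j)\in\mathcal{H}}(\alpha_a|\alpha_b)\min(i,j)m_j^{(b)}$.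 Put $c_k=\lambda_{k+1}+\cdots+\lambda_n$ ($k\ge1$), $c_0=c_1$; let $\lambda'$ be the partition with $k$-th column of height $c_k$, $1\le k\le n-1$. $\mathcal{A}(\lambda')$ is the set of fillings $t=(t_{j,k})$ ($j$ row, $k$ column) of shape $\lambda'$ with entries of column $k$ in $\{1,\ldots,c_{k-1}\}$, strictly decreasing down columns. $M_i^{(a)}(t)=-\sum_{j=1}^{c_a}\chi(i\ge t_{j,a})+\sum_{j=1}^{c_{a+1}}\chi(i\ge t_{j,a+1})$, with $\chi$ the truth indicator. An $(M,p,m)$-quasipartition is a tuple of integers with $M\le\mu_m\le\cdots\le\mu_1\le p$ (for $m=0$ the empty tuple, no condition). $\mathrm{RC}(L,\lambda)$ is the set of $(\nu,J)$, $\nu\in\mathrm{C}(L,\lambda)$, $J=(J^{(a,i)})_{(a,i)\in\mathcal{H}}$, such that for some $t\in\mathcal{A}(\lambda')$ every $J^{(a,i)}$ is an $(M_i^{(a)}(t),p_i^{(a)},m_i^{(a)})$-quasipartition. $(\nu,J)$ is viewed as the partitions $\nu^{(a)}$ with the parts of size $i$ labeled by the parts of $J^{(a,i)}$: a pair $(i,x)$, $i$ a part of $\nu^{(a)}$ with label $x$ from $J^{(a,i)}$, is a string of $(\nu,J)^{(a)}$; it is singular if $x=p_i^{(a)}$. $J^{(a,i)}$ is singular if it has a part equal to $p_i^{(a)}$. **Splitting maps.** If $B=B^{1,1}\otimes B'$: $\mathrm{lh}(B)=B'$, $\mathrm{lh}(c\otimes b')=b'$. If $B=B^{r,s}\otimes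 B'$, $s\ge2$: $\mathrm{ls}(B)=B^{r,1}\otimes B^{r,s-1}\otimes B'$, $\mathrm{ls}(c\otimes b')=c_1\otimes c_2\cdots c_s\otimes b'$, where $c_i$ is the $i$-th column of $c$. If $B=B^{r,1}\otimes B'$, $r\ge2$: $\mathrm{lb}(B)=B^{1,1}\otimes B^{r-1,1}\otimes B'$, and a column with entries $b_1<\cdots<b_r$ tensored with $b'$ is sent to (box $b_r$) $\otimes$ (column $b_1<\cdots<b_{r-1}$) $\otimes\, b'$. $\mathrm{lh}(L),\mathrm{ls}(L),\mathrm{lb}(L)$ denote the multiplicity arrays of $\mathrm{lh}(B),\mathrm{ls}(B),\mathrm{lb}(B)$. **Maps on rigged configurations.** $\lambda^-$ is the set of nonnegative tuples $\mu$ with $\lambda-\mu=\epsilon_r$ for some $1\le r\le n$. For $L_1^{(1)}>0$, $\delta:\mathrm{RC}(L,\lambda)\to\bigcup_{\mu\in\lambda^-}\mathrm{RC}(\mathrm{lh}(L),\mu)$ is: set $\ell^{(0)}=1$; for $a=1,\ldots,n-1$ find the smallest $i\ge\ell^{(a-1)}$ with $J^{(a,i)}$ singular; if none exists set $\mathrm{rk}(\nu,J)=a$ and stop, else $\ell^{(a)}=i$ (if never stopped, $\mathrm{rk}(\nu,J)=n$). Remove a box from the selected singular string of length $\ell^{(a)}$ in each $(\nu,J)^{(a)}$ for which $\ell^{(a)}$ is defined, make each shortened string singular with respect to the new vacancy numbers (computed with $\mathrm{lh}(L)$), leave all other strings and labels unchanged; the result lies in $\mathrm{RC}(\mathrm{lh}(L),\lambda-\epsilon_{\mathrm{rk}(\nu,J)})$.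 The map $\mathrm{ls}_{rc}:\mathrm{RC}(L,\lambda)\to\mathrm{RC}(\mathrm{ls}(L),\lambda)$ (for $B=B^{r,s}\otimes B'$, $s\ge2$) is $(\nu,J)\mapsto(\nu,J)$. The map $\mathrm{lb}_{rc}:\mathrm{RC}(L,\lambda)\to\mathrm{RC}(\mathrm{lb}(L),\lambda)$ (for $B=B^{r,1}\otimes B'$, $r\ge2$) adds a singular string of length $1$ to $(\nu,J)^{(a)}$ for each $1\le a<r$ (vacancy numbers do not change). *)

(* Defs.v *)
From HB Require Import structures.
From mathcomp Require Import all_boot all_order all_algebra.
From mathcomp Require Import finmap multiset.

Set Implicit Arguments.
Unset Strict Implicit.
Unset Printing Implicit Defensive.

Import Order.TTheory GRing.Theory Num.Theory.
Local Open Scope mset_scope.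
Local Open Scope ring_scope.

(* Indices follow the 1-based conventions of the mathematics: a Dynkin node   *)
(* is an a : nat with 0 < a < n, and letters are naturals x with 0 < x <= n.  *)

(** * Paths *)

(* The factor B^{r,s} is the pair (r, s).  The product                        *)
(* B^{r_k,s_k} (x) ... (x) B^{r_1,s_1} is the list of its factors read from   *)
(* left to right, so that B = B^{r,s} (x) B' is (r, s) :: B'.                 *)
Definition factor := (nat * nat)%type.
Definition valid (n : nat) (B : seq factor) : bool :=
  all (fun f : factor => (0 < f.1 < n)%N && (0 < f.2)%N) B.

(* A rectangular tableau is the list of its columns, from left to right, each *)
(* column being read downwards.                                               *)
Definition tableau := seq (seq nat).

Definition is_column (n r : nat) (col : seq nat) : bool :=
  [&& size col == r, sorted ltn col & all (fun x => 0 < x <= n)%N col].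

Definition is_tableau (n r s : nat) (T : tableau) : bool :=
  [&& size T == s, all (is_column n r) T
    & sorted (fun col col' : seq nat => all2 leq col col') T].

Definition tpath := seq tableau.

Definition is_path (n : nat) (B : seq factor) (b : tpath) : bool :=
  all2 (fun (f : factor) T => is_tableau n f.1 f.2 T) B b.

Definition wt (n : nat) (b : tpath) : n.-tuple nat :=
  [tuple count_mem (nat_of_ord k).+1 (flatten (flatten b)) | k < n].

Definition P (n : nat) (B : seq factor) (lambda : n.-tuple nat) :=
  {b : tpath | is_path n B b && (wt n b == lambda)}.

(** * Splitting maps on paths *)

Definition lh_path (b : tpath) : tpath := behead b.

Definition ls_path (b : tpath) : tpath :=
  if b is (c1 :: c) :: b' then [:: c1] :: c :: b' else b.

Definition lb_path (b : tpath) : tpath :=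
  if b is [:: x :: col] :: b' then
    [:: [:: last x col]] :: [:: belast x col] :: b'
  else b.

Lemma lh_pathP n B' (lambda : n.-tuple nat) (b : P ((1, 1)%N :: B') lambda) :
  is_path n B' (lh_path (sval b)) &&
  (wt n (lh_path (sval b)) == wt n (lh_path (sval b))).
Proof. by rewrite eqxx andbT; case: b => -[|T b] //= /andP[/andP[]]. Qed.

Lemma ls_pathP n r s B' (lambda : n.-tuple nat)
    (b : P ((r, s.+2) :: B') lambda) :
  is_path n ((r, 1)%N :: (r, s.+1) :: B') (ls_path (sval b)) &&
  (wt n (ls_path (sval b)) == lambda).
Proof.
case: b => -[|[|c1 c] b] //=.
move=> /andP[/andP[/and3P[/= sc /andP[c1P cP] scP] bP] wtb].
rewrite /is_tableau /= c1P cP bP -[size c == _]/(size (c1 :: c) == s.+2) sc.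
by rewrite (path_sorted scP).
Qed.

Lemma lb_pathP n r B' (lambda : n.-tuple nat)
    (b : P ((r.+2, 1)%N :: B') lambda) :
  is_path n ((1, 1)%N :: (r.+1, 1)%N :: B') (lb_path (sval b)) &&
  (wt n (lb_path (sval b)) == lambda).
Proof.
case: b => -[|[|[|x col] [|c2 c]] b] //=; rewrite ?andbF //=.
move=> /andP[/andP[/and3P[_ /andP[/and3P[/= sc so xP] _] _] bP] /eqP wtb].
have xP' : all (fun x => 0 < x <= n)%N (rcons (belast x col) (last x col)).
  by rewrite -lastI.
move: xP'; rewrite all_rcons => /andP[lP beP].
have so' : sorted ltn (rcons (belast x col) (last x col)) by rewrite -lastI.
have sob : sorted ltn (belast x col).
  by apply: (subseq_sorted ltn_trans _ so'); rewrite -cats1 prefix_subseq.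
rewrite bP /is_tableau /is_column /= size_belast beP sob lP.
rewrite -[size col == _]/((size col).+1 == r.+2) sc /=.
apply/eqP; rewrite -wtb; apply: eq_from_tnth => k; rewrite !tnth_mktuple.
set y := (nat_of_ord k).+1.
rewrite -[LHS]/(count_mem y
  (last x col :: belast x col ++ flatten (flatten b))).
rewrite -[RHS]/(count_mem y ((x :: col) ++ flatten (flatten b))).
rewrite (lastI x col) cat_rcons -[in LHS]cat1s -[in RHS]cat1s !count_cat.
by rewrite addnCA.
Qed.

Definition lh n B' (lambda : n.-tuple nat) (b : P ((1, 1)%N :: B') lambda) :
  P B' (wt n (lh_path (sval b))) :=
  exist (fun c : tpath => is_path n _ c && (wt n c == _)) _ (lh_pathP b).

Definition ls n r s B' (lambda : n.-tuple nat)
    (b : P ((r, s.+2) :: B') lambda) :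
  P ((r, 1)%N :: (r, s.+1) :: B') lambda :=
  exist (fun c : tpath => is_path n _ c && (wt n c == _)) _ (ls_pathP b).

Definition lb n r B' (lambda : n.-tuple nat)
    (b : P ((r.+2, 1)%N :: B') lambda) :
  P ((1, 1)%N :: (r.+1, 1)%N :: B') lambda :=
  exist (fun c : tpath => is_path n _ c && (wt n c == _)) _ (lb_pathP b).

(* The weight of lh b belongs to lambda^-.                                    *)
Lemma lh_wt n B' (lambda : n.-tuple nat) (b : P ((1, 1)%N :: B') lambda) :
  exists k : 'I_n, forall j : 'I_n,
    tnth lambda j = ((j == k) + tnth (wt n (lh_path (sval b))) j)%N.
Proof.
case: b => -[|[|[|x [|y col]] [|c2 c]] b] //=; rewrite ?andbF //.
move=> /andP[/andP[/and3P[_ /andP[/and3P[_ _ xP] _] _] bP] /eqP <-].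
move: xP => /andP[/andP[x0 xn] _].
have xn' : (x.-1 < n)%N by rewrite prednK.
exists (Ordinal xn') => j; rewrite !tnth_mktuple /=; congr (_ + _)%N.
by rewrite -val_eqE /= eq_sym -[in LHS](prednK x0) eqSS eq_sym.
Qed.

(** * Unrestricted rigged configurations *)

(* The multiplicity array of B: mult_array B (a, i) is L_i^{(a)}.             *)
Definition mult_array (B : seq factor) : {mset factor} := seq_mset B.

Definition eps (n k : nat) : 'rV[int]_n := \row_(j < n) (j.+1 == k)%:R.
Definition alpha (n a : nat) : 'rV[int]_n := eps n a - eps n a.+1.
Definition fundwt (n a : nat) : 'rV[int]_n := \sum_(1 <= k < a.+1) eps n k.
Definition wtvec (n : nat) (lambda : n.-tuple nat) : 'rV[int]_n :=
  \row_j (tnth lambda j)%:Z.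

(* (alpha_a | alpha_b) in type A *)
Definition cartan (a b : nat) : int :=
  if a == b then 2 else if (a == b.+1) || (b == a.+1) then -1 else 0.

(* nu a and J a i are nu^{(a)} and J^{(a,i)}; is_config and is_rc below make  *)
(* them empty for a outside I and for i = 0, so that Leibniz equality is the  *)
(* equality of families indexed by I and I x Z_{>0}.                          *)
Record rigged := Rigged { nu : nat -> seq nat; J : nat -> nat -> seq int }.

Definition is_partition (s : seq nat) : bool := sorted geq s && (0%N \notin s).

Definition parts_mult (nu : nat -> seq nat) (a i : nat) : nat :=
  count_mem i (nu a).

(* The infinite sums over i >= 1 or over (a, i) are taken over the indices    *)
(* of nonzero multiplicity: finsupp L for L, undup (nu a) for m^{(a)}.        *)
Definition is_config (n : nat) (L : {mset factor}) (lambda : n.-tuple nat)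
    (nu : nat -> seq nat) : Prop :=
  [/\ forall a, (0 < a < n)%N -> is_partition (nu a),
      forall a, ~~ (0 < a < n)%N -> nu a = [::] &
      \sum_(1 <= a < n) \sum_(i <- undup (nu a))
          alpha n a *+ (i * parts_mult nu a i)
      = \sum_(h <- finsupp L) fundwt n h.1 *+ (h.2 * L h) - wtvec lambda].

Definition vacancy (n : nat) (L : {mset factor}) (nu : nat -> seq nat)
    (a i : nat) : int :=
  \sum_(h <- finsupp L | h.1 == a) (minn i h.2 * L h)%N%:Z
  - \sum_(1 <= b < n) \sum_(j <- undup (nu b))
      cartan a b * (minn i j * parts_mult nu b j)%N%:Z.

(* Height of the k-th column of lambda', with c_0 = c_1.                      *)
Definition colheight (n : nat) (lambda : n.-tuple nat) (k : nat) : nat :=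
  (\sum_((maxn k 1).+1 <= j < n.+1) nth 0 lambda j.-1)%N.

(* t j k is the entry in row j and column k; values of t outside the shape    *)
(* lambda' are irrelevant.                                                    *)
Definition admissible (n : nat) (lambda : n.-tuple nat)
    (t : nat -> nat -> nat) : Prop :=
  forall k, (0 < k < n)%N ->
    (forall j, (0 < j <= colheight lambda k)%N ->
       (0 < t j k <= colheight lambda k.-1)%N) /\
    (forall j, (0 < j < colheight lambda k)%N -> (t j.+1 k < t j k)%N).

Definition lowbound (n : nat) (lambda : n.-tuple nat) (t : nat -> nat -> nat)
    (a i : nat) : int :=
  - (\sum_(1 <= j < (colheight lambda a).+1) (t j a <= i)%N%:Z)
  + \sum_(1 <= j < (colheight lambda a.+1).+1) (t j a.+1 <= i)%N%:Z.

Definition quasipartition (M p : int) (m : nat) (mu : seq int) : bool :=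
  [&& size mu == m, sorted >=%R mu & all (fun x => M <= x <= p) mu].

Definition is_rc (n : nat) (L : {mset factor}) (lambda : n.-tuple nat)
    (x : rigged) : Prop :=
  [/\ is_config L lambda (nu x),
      forall a i, ~~ ((0 < a < n)%N && (0 < i)%N) -> J x a i = [::] &
      exists2 t, admissible lambda t &
        forall a i, (0 < a < n)%N -> (0 < i)%N ->
          quasipartition (lowbound lambda t a i) (vacancy n L (nu x) a i)
            (parts_mult (nu x) a i) (J x a i)].

Definition RC (n : nat) (L : {mset factor}) (lambda : n.-tuple nat) :=
  {x : rigged | is_rc L lambda x}.

Definition empty_rc : rigged := Rigged (fun _ => [::]) (fun _ _ => [::]).

(** * Maps on rigged configurations *)

Definition lh_mult (L : {mset factor}) : {mset factor} := (L `\ (1, 1)%N)%mset.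
Definition lb_mult (r : nat) (L : {mset factor}) : {mset factor} :=
  ((1, 1)%N +` ((r.-1, 1)%N +` (L `\ (r, 1)%N)))%mset.

Lemma lh_multE B' : lh_mult (mult_array ((1, 1)%N :: B')) = mult_array B'.
Proof.
by apply/msetP => h; rewrite /lh_mult /mult_array mset_cons !msetE2 addKn.
Qed.

Lemma lb_multE r B' :
  lb_mult r (mult_array ((r, 1)%N :: B'))
  = mult_array ((1, 1)%N :: (r.-1, 1)%N :: B').
Proof.
by apply/msetP => h; rewrite /lb_mult /mult_array !mset_cons !msetE2 addKn.
Qed.

Definition singular n (L : {mset factor}) (x : rigged) (a i : nat) : bool :=
  vacancy n L (nu x) a i \in J x a i.

(* ell a is l^{(a)}, and None once the search has stopped.  A singular        *)
(* J^{(a,i)} is nonempty, so that i is at most the size of nu^{(a)}.          *)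
Fixpoint ell n (L : {mset factor}) (x : rigged) (a : nat) : option nat :=
  if a is a'.+1 then
    if ell n L x a' is Some l then
      ohead [seq i <- iota l (sumn (nu x a)).+1 | singular n L x a i]
    else None
  else Some 1%N.

Definition selected n (L : {mset factor}) (x : rigged) (a : nat) : option nat :=
  if (0 < a < n)%N then ell n L x a else None.

Definition remove_box (l : nat) (s : seq nat) : seq nat :=
  sort geq [seq i <- l.-1 :: rem l s | (0 < i)%N].

Definition delta n (L : {mset factor}) (x : rigged) : rigged :=
  let nu' a :=
    if selected n L x a is Some l then remove_box l (nu x a) else nu x a in
  let J' a i :=
    if selected n L x a is Some l then
      if i == l then rem (vacancy n L (nu x) a i) (J x a i)
      else if (0 < i)%N && (i == l.-1) then
        sort >=%R (vacancy n (lh_mult L) nu' a i :: J x a i)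
      else J x a i
    else J x a i in
  Rigged nu' J'.

Definition ls_rc (x : rigged) : rigged := x.

(* L is the multiplicity array of the source B^{r,1} (x) B'.                  *)
Definition lb_rc n (r : nat) (L : {mset factor}) (x : rigged) : rigged :=
  let nu' a := if (0 < a < r)%N then sort geq (1%N :: nu x a) else nu x a in
  let J' a i :=
    if (0 < a < r)%N && (i == 1)%N then
      sort >=%R (vacancy n (lb_mult r L) nu' a i :: J x a i)
    else J x a i in
  Rigged nu' J'.

(** * Families of maps *)

Definition map_family (n : nat) : Type :=
  forall (B : seq factor), valid n B ->
  forall (lambda : n.-tuple nat), P B lambda -> RC (mult_array B) lambda.

(* Elements of RC(L, lambda) are compared through their underlying (nu, J).   *)
(* For delta this is equality in the union of the RC(lh(L), mu); for ls_rc    *)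
(* and lb_rc it is equality in RC(ls(L), lambda) and RC(lb(L), lambda).       *)
Definition compatible (n : nat) (Phi : map_family n) : Prop :=
  [/\ forall v lambda (b : P [::] lambda),
        sval (@Phi [::] v lambda b) = empty_rc,
      forall B' v v' lambda (b : P ((1, 1)%N :: B') lambda),
        delta n (mult_array ((1, 1)%N :: B'))
          (sval (@Phi ((1, 1)%N :: B') v lambda b))
        = sval (@Phi B' v' _ (lh b)),
      forall r s B' v v' lambda (b : P ((r, s.+2) :: B') lambda),
        ls_rc (sval (@Phi ((r, s.+2) :: B') v lambda b))
        = sval (@Phi ((r, 1)%N :: (r, s.+1) :: B') v' lambda (ls b)) &
      forall r B' v v' lambda (b : P ((r.+2, 1)%N :: B') lambda),
        lb_rc n r.+2 (mult_array ((r.+2, 1)%N :: B'))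
          (sval (@Phi ((r.+2, 1)%N :: B') v lambda b))
        = sval (@Phi ((1, 1)%N :: (r.+1, 1)%N :: B') v' lambda (lb b))].

(* Main.v *)
(* Quantifying over the tableaux t can be replaced by a system of linear      *)
(* inequalities: (nu, J) has admissible lower bounds iff, for every chain of  *)
(* strings (j_b, x_b), ..., (j_a, x_a) at consecutive nodes b, ..., a,        *)
(*   sum_k x_k + sum_k max(j_k - j_{k+1}, 0) + min(j_a, lambda_{a+1}) >= 0.   *)
(* As a function of one length j_k, with label p_{j_k} (up to a constant),    *)
(* the left-hand side is concave between the lengths of strings of nu^(k):    *)
(* its convex kinks are compensated by the bends of the vacancy numbers at    *)
(* the lengths of neighbouring strings.  Hence the inequalities survive when  *)
(* delta, or its inverse, moves one box at a time from node to node.          *)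
(*   A column of height r is removed by r successive searches, started at     *)
(* the nodes r, ..., 1; the k-th one is delta after lb_rc.  Singularity in    *)
(* terms of the selected lengths l^k_a shows that l^k_a >= l^{k+1}_{a+1},     *)
(* so that the ranks increase along a column.  For two adjacent columns with  *)
(* selected lengths l^k_a and m^k_a, both the absence of singular strings of  *)
(* length < s at node r and the weak increase along the rows are equivalent   *)
(* to m^k_a < l^k_a.                                                          *)
Require Import Defs.
From mathcomp Require Import all_boot all_order all_algebra zify.
From mathcomp Require Import finmap multiset.
From Stdlib Require Import FunctionalExtensionality ProofIrrelevance.
From Stdlib Require Import IndefiniteDescription.

Set Implicit Arguments.
Unset Strict Implicit.
Unset Printing Implicit Defensive.

Import Order.TTheory GRing.Theory Num.Theory.
Local Open Scope ring_scope.

(** * Concavity and chains of strings *)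

(** The maps are built as one relation [Rel] between paths and states, a state being a family of
    multisets of labelled strings. Columns are peeled off from left to right, and each column from
    the bottom entry upwards. The basic move is [step]: one box leaves a column of height [k], and
    one box leaves a string at each of the nodes [k], ..., [r - 1], where [r] is the removed letter.

    A [step] mentions no search. It is symmetric: the changed strings are singular before and after,
    the other strings are untouched, and all labels respect the vacancy numbers on both sides.
    Validity afterwards forces the selected strings to be the first singular ones ([step_nonsing]).
    Validity before forces the inverse move to take the longest possible ones ([step_nonsing']).
    Hence steps exist and are deterministic in both directions ([step_down], [step_det]; [step_up]
    and [step_up_det] for a given [r]).

    Membership in RC requires upper and lower bounds on the labels. Upper bounds are part of [step].
    Lower bounds become the chain inequalities [chain_cond]: [admissible_chain] is a shortest-path
    duality in which the columns of t are the potentials. Concavity carries these inequalities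
    through a step ([rc_down], [rc_up]).

    The tableau conditions match the steps. Strict columns come from [step_next] and [col_ranks],
    with [step_extra] for the converse. Weakly increasing rows come from [pair_le] and
    [pair_nonsing]. So every path has a state and every state a path, uniquely up to order
    ([rel_exists], [rel_path], [rel_det], [rel_inj]), which gives the bijection.

    Compatibility holds because [delta] and [lb_rc] act on states as a step and as [lbS]
    ([delta_rep], [step_lb], [lb_rep]). Uniqueness follows from injectivity of [delta] at fixed
    weight and of [lb_rc], by induction on the size of the factors. *)

Lemma concave_left (g : nat -> int) (u v : nat) :
  (forall i, (u < i < v)%N -> g i.-1 + g i.+1 <= 2 * g i) ->
  0 <= g u -> -1 <= g v -> forall w, (u <= w < v)%N -> 0 <= g w.
Proof.
move=> cg gu; elim: v cg => [|v IH] cg gv w; first by lia.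
case: (leqP v u) => [vu uw|uv]; first by have -> : w = u by lia.
(* By integrality a negative [g v] is at most -1, hence at most [g v.+1]. Concavity then makes [g]
   nondecreasing from [u] on, so [g u] would be negative too. *)
have gv0 : 0 <= g v.
  rewrite leNgt; apply/negP => gvlt.
  have mono : forall d, (d <= v - u)%N -> g (v - d)%N <= g (v - d).+1.
    elim=> [|d IHd] dle; first by rewrite subn0; lia.
    have := IHd (ltnW dle).
    have -> : (v - d.+1).+1 = (v - d)%N by lia.
    have := cg (v - d)%N; have -> : (v - d).-1 = (v - d.+1)%N by lia.
    by move=> /(_ ltac:(lia)); lia.
  have noninc : forall d, (d <= v - u)%N -> g (v - d)%N <= g v.
    elim=> [|d IHd] dle; first by rewrite subn0.
    have := mono d.+1 dle; have -> : (v - d.+1).+1 = (v - d)%N by lia.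
    by have := IHd (ltnW dle); lia.
  by have := noninc (v - u)%N (leqnn _); rewrite subKn 1?ltnW //; lia.
rewrite ltnS => /andP[uw]; rewrite leq_eqVlt => /predU1P[-> //|wv].
by apply: IH; [move=> i ?; apply: cg; lia| lia | rewrite uw].
Qed.

Lemma concave_right (g : nat -> int) (u v : nat) :
  (forall i, (u < i < v)%N -> g i.-1 + g i.+1 <= 2 * g i) ->
  -1 <= g u -> 0 <= g v -> forall w, (u < w <= v)%N -> 0 <= g w.
Proof.
move=> cg gu gv w /andP[uw wv].
have vw : (v - (v - w))%N = w by lia.
rewrite -vw; apply: (@concave_left (fun i => g (v - i)%N) 0 (v - u)).
- move=> i iP; have iP' : (u < v - i < v)%N by lia.
  have := cg _ iP'.
  have -> : (v - i.-1)%N = (v - i).+1 by lia.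
  have -> : (v - i.+1)%N = (v - i).-1 by lia.
  by rewrite addrC.
- by rewrite subn0.
- by rewrite subKn //; lia.
- by lia.
Qed.

Lemma concave_ray (g : nat -> int) (u v : nat) : (u <= v)%N ->
  (forall i, (u < i <= v)%N -> g i.-1 + g i.+1 <= 2 * g i) ->
  g v <= g v.+1 -> g u <= g v.
Proof.
move=> uv cg gv.
have mono : forall d, (d <= v - u)%N -> g (v - d)%N <= g (v - d).+1.
  elim=> [|d IHd] dle; first by rewrite subn0.
  have := IHd (ltnW dle).
  have -> : (v - d.+1).+1 = (v - d)%N by lia.
  have := cg (v - d)%N; have -> : (v - d).-1 = (v - d.+1)%N by lia.
  by move=> /(_ ltac:(lia)); lia.
have noninc : forall d, (d <= v - u)%N -> g (v - d)%N <= g v.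
  elim=> [|d IHd] dle; first by rewrite subn0.
  have := mono d.+1 dle; have -> : (v - d.+1).+1 = (v - d)%N by lia.
  by have := IHd (ltnW dle); lia.
by have := noninc (v - u)%N (leqnn _); rewrite subKn.
Qed.

Definition string := (nat * int)%type.
Definition len (t : string) : nat := t.1.
Definition lab (t : string) : int := t.2.
Arguments len !t /.
Arguments lab !t /.
(* S a lists the strings (length, label) at node a, in any order. *)
Definition state := nat -> seq string.

Definition boxes (s : seq string) (i : nat) : int :=
  \sum_(t <- s) (minn i (len t))%:Z.
Definition fboxes (B : seq factor) (a i : nat) : int :=
  \sum_(h <- B | h.1 == a) (minn i h.2)%:Z.
Definition vac (B : seq factor) (S : state) (a i : nat) : int :=
  fboxes B a i - 2 * boxes (S a) i + boxes (S a.+1) i + boxes (S a.-1) i.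
Definition smult (s : seq string) (i : nat) : nat := count (fun t => len t == i) s.
Definition ssize (s : seq string) : nat := \sum_(t <- s) len t.

Lemma boxes_cons t s i : boxes (t :: s) i = (minn i (len t))%:Z + boxes s i.
Proof. exact: big_cons. Qed.

Lemma smult_cons t s i : smult (t :: s) i = ((len t == i) + smult s i)%N.
Proof. by []. Qed.

Lemma boxes_cat s s' i : boxes (s ++ s') i = boxes s i + boxes s' i.
Proof. exact: big_cat. Qed.

Lemma perm_boxes s s' i : perm_eq s s' -> boxes s i = boxes s' i.
Proof. by move=> ss'; apply: perm_big. Qed.

Lemma perm_ssize s s' : perm_eq s s' -> ssize s = ssize s'.
Proof. by move=> ss'; apply: perm_big. Qed.

Lemma boxes0 s : boxes s 0 = 0.
Proof. by rewrite /boxes big1 // => t _; rewrite min0n. Qed.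

Lemma fboxes0 B a : fboxes B a 0 = 0.
Proof. by rewrite /fboxes big1 // => t _; rewrite min0n. Qed.

Lemma vac0 B S a : vac B S a 0 = 0.
Proof. by rewrite /vac fboxes0 !boxes0. Qed.

Lemma boxes_conv s i : (0 < i)%N ->
  boxes s i.-1 + boxes s i.+1 = 2 * boxes s i - (smult s i)%:Z.
Proof.
move=> i0; elim: s => [|t s IH]; first by rewrite /boxes !big_nil.
rewrite !boxes_cons smult_cons.
case: t => j x /=. move: IH.
by move: (boxes s i.-1) (boxes s i) (boxes s i.+1) (smult s i) => a b c d; lia.
Qed.

Lemma fboxes_conv B a i : (0 < i)%N ->
  fboxes B a i.-1 + fboxes B a i.+1 <= 2 * fboxes B a i.
Proof.
move=> i0; rewrite /fboxes; elim: B => [|t s IH]; first by rewrite !big_nil.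
rewrite !big_cons; case: (t.1 == a) => //; move: IH.
move: (\sum_(h <- s | _) _) (\sum_(h <- s | _) _) (\sum_(h <- s | _) _).
by lia.
Qed.

Lemma boxes_large s i : (ssize s <= i)%N -> boxes s i = (ssize s)%:Z.
Proof.
elim: s => [|t s IH]; first by rewrite /boxes /ssize !big_nil.
rewrite boxes_cons /ssize !big_cons -/(ssize s) => h.
by rewrite IH; lia.
Qed.

Lemma ssize_mem s t : t \in s -> (len t <= ssize s)%N.
Proof.
elim: s => // u s IH; rewrite inE /ssize big_cons -/(ssize s).
by case/predU1P => [->|/IH]; lia.
Qed.

Lemma smult_mem s t : t \in s -> (0 < smult s (len t))%N.
Proof. by move=> ts; rewrite -has_count; apply/hasP; exists t. Qed.

Lemma smult_gt0P s i : reflect (exists x, (i, x) \in s) (0 < smult s i)%N.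
Proof.
rewrite -has_count; apply: (iffP hasP) => [[[j x] js /= /eqP <-]|[x xs]].
  by exists x.
by exists (i, x) => /=.
Qed.

(* g is the contribution of the nodes below q to the chain inequality, as a   *)
(* function of the length of the string chosen at node q; the chain may start *)
(* at q itself.  Symmetrically for rfun and the nodes above q.                *)
Inductive lfun (S : state) : nat -> (nat -> int) -> Prop :=
| Lfun0 q : lfun S q (fun _ => 0)
| LfunS q g s : lfun S q g -> s \in S q ->
    lfun S q.+1 (fun j => g (len s) + lab s + (len s - j)%N%:Z).

Inductive rfun (S : state) (Lam : nat -> nat) : nat -> (nat -> int) -> Prop :=
| Rfun0 q : rfun S Lam q (fun j => (minn j (Lam q))%:Z)
| RfunS q g s : rfun S Lam q.+1 g -> s \in S q.+1 ->
    rfun S Lam q (fun j => (j - len s)%N%:Z + lab s + g (len s)).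

Definition chain_cond (S : state) (Lam : nat -> nat) : Prop :=
  forall q g s, lfun S q g -> s \in S q ->
    0 <= g (len s) + lab s + (minn (len s) (Lam q))%:Z.

(** A chain may be cut at any of its nodes: induction on the right part moves the cut up to the top
    node. *)
Lemma chain_pivot S Lam : chain_cond S Lam ->
  forall q gl gr s, lfun S q gl -> rfun S Lam q gr -> s \in S q ->
    0 <= gl (len s) + lab s + gr (len s).
Proof.
move=> ok q gl gr s lP rP; elim: rP gl s lP => {q gr} [q|q g s1 _ IH s1P] gl s lP sP.
  exact: ok lP sP.
by have := IH _ _ (LfunS lP sP) s1P; lia.
Qed.

Lemma lfun_below S S' q g : (forall a, (a < q)%N -> S' a =i S a) ->
  lfun S' q g -> lfun S q g.
Proof.
move=> SS' lP; elim: lP SS' => {q g} [q _|q g s _ IH sP SS']; first exact: Lfun0.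
by apply: LfunS; [apply: IH => a aq; apply: SS'; lia | rewrite -SS'].
Qed.

(** A chain of [S'] avoiding node [q] is a chain of [S]. One through [q] has both its sides in [S],
    so only the pivot string at [q] is new. *)
Lemma chain_update S S' Lam q : chain_cond S Lam ->
  (forall a, a != q -> S' a =i S a) ->
  (forall gl gr s, lfun S q gl -> rfun S Lam q gr -> s \in S' q ->
     0 <= gl (len s) + lab s + gr (len s)) ->
  chain_cond S' Lam.
Proof.
move=> ok SS' piv.
have main a gl : lfun S' a gl -> (q <= a)%N ->
    forall gr s, rfun S Lam a gr -> s \in S' a -> 0 <= gl (len s) + lab s + gr (len s).
  elim=> {a gl} [a|a g s lP IH sP] qa gr t rP tP.
    have [aq|aq] := eqVneq a q.
      by subst a; apply: (piv _ _ _ (Lfun0 _ _) rP tP).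
    by apply: (chain_pivot ok (Lfun0 _ _) rP); rewrite -SS'.
  have [aq|aq] := eqVneq a.+1 q.
    subst q; have sS : s \in S a by rewrite -SS' //; lia.
    have lS : lfun S a g by apply: lfun_below lP => b ?; apply: SS'; lia.
    exact: (piv _ _ _ (LfunS lS sS) rP tP).
  have tS : t \in S a.+1 by rewrite -SS'.
  by have := IH ltac:(lia) _ _ (RfunS rP tS) sP; lia.
move=> a g s lP sP; case: (leqP q a) => [qa|aq].
  exact: (main _ _ lP qa _ _ (Rfun0 _ _ _) sP).
apply: ok; last by rewrite -SS' //; lia.
by apply: lfun_below lP => b ?; apply: SS'; lia.
Qed.

Lemma lfun_nonneg0 S Lam q g : chain_cond S Lam -> lfun S q g -> 0 <= g 0%N.
Proof.
move=> ok; case=> {q g} [q|q g s lP sP] //.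
by have := ok _ _ _ lP sP; lia.
Qed.

Lemma rfun_nonneg0 S Lam q g : chain_cond S Lam -> rfun S Lam q g -> 0 <= g 0%N.
Proof.
move=> ok; case=> {q g} [q|q g s lP sP]; first by lia.
by have := chain_pivot ok (Lfun0 _ _) lP sP; lia.
Qed.

Lemma lfun_conv S q g i : lfun S q g -> (0 < i)%N ->
  g i.-1 + g i.+1 <= 2 * g i + (smult (S q.-1) i)%:Z.
Proof.
case=> {q g} [q|q g s _ sP] i0 /=; first by lia.
have [E|] := eqVneq (len s) i; last by lia.
by have := smult_mem sP; rewrite E; lia.
Qed.

Lemma rfun_conv S Lam q g i : rfun S Lam q g -> (0 < i)%N ->
  g i.-1 + g i.+1 <= 2 * g i + (smult (S q.+1) i)%:Z.
Proof.
case=> {q g} [q|q g s _ sP] i0 /=; first by lia.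
have [E|] := eqVneq (len s) i; last by lia.
by have := smult_mem sP; rewrite E; lia.
Qed.

(* Concavity of the chain inequality as a function of the length at node q, *)
(* away from the lengths already present there: the kinks of gl and gr sit  *)
(* at lengths of neighbouring strings, where the vacancy number bends down. *)
Lemma gap_conv B S T Lam q gl gr d i :
  lfun T q gl -> rfun T Lam q gr -> (0 < i)%N -> smult (S q) i = 0%N ->
  (smult (T q.-1) i <= smult (S q.-1) i)%N ->
  (smult (T q.+1) i <= smult (S q.+1) i)%N ->
  let G j := gl j + (vac B S q j + d) + gr j in
  G i.-1 + G i.+1 <= 2 * G i.
Proof.
move=> lP rP i0 m0 ml mr /=.
have := lfun_conv lP i0; have := rfun_conv rP i0.
have := fboxes_conv B q i0; have := boxes_conv (S q) i0.
have := boxes_conv (S q.+1) i0; have := boxes_conv (S q.-1) i0.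
rewrite /vac m0; move: ml mr.
move: (smult (T _) _) (smult (T _) _) (smult (S _) _) (smult (S _) _).
move: (boxes (S q.-1) i.-1) (boxes (S q.-1) i.+1) (boxes (S q.-1) i).
move: (boxes (S q.+1) i.-1) (boxes (S q.+1) i.+1) (boxes (S q.+1) i).
move: (boxes (S q) i.-1) (boxes (S q) i.+1) (boxes (S q) i).
move: (fboxes B q i.-1) (fboxes B q i.+1) (fboxes B q i).
by lia.
Qed.

(** * Removing a box from consecutive nodes *)

Lemma prev_len (s : seq string) m : (0 < m)%N ->
  exists2 u, (u < m)%N & (u = 0%N \/ exists x, (u, x) \in s) /\
    (forall i, (u < i < m)%N -> smult s i = 0%N).
Proof.
elim: m => // m IH _; case: m IH => [_|m /(_ isT) [u um [us gap]]].
  by exists 0%N => //; split; [left | move=> i; lia].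
have [/smult_gt0P[x xs]|m0] := boolP (0 < smult s m.+1)%N.
  by exists m.+1 => //; split; [right; exists x | move=> i; lia].
exists u; first by lia.
split=> // i iP; have [->|im] := eqVneq i m.+1; first by lia.
by apply: gap; lia.
Qed.

Lemma next_len (s : seq string) m :
  (exists2 v, (m <= v)%N & (exists x, (v, x) \in s) /\
     (forall i, (m <= i < v)%N -> smult s i = 0%N))
  \/ (forall i, (m <= i)%N -> smult s i = 0%N).
Proof.
have [d dE] : exists d, (ssize s < m + d)%N by exists (ssize s).+1; lia.
elim: d m dE => [|d IH] m dE.
  right=> i mi; apply/eqP; rewrite -leqn0 leqNgt; apply/smult_gt0P => -[x xs].
  by have := ssize_mem xs; rewrite /=; lia.
have [/smult_gt0P[x xs]|m0] := boolP (0 < smult s m)%N.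
  by left; exists m => //; split; [exists x | move=> i; lia].
have m0' i : (m <= i)%N -> (m.+1 <= i)%N \/ smult s i = 0%N.
  by move=> mi; have [->|im] := eqVneq i m; [right|left]; lia.
have dE' : (ssize s < m.+1 + d)%N by lia.
have [[v mv [xs gap]]|gap] := IH _ dE'.
  left; exists v; first by lia.
  by split=> // i iP; have [|?|//] := m0' i; [lia|apply: gap; lia].
by right=> i /m0'[/gap|].
Qed.

Definition addcol (k : nat) (B : seq factor) : seq factor :=
  if k is 0 then B else (k, 1%N) :: B.

(** A string shortened to length 0 disappears. *)
Definition short (i : nat) (x : int) : seq string :=
  if i is 0 then [::] else [:: (i, x)].

(* Lengths at nodes a >= r are regarded as infinite. *)
Definition reached (r : nat) (l : nat -> nat) (a i : nat) : bool :=
  (a < r)%N && (l a <= i)%N.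

(** The number of letters greater than [a] in the path all of whose columns read 1, 2, ..., up to
    their height. *)
Definition deficit (B : seq factor) (a : nat) : nat :=
  (\sum_(h <- B) (h.1 - a) * h.2)%N.

Section Nodes.
Variable n : nat.

(** [R] holds the strings common to [S] and [S']. The labels [x] and [y] stay arbitrary because
    vacancy numbers depend only on lengths: [ps_vac] must be available before the new labels can be
    shown to be singular. *)
Record prestep k r l (x y : nat -> int) (R S S' : state) : Prop := Prestep {
  ps_k : (0 < k)%N;
  ps_kr : (k <= r)%N;
  ps_rn : (r <= n)%N;
  ps_l1 : forall a, (a < k)%N -> l a = 1%N;
  ps_mono : forall a, (a.+1 < r)%N -> (l a <= l a.+1)%N;
  ps_S : forall a, (k <= a < r)%N -> perm_eq (S a) ((l a, x a) :: R a);
  ps_S' : forall a, (k <= a < r)%N -> perm_eq (S' a) (short (l a).-1 (y a) ++ R a);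
  ps_S0 : forall a, ~~ (k <= a < r)%N -> perm_eq (S a) (R a);
  ps_S0' : forall a, ~~ (k <= a < r)%N -> perm_eq (S' a) (R a) }.

Definition valid_labels B (S : state) : Prop :=
  forall a s, s \in S a -> lab s <= vac B S a (len s).

(* S' is obtained from S by the search of delta started at node k with        *)
(* initial length 1; this removes a box from the factor B^{k,1}.              *)
Record step B k r l (R S S' : state) : Prop := Step {
  st_pre : prestep k r l (fun a => vac (addcol k B) S a (l a))
             (fun a => vac (addcol k.-1 B) S' a (l a).-1) R S S';
  st_val : valid_labels (addcol k B) S;
  st_val' : valid_labels (addcol k.-1 B) S' }.

Lemma boxes_short i x j : boxes (short i x) j = (minn j i)%:Z.
Proof.
by case: i => [|i]; rewrite /boxes ?big_nil ?big_seq1 ?minn0.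
Qed.

Lemma ssize_short i x : ssize (short i x) = i.
Proof. by case: i => [|i]; rewrite /ssize ?big_nil ?big_seq1. Qed.

Lemma fboxes_col k B a i :
  fboxes (addcol k B) a i = ((0 < k)%N && (k == a))%N%:Z * (minn i 1)%:Z + fboxes B a i.
Proof.
case: k => [|k]; first by rewrite mul0r add0r.
by rewrite /fboxes big_cons /=; case: (_ == a); rewrite ?mul1r ?mul0r ?add0r.
Qed.

Lemma deficit_col k B a : deficit (addcol k B) a = (k - a + deficit B a)%N.
Proof.
by case: k => [|k]; rewrite ?sub0n // /deficit big_cons /= muln1.
Qed.

Section Prestep.
Variables (k r : nat) (l : nat -> nat) (x y : nat -> int) (R S S' : state).
Hypothesis st : prestep k r l x y R S S'.

Lemma ps_lpos a : (a < r)%N -> (0 < l a)%N.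
Proof.
elim: a => [|a IH] ar; first by rewrite (ps_l1 st) // (ps_k st).
by have := ps_mono st ar; have := IH (ltnW ar); lia.
Qed.

Lemma ps_le a b : (a <= b)%N -> (b < r)%N -> (l a <= l b)%N.
Proof.
elim: b => [|b IH]; first by rewrite leqn0 => /eqP->.
rewrite leq_eqVlt => /predU1P[->//|ab] br.
by have := ps_mono st br; have := IH ab (ltnW br); lia.
Qed.

Lemma ps_boxes a i :
  boxes (S a) i = boxes (S' a) i + ((k <= a)%N && reached r l a i)%:Z.
Proof.
have [ar|ar] := boolP (k <= a < r)%N; last first.
  rewrite (perm_boxes _ (ps_S0 st ar)) (perm_boxes _ (ps_S0' st ar)).
  by rewrite /reached; lia.
have ar' : (a < r)%N by lia.
have := ps_lpos ar'.
rewrite (perm_boxes _ (ps_S st ar)) (perm_boxes _ (ps_S' st ar)).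
by rewrite boxes_cons boxes_cat boxes_short /reached /=; lia.
Qed.

Lemma ps_ssize a : ssize (S a) = (ssize (S' a) + (k <= a < r))%N.
Proof.
have [ar|ar] := boolP (k <= a < r)%N; last first.
  by rewrite (perm_ssize (ps_S0 st ar)) (perm_ssize (ps_S0' st ar)) addn0.
have ar' : (a < r)%N by lia.
have := ps_lpos ar'.
rewrite (perm_ssize (ps_S st ar)) (perm_ssize (ps_S' st ar)).
rewrite /ssize big_cons big_cat /= -/(ssize (short _ _)) ssize_short.
by move: (\sum_(i <- _) _)%N => z; lia.
Qed.

(** Setting [l a = 1] below [k] makes one formula cover all nodes: there the [reached] terms
    reproduce the replacement of the column of height [k] by one of height [k - 1]. *)
Lemma ps_vac B a i : (0 < a)%N ->
  vac (addcol k.-1 B) S' a i = vac (addcol k B) S a i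
    + 2 * (reached r l a i)%:Z - (reached r l a.-1 i)%:Z - (reached r l a.+1 i)%:Z.
Proof.
move=> a0; rewrite /vac !fboxes_col !ps_boxes.
have k0 := ps_k st; have kr := ps_kr st; have l1 := ps_l1 st.
have E b : (b < k)%N -> reached r l b i = (0 < i)%N.
  by move=> bk; rewrite /reached l1 //; lia.
have := E a; have := E a.-1; have := E a.+1.
move: (reached r l a i) (reached r l a.-1 i) (reached r l a.+1 i) => b1 b2 b3.
move: (boxes (S' a) i) (boxes (S' a.-1) i) (boxes (S' a.+1) i) (fboxes B a i).
move=> z1 z2 z3 z4.
have [ka|ka] := eqVneq k a.
  subst k; rewrite leqnn.
  have -> : (a <= a.-1)%N = false by lia.
  have -> : (a <= a.+1)%N by lia.
  have -> : (a.-1 == a) = false by lia.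
  by rewrite andbF /=; lia.
have [ka'|ka'] := eqVneq k.-1 a.
  have -> : (k <= a)%N = false by lia.
  have -> : (k <= a.-1)%N = false by lia.
  have -> : (k <= a.+1)%N by lia.
  by lia.
have -> : (k <= a.+1)%N = (k <= a)%N by lia.
have -> : (k <= a.-1)%N = (k <= a)%N by lia.
by case: leqP; lia.
Qed.

Lemma ps_memS a s : s \in S a -> (k <= a < r)%N && (s == (l a, x a)) \/ s \in R a.
Proof.
have [ar|ar] := boolP (k <= a < r)%N; last first.
  by rewrite (perm_mem (ps_S0 st ar)); right.
rewrite (perm_mem (ps_S st ar)) inE => /predU1P[->|]; last by right.
by left; rewrite eqxx andbT.
Qed.

Lemma ps_memS' a s : s \in S' a ->
  [&& (k <= a < r)%N, (1 < l a)%N & s == ((l a).-1, y a)] \/ s \in R a.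
Proof.
have [ar|ar] := boolP (k <= a < r)%N; last first.
  by rewrite (perm_mem (ps_S0' st ar)); right.
rewrite (perm_mem (ps_S' st ar)) mem_cat => /orP[|]; last by right.
case E: (l a) => [|[|m]] //=; rewrite inE => ?; by left.
Qed.

Lemma ps_memR a s : s \in R a -> s \in S a.
Proof.
have [ar|ar] := boolP (k <= a < r)%N; last first.
  by rewrite (perm_mem (ps_S0 st ar)).
by rewrite (perm_mem (ps_S st ar)) inE => ->; rewrite orbT.
Qed.

Lemma ps_memR' a s : s \in R a -> s \in S' a.
Proof.
have [ar|ar] := boolP (k <= a < r)%N; last first.
  by rewrite (perm_mem (ps_S0' st ar)).
by rewrite (perm_mem (ps_S' st ar)) mem_cat => ->; rewrite orbT.
Qed.

Lemma reachedS a i : reached r l a.+1 i -> reached r l a i.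
Proof.
rewrite /reached => /andP[ar li]; have := ps_mono st ar; lia.
Qed.

End Prestep.

Section StepProps.
Variables (B : seq factor) (k r : nat) (l : nat -> nat) (R S S' : state).
Hypothesis st : step B k r l R S S'.
Let ps := st_pre st.

Lemma step_memS a : (k <= a < r)%N -> (l a, vac (addcol k B) S a (l a)) \in S a.
Proof. by move=> ar; rewrite (perm_mem (ps_S ps ar)) mem_head. Qed.

Lemma step_memS' a : (k <= a < r)%N -> (1 < l a)%N ->
  ((l a).-1, vac (addcol k.-1 B) S' a (l a).-1) \in S' a.
Proof.
move=> ar la; rewrite (perm_mem (ps_S' ps ar)) mem_cat.
by move: la; case: (l a) => [|[|m]] //= _; rewrite mem_head.
Qed.

(** Between [l a.-1] and [l a] the vacancy number drops by one during the step, so an untouched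
    singular string there would violate the bound in [S']. For [a = r] the interval is unbounded,
    which is why the search stops at [r]. *)
Lemma step_nonsing a s : (k <= a <= r)%N -> s \in S a -> (l a.-1 <= len s)%N ->
  ((a < r)%N -> (len s < l a)%N) -> lab s < vac (addcol k B) S a (len s).
Proof.
move=> ar sS ls sl; have k0 := ps_k ps; have [/andP[ar' /eqP sE]|sR] := ps_memS ps sS.
  by move: sl; rewrite sE /= => /(_ ltac:(lia)); lia.
have := st_val' st (ps_memR' ps sR); rewrite (ps_vac ps) //; last by lia.
have -> : reached r l a (len s) = false by rewrite /reached; lia.
have -> : reached r l a.-1 (len s) by rewrite /reached; lia.
have -> : reached r l a.+1 (len s) = false.
  by apply: contraTF isT => /(reachedS ps); rewrite /reached; lia.
by move: (vac _ _ _ _) => z; lia.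
Qed.

(** Mirror image: from [l a] up to [l a.+1] the vacancy number rises by one, so a label valid in [S]
    is no longer singular in [S']. *)
Lemma step_nonsing' a s : (k.-1 <= a < r)%N -> (0 < a)%N -> s \in S' a ->
  (l a <= len s)%N -> ((a.+1 < r)%N -> (len s < l a.+1)%N) ->
  lab s < vac (addcol k.-1 B) S' a (len s).
Proof.
move=> ar a0 sS ls sl; have k0 := ps_k ps.
have [/and3P[ar' la /eqP sE]|sR] := ps_memS' ps sS.
  by move: ls; rewrite sE /=; lia.
have := st_val st (ps_memR ps sR); rewrite (ps_vac ps) //.
have Ha : reached r l a (len s) by rewrite /reached; lia.
have -> : reached r l a.-1 (len s) by apply: (reachedS ps); rewrite prednK.
have -> : reached r l a.+1 (len s) = false by rewrite /reached; lia.
by rewrite Ha; move: (vac _ _ _ _) => z; lia.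
Qed.

End StepProps.

(** [c a] stands for the tail sum of the weight beyond the letter [a]. Then [rc_size] is the weight
    equation summed over the coordinates beyond [a], [rc_anti] is nonnegativity of the weight, and
    the bound in [rc_chain] is the multiplicity of the letter [q + 1]. *)
Record rc (B : seq factor) (c : nat -> nat) (S : state) : Prop := Rc {
  rc_out : forall a, ~~ (0 < a < n)%N -> S a = [::];
  rc_len : forall a s, s \in S a -> (0 < len s)%N;
  rc_size : forall a, (ssize (S a) + deficit B a)%N = c a;
  rc_anti : forall a, (c a.+1 <= c a)%N;
  rc_val : valid_labels B S;
  rc_chain : chain_cond S (fun q => c q - c q.+1)%N }.

Lemma deficit_conv B a : (0 < a)%N ->
  (deficit B a.-1 + deficit B a.+1 =
   2 * deficit B a + \sum_(h <- B | h.1 == a) h.2)%N.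
Proof.
move=> a0; rewrite /deficit; elim: B => [|h B IH]; first by rewrite !big_nil.
rewrite !big_cons; move: IH.
move: (\sum_(_ <- B) _)%N (\sum_(_ <- B) _)%N (\sum_(_ <- B) _)%N.
move: (\sum_(_ <- B | _) _)%N => u v w z.
have -> : (h.1 - a.-1 = (h.1 - a.+1) + (a < h.1)%N + (a <= h.1)%N)%N by lia.
have -> : (h.1 - a = (h.1 - a.+1) + (a < h.1)%N)%N by lia.
have -> : nat_of_bool (a <= h.1)%N = ((h.1 == a) + (a < h.1)%N)%N by lia.
move: (h.1 - a.+1)%N => e; case: (a < h.1)%N; case: (h.1 == a) => /=; nia.
Qed.

Lemma fboxes_large B a i : (\sum_(h <- B) h.2 <= i)%N ->
  fboxes B a i = (\sum_(h <- B | h.1 == a) h.2)%N%:Z.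
Proof.
rewrite /fboxes; elim: B => [|h B IH]; first by rewrite !big_nil.
rewrite !big_cons => hi.
have := IH ltac:(lia); case: (h.1 == a) => // ->.
by move: (\sum_(_ <- B | _) _)%N hi => u; lia.
Qed.

(** Past all lengths the minima are constant, and the limit is the difference of the multiplicities
    of the letters [a] and [a + 1]. *)
Lemma vac_large B c S a : (0 < a)%N ->
  (forall a, (ssize (S a) + deficit B a)%N = c a) ->
  exists N, forall i, (N <= i)%N ->
    vac B S a i = (c a.-1)%:Z + (c a.+1)%:Z - 2 * (c a)%:Z.
Proof.
move=> a0 sz.
exists (\sum_(h <- B) h.2 + ssize (S a) + ssize (S a.+1) + ssize (S a.-1))%N => i iN.
move: iN; set z := (\sum_(h <- B) h.2)%N => iN.
have zi : (z <= i)%N by lia.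
rewrite /vac fboxes_large // !boxes_large; [|lia..].
rewrite -!sz; have := deficit_conv B a0.
move: (\sum_(_ <- B | _) _)%N (deficit B _) (deficit B _) (deficit B _).
by move=> *; lia.
Qed.

Lemma chain_eqmem S S' Lam : chain_cond S Lam -> (forall a, S' a =i S a) ->
  chain_cond S' Lam.
Proof.
move=> ok SS' q g s lP sP; apply: (ok q); last by rewrite -SS'.
by apply: lfun_below lP => a _; apply: SS'.
Qed.

Lemma chain_mono S Lam Lam' : chain_cond S Lam ->
  (forall q, (Lam q <= Lam' q)%N) -> chain_cond S Lam'.
Proof.
by move=> ok LL q g s lP sP; have := ok _ _ _ lP sP; have := LL q; lia.
Qed.

End Nodes.

(** * The lower bounds are preserved *)

Section Closure.
Variable n : nat.

Section Down.
Variables (B : seq factor) (k r : nat) (l : nat -> nat) (R S S' : state).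
Variable c : nat -> nat.
Hypothesis st : step n B k r l R S S'.
Hypothesis rcS : rc n (addcol k B) c S.
Let ps := st_pre st.
Let Lam q := (c q - c q.+1)%N.
Let T q a := if (a <= q)%N then S' a else S a.

(* The vacancy numbers at node q.+1 once the boxes have been removed from the *)
(* nodes up to q.                                                            *)
Let vacT q j : (k.-1 <= q)%N -> (q < r)%N ->
  vac B (T q) q.+1 j = vac (addcol k B) S q.+1 j - (l q <= j)%N%:Z.
Proof.
move=> kq qr; rewrite /vac /T !fboxes_col /= leqnn ltnn.
have -> : (q.+2 <= q)%N = false by lia.
rewrite (ps_boxes ps q) /reached qr /=; have k0 := ps_k ps.
have [kq'|kq'] := eqVneq k q.+1.
  have -> : (k <= q)%N = false by lia.
  have -> : l q = 1%N by apply: (ps_l1 ps); lia.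
  by rewrite k0 /= ; lia.
have -> : (k <= q)%N by lia.
by rewrite andbF /=; lia.
Qed.

Let labT q s : (k.-1 <= q)%N -> (q < r)%N -> s \in S q.+1 ->
  ((q.+1 < r)%N -> (len s < l q.+1)%N) -> lab s <= vac B (T q) q.+1 (len s).
Proof.
move=> kq qr sS sl; rewrite vacT //; have := st_val st sS.
case: leqP => lq; last by lia.
have k0 := ps_k ps; have ar : (k <= q.+1 <= r)%N by lia.
by have := step_nonsing st ar sS lq sl; lia.
Qed.

(** Only the shortened string at node [q + 1] is new. With its label read as a vacancy number of
    [T q], the chain sum [G] is concave between the previous length [u] and the selected length [L].
    It is nonnegative at [u], and at least -1 at [L], since the box removed from node [q] (or the
    removed column) costs at most one there. So it is nonnegative at [L - 1]. *)
Let chainT q : (k.-1 <= q)%N -> (q < r)%N -> chain_cond (T q) Lam.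
Proof.
have k0 := ps_k ps; have rn := ps_rn ps.
elim: q => [|q IH] kq qr.
  apply: (chain_eqmem (rc_chain rcS)) => a; rewrite /T leqn0.
  have [->|//] := eqVneq a 0%N; have a0 : ~~ (k <= 0 < r)%N by lia.
  by move=> s; rewrite (perm_mem (ps_S0 ps a0)) (perm_mem (ps_S0' ps a0)).
have [kq'|kq'] := eqVneq k.-1 q.+1.
  apply: (chain_eqmem (rc_chain rcS)) => a s; rewrite /T; case: leqP => // aq.
  have a0 : ~~ (k <= a < r)%N by lia.
  by rewrite (perm_mem (ps_S0 ps a0)) (perm_mem (ps_S0' ps a0)).
have kq1 : (k.-1 <= q)%N by lia.
have qr1 : (q < r)%N by lia.
have ok := IH kq1 qr1.
apply: (chain_update ok (q := q.+1)) => [a aq s|gl gr s glP grP].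
  by rewrite /T; have -> : (a <= q.+1)%N = (a <= q)%N by lia.
rewrite {1}/T leqnn => /(ps_memS' ps) [|sR]; last first.
  apply: (chain_pivot ok glP grP).
  by rewrite /T ltnn; apply: (ps_memR ps).
move=> /and3P[ar la /eqP ->] /=.
set L := l q.+1 in la *.
have Tq : T q q.+1 = S q.+1 by rewrite /T ltnn.
have [|u uL [us gap]] := @prev_len (S q.+1) L; first by lia.
pose G j : int := gl j + (vac B (T q) q.+1 j + 0) + gr j.
have -> : vac (addcol k.-1 B) S' q.+1 L.-1 = vac B (T q) q.+1 L.-1 + 0.
  rewrite addr0 vacT // (ps_vac ps) //.
  have -> : reached r l q.+1 L.-1 = false by rewrite /reached /L; lia.
  have -> : reached r l q.+2 L.-1 = false.
    by apply: contraTF isT => /(reachedS ps); rewrite /reached /L; lia.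
  by rewrite /reached qr1 /=; move: (vac _ _ _ _) => z; lia.
rewrite -/(G L.-1); apply: (@concave_left G u L).
- move=> i iP; apply: (@gap_conv B (T q) (T q) Lam q.+1) => //; first by lia.
  by rewrite Tq; apply: gap.
- rewrite /G addr0; case: us => [->|[x xs]].
    rewrite vac0 addr0; have := lfun_nonneg0 ok glP.
    by have := rfun_nonneg0 ok grP; lia.
  have xT : (u, x) \in T q q.+1 by rewrite Tq.
  have := chain_pivot ok glP grP xT => /=.
  have /= := @labT q (u, x) kq1 qr1 xs (fun _ => uL); lia.
- have xT : (L, vac (addcol k B) S q.+1 L) \in T q q.+1.
    by rewrite Tq; apply: (step_memS st).
  have /= := chain_pivot ok glP grP xT.
  rewrite /G vacT //; case: (l q <= L)%N; lia.
- by lia.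
Qed.

Let r0 : (0 < r)%N.
Proof. by have := ps_k ps; have := ps_kr ps; lia. Qed.

Let T_S' a : T r.-1 a =i S' a.
Proof.
move=> s; rewrite /T; case: leqP => // ar; have ar' : ~~ (k <= a < r)%N by lia.
by rewrite (perm_mem (ps_S0 ps ar')) (perm_mem (ps_S0' ps ar')).
Qed.

Let chainS' : chain_cond S' Lam.
Proof.
have kr := ps_kr ps.
apply: (@chain_eqmem (T r.-1)); last by move=> a s; rewrite T_S'.
by apply: chainT; have := r0; lia.
Qed.

(* A concave function on a ray that is eventually constant is nondecreasing. *)
Let ray g : lfun (T r.-1) r g ->
  exists N, forall j, (N <= j)%N -> 0 <= g j + (c r.-1)%:Z - (c r)%:Z - 1.
Proof.
move=> gP; have kr := ps_kr ps; have k0 := ps_k ps.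
have rr : r.-1.+1 = r by have := r0; lia.
have ok : chain_cond (T r.-1) Lam by apply: chainT; lia.
have Tr : T r.-1 r = S r by rewrite /T; have -> : (r <= r.-1)%N = false by have := r0; lia.
have [N vN] := vac_large r0 (rc_size rcS).
have [C gC] : exists C, forall j, (C <= j)%N -> g j = g C.
  case: gP => [q|q g' s _ _]; first by exists 0%N.
  by exists (len s) => j ?; lia.
pose M := (N + C + l r.-1 + ssize (S r) + Lam r).+1%N.
have [|u uM [us gap]] := @prev_len (S r) M.+1; first by [].
have EvT j : vac B (T r.-1) r j = vac (addcol k B) S r j - (l r.-1 <= j)%N%:Z.
  by have := @vacT r.-1 j; rewrite rr; apply; lia.
pose G j : int := g j + (vac B (T r.-1) r j + 0) + (minn j (Lam r))%:Z.
have GM j : (M <= j)%N -> G j = g C + (c r.-1)%:Z - (c r)%:Z - 1.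
  move=> Mj; rewrite /G EvT vN ?gC; [|lia..].
  have -> : (l r.-1 <= j)%N by lia.
  by have := rc_anti rcS r; move: Mj; rewrite /M /Lam; lia.
have Gu : 0 <= G u.
  rewrite /G addr0; case: us => [->|[x xs]].
    by rewrite vac0 addr0 min0n; have := lfun_nonneg0 ok gP; lia.
  have xT : (u, x) \in T r.-1 r by rewrite Tr.
  have /= := chain_pivot ok gP (Rfun0 _ _ _) xT.
  have := @labT r.-1 (u, x); rewrite rr ltnn /= => H.
  by have := H ltac:(lia) ltac:(lia) xs ltac:(lia); lia.
exists C => j Cj; rewrite gC //.
have <- : G M = g C + (c r.-1)%:Z - (c r)%:Z - 1 by apply: GM.
suff : G u <= G M by lia.
apply: (@concave_ray G u M); first by lia.
- move=> i iP; have i0 : (0 < i)%N by lia.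
  have m0 : smult (T r.-1 r) i = 0%N by rewrite Tr; apply: gap; lia.
  exact: (gap_conv B 0 gP (Rfun0 _ Lam _) i0 m0 (leqnn _) (leqnn _)).
- by rewrite !GM //.
Qed.

Lemma rc_down : rc n (addcol k.-1 B) (fun a => c a - (a < r))%N S'.
Proof.
have k0 := ps_k ps; have kr := ps_kr ps; have rn := ps_rn ps.
(* For the empty left chain, [ray] says that the letter [r] occurs in the weight. *)
have cr : (c r < c r.-1)%N.
  by have [N /(_ N (leqnn _))] := ray (Lfun0 _ _); lia.
have cpos a : (a < r)%N -> (0 < c a)%N.
  move=> ar; apply: (@leq_trans (c r.-1)); first by lia.
  have: (a <= r.-1)%N by lia.
  elim: (r.-1) => [|b IH]; first by rewrite leqn0 => /eqP->.
  rewrite leq_eqVlt => /predU1P[->//|/IH]; have := rc_anti rcS b; lia.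
split.
- move=> a an; have ar : ~~ (k <= a < r)%N by lia.
  apply: perm_nilP; rewrite (permPl (ps_S0' ps ar)) -(permPl (ps_S0 ps ar)).
  by rewrite (rc_out rcS).
- move=> a s /(ps_memS' ps)[/and3P[_ la /eqP->]/=|sR]; first by lia.
  exact: (rc_len rcS (ps_memR ps sR)).
- move=> a; have := rc_size rcS a; rewrite (ps_ssize ps) !deficit_col; lia.
- move=> a; have := rc_anti rcS a; have [E|ne] := eqVneq a r.-1; last by lia.
  have -> : a.+1 = r by lia.
  by rewrite ltnn E; lia.
- exact: st_val' st.
move=> q g s gP sP; have base := chainS' gP sP.
(* Only the multiplicity of the letter [r] decreases, so only chains ending at node [r - 1] change.
   For these the missing inequality is [ray], with the whole chain read as a left chain of node
   [r]. *)
have [E|ne] := eqVneq q r.-1; last first.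
  suff -> : (c q - (q < r) - (c q.+1 - (q.+1 < r)) = Lam q)%N by [].
  rewrite /Lam; have := cpos q; have := cpos q.+1; have := rc_anti rcS q; lia.
have gP' : lfun (T r.-1) q g by apply: lfun_below gP => a _ t; rewrite T_S'.
have sP' : s \in T r.-1 q by rewrite T_S'.
have := LfunS gP' sP'; rewrite E; have -> : r.-1.+1 = r by lia.
move=> /ray[N /(_ (N + len s)%N)].
rewrite leq_addr => /(_ isT); move: base; rewrite /Lam E.
have -> : r.-1.+1 = r by lia.
by rewrite ltnn; lia.
Qed.

End Down.

Section Up.
Variables (B : seq factor) (k r : nat) (l : nat -> nat) (R S S' : state).
Variable c : nat -> nat.
Hypothesis st : step n B k r l R S S'.
Hypothesis rcS' : rc n (addcol k.-1 B) c S'.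
Let ps := st_pre st.
Let c' a := (c a + (a < r))%N.
Let Lam q := (c' q - c' q.+1)%N.
Let T q a := if (a < q)%N then S' a else S a.

Let c'_anti a : (c' a.+1 <= c' a)%N.
Proof. by rewrite /c'; have := rc_anti rcS' a; lia. Qed.

Let vacT q j : (k <= q)%N ->
  vac B (T q.+1) q j =
  vac (addcol k.-1 B) S' q j + (reached r l q.+1 j)%:Z.
Proof.
move=> kq; have k0 := ps_k ps; rewrite /vac /T !fboxes_col /= leqnn ltnn.
have -> : (q.-1 < q.+1)%N by lia.
rewrite (ps_boxes ps q.+1).
have -> : (k <= q.+1)%N by lia.
have -> : (k.-1 == q) = false by lia.
by rewrite andbF /=; lia.
Qed.

(** Boxes return from node [r - 1] down to [k]. The label of the lengthened string is the vacancy
    number of the intermediate state minus one, whence the -1 in [G]. The string before lengthening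
    gives -1 at [L - 1], the next string or the behaviour at infinity gives 0 to the right, and
    concavity gives 0 at [L]. *)
Let chainT d : (k + d <= r)%N -> chain_cond (T (r - d)) Lam.
Proof.
have k0 := ps_k ps; have rn := ps_rn ps.
elim: d => [|d IH] dr.
  have okS' : chain_cond S' Lam.
    by apply: (chain_mono (rc_chain rcS')) => q; rewrite /Lam /c'; lia.
  apply: (chain_eqmem okS') => a s; rewrite subn0 /T.
  case: leqP => // ar; have ar' : ~~ (k <= a < r)%N by lia.
  by rewrite (perm_mem (ps_S0 ps ar')) (perm_mem (ps_S0' ps ar')).
have dr' : (k + d <= r)%N by lia.
have ok := IH dr'.
move: ok; have -> : (r - d = (r - d.+1).+1)%N by lia.
have : (r - d.+1 < r)%N by lia.
have : (k <= r - d.+1)%N by lia.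
move: (r - d.+1)%N => q kq qr ok.
have Tq : T q.+1 q = S' q by rewrite /T leqnn.
have vT := vacT _ kq.
apply: (chain_update ok (q := q)) => [a aq s|gl gr s glP grP].
  by rewrite /T; have -> : (a < q.+1)%N = (a < q)%N by lia.
rewrite {1}/T ltnn => /(ps_memS ps)[|sR]; last first.
  apply: (chain_pivot ok glP grP).
  by rewrite Tq; apply: (ps_memR' ps).
move=> /andP[ar /eqP ->] /=.
set L := l q.
have L0 : (0 < L)%N by apply: (ps_lpos ps).
pose G j : int := gl j + (vac B (T q.+1) q j - 1) + gr j.
have Gconv i : (0 < i)%N -> smult (S' q) i = 0%N -> G i.-1 + G i.+1 <= 2 * G i.
  move=> i0 m0; apply: (@gap_conv B (T q.+1) (T q.+1) Lam q) => //.
  by rewrite Tq.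
have -> : vac (addcol k B) S q L = vac B (T q.+1) q L - 1.
  rewrite vT (ps_vac ps); last by lia.
  have HL : reached r l q L by rewrite /reached /L; lia.
  have -> : reached r l q.-1 L by apply: (reachedS ps); rewrite prednK //; lia.
  by rewrite HL; move: (vac _ _ _ _) => z; lia.
have Gu : -1 <= G L.-1.
  rewrite /G; case: (ltnP 1 L) => L1; last first.
    have -> : L.-1 = 0%N by lia.
    rewrite vac0; have := lfun_nonneg0 ok glP.
    by have := rfun_nonneg0 ok grP; lia.
  have xT := step_memS' st ar L1; rewrite -/L in xT.
  have xT' : (L.-1, vac (addcol k.-1 B) S' q L.-1) \in T q.+1 q by rewrite Tq.
  by have /= := chain_pivot ok glP grP xT'; rewrite vT; lia.
suff [v Lv [Gv gap]] : exists2 v, (L <= v)%N & 0 <= G v /\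
    (forall i, (L <= i < v)%N -> smult (S' q) i = 0%N).
  rewrite -/(G L); apply: (@concave_right G L.-1 v) => //; last by lia.
  by move=> i iP; apply: Gconv; [lia | apply: gap; lia].
have [[v Lv [[x xs] gap]]|gap] := next_len (S' q) L.
  exists v => //; split=> //; rewrite /G vT.
  have xT : (v, x) \in T q.+1 q by rewrite Tq.
  have /= := chain_pivot ok glP grP xT; have /= := st_val' st xs.
  have [rv|nrv] := boolP (reached r l q.+1 v); first by lia.
  have ar2 : (k.-1 <= q < r)%N by lia.
  have q0 : (0 < q)%N by lia.
  have /= := step_nonsing' st ar2 q0 xs Lv.
  by move: nrv; rewrite /reached; lia.
have q0 : (0 < q)%N by lia.
have [N vN] := vac_large q0 (rc_size rcS').
(* When no longer string exists, [G] is estimated far out: a left chain costs at most the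
   multiplicity of the letter [q], and a right chain eventually yields at least the new multiplicity
   of [q + 1]. These compensate the limit of the vacancy number. *)
have linf p g : lfun (T q.+1) p g -> p = q ->
    forall j, 0 <= g j + (c q.-1)%:Z - (c q)%:Z.
  case=> {p g} [q1|q1 g s1 g1P s1P] E j; have := rc_anti rcS' q.-1.
    by rewrite prednK; lia.
  have := ok _ _ _ g1P s1P; rewrite /Lam /c' -E /= => h1 h2.
  by move: h1; lia.
have rinf p g : rfun (T q.+1) Lam p g -> p = q ->
    exists K, forall j, (K <= j)%N -> (Lam q)%:Z <= g j.
  case=> {p g} [q1|q1 g s1 _ _] E; first by exists (Lam q) => j; rewrite E; lia.
  by exists (len s1 + Lam q + absz (lab s1 + g (len s1))%R)%N => j; lia.
have [K rK] := rinf _ _ grP erefl.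
exists (N + L + l q.+1 + K)%N; first by lia.
split=> [|i iP]; last by apply: gap; lia.
set M := (N + L + l q.+1 + K)%N.
have KM : (K <= M)%N by lia.
have := linf _ _ glP erefl M; have := rK _ KM.
rewrite /G vT vN; last by lia.
rewrite /Lam /c' qr; have := rc_anti rcS' q.
by rewrite /reached; case: (ltnP q.+1 r); lia.
Qed.

Lemma rc_up : rc n (addcol k B) (fun a => c a + (a < r))%N S.
Proof.
have k0 := ps_k ps; have kr := ps_kr ps; have rn := ps_rn ps.
split.
- move=> a an; have ar : ~~ (k <= a < r)%N by lia.
  apply: perm_nilP; rewrite (permPl (ps_S0 ps ar)) -(permPl (ps_S0' ps ar)).
  by rewrite (rc_out rcS').
- move=> a s /(ps_memS ps)[/andP[ar /eqP->]/=|sR].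
    by apply: (ps_lpos ps); lia.
  exact: (rc_len rcS' (ps_memR' ps sR)).
- move=> a; have := rc_size rcS' a; rewrite (ps_ssize ps) !deficit_col; lia.
- exact: c'_anti.
- exact: st_val st.
apply: (@chain_eqmem (T (r - (r - k)))); first by apply: chainT; lia.
move=> a s; rewrite subKn // /T; case: leqP => // ak.
have ar : ~~ (k <= a < r)%N by lia.
by rewrite (perm_mem (ps_S0 ps ar)) (perm_mem (ps_S0' ps ar)).
Qed.

End Up.
End Closure.

(** * Existence and determinism of steps in both directions *)

Definition is_sing B (S : state) a i := (i, vac B S a i) \in S a.

Definition first_sing B (S : state) (l a : nat) : option nat :=
  ohead [seq i <- iota l (ssize (S a)).+1 | is_sing B S a i].

Fixpoint search B (S : state) (k a : nat) : option nat :=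
  if a is a'.+1 then
    if (a < k)%N then Some 1%N else
    if search B S k a' is Some l then first_sing B S l a else None
  else Some 1%N.

Lemma first_sing_some B S l a i : (l <= i)%N -> is_sing B S a i ->
  (forall j, (l <= j < i)%N -> ~~ is_sing B S a j) -> first_sing B S l a = Some i.
Proof.
move=> li si nsi; have il := ssize_mem si; rewrite /= in il.
rewrite /first_sing; have -> : ((ssize (S a)).+1 = (i - l) + (ssize (S a) - (i - l)).+1)%N by lia.
rewrite iotaD filter_cat /= subnKC // si.
set s := filter _ _; suff -> : s = [::] by [].
apply/eqP; rewrite -[_ == _]negbK -has_filter; apply/hasPn => j.
by rewrite mem_iota => jl; apply: nsi; lia.
Qed.

Lemma first_sing_none B S l a : (forall j, (l <= j)%N -> ~~ is_sing B S a j) ->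
  first_sing B S l a = None.
Proof.
move=> ns; rewrite /first_sing; set s := filter _ _; suff -> : s = [::] by [].
apply/eqP; rewrite -[_ == _]negbK -has_filter; apply/hasPn => j.
by rewrite mem_iota => jl; apply: ns; lia.
Qed.

Lemma first_singP B S l a :
  match first_sing B S l a with
  | Some i => [/\ (l <= i)%N, is_sing B S a i
                & forall j, (l <= j < i)%N -> ~~ is_sing B S a j]
  | None => forall j, (l <= j)%N -> ~~ is_sing B S a j
  end.
Proof.
have [d] := ubnP (ssize (S a) - l); elim: d l => // d IH l dl.
have [sl|nsl] := boolP (is_sing B S a l).
  rewrite (@first_sing_some _ _ _ _ l) //; first by split=> // j; lia.
  by move=> j; lia.
have [big|small] := leqP (ssize (S a)) l.
  have ns j : (l <= j)%N -> ~~ is_sing B S a j.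
    have [->//|jl] := eqVneq j l => lj; apply/negP => /ssize_mem /=; lia.
  by rewrite first_sing_none.
have small' : (ssize (S a) - l.+1 < d)%N by lia.
have ns j : (l <= j)%N -> j = l \/ (l < j)%N by lia.
have := IH _ small'; case E: (first_sing B S l.+1 a) => [i|].
  case=> li si nsi.
  have ns' j : (l <= j < i)%N -> ~~ is_sing B S a j.
    by have [->//|jl jli] := eqVneq j l; apply: nsi; lia.
  by rewrite (@first_sing_some _ _ _ _ i) //; [split=> // | ]; lia.
move=> nsi.
have ns' j : (l <= j)%N -> ~~ is_sing B S a j by case/ns => [->|/nsi].
by rewrite first_sing_none.
Qed.

Lemma vac_perm B S S' a i : (forall b, perm_eq (S b) (S' b)) ->
  vac B S a i = vac B S' a i.
Proof. by move=> SS'; rewrite /vac !(perm_boxes _ (SS' _)). Qed.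

Section Steps.
Variable n : nat.

Lemma step_search B k r l R S S' a : step n B k r l R S S' ->
  search (addcol k B) S k a = if (a < r)%N then Some (l a) else None.
Proof.
move=> st; have ps := st_pre st.
have k0 := ps_k ps; have kr := ps_kr ps.
elim: a => [|a IH].
  by rewrite /= (ps_l1 ps) //; have -> : (0 < r)%N by lia.
rewrite [LHS]/=; case: ltnP => ak.
  by rewrite (ps_l1 ps) //; have -> : (a.+1 < r)%N by lia.
rewrite IH; case: (ltnP a r) => ar; last by have -> : (a.+1 < r)%N = false by lia.
have ns j : (l a <= j)%N -> ((a.+1 < r)%N -> (j < l a.+1)%N) ->
    ~~ is_sing (addcol k B) S a.+1 j.
  move=> lj jl; apply/negP => js; have ak' : (k <= a.+1 <= r)%N by lia.
  by have /= := step_nonsing st ak' js lj jl; rewrite ltxx.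
case: ltnP => ar'.
  apply: first_sing_some; first exact: (ps_mono ps).
    by apply: (step_memS st); lia.
  by move=> j jl; apply: ns; lia.
by apply: first_sing_none => j jl; apply: ns => //; lia.
Qed.

Lemma step_rank_inj B k r1 l1 R1 S1 S1' r2 l2 R2 S2 S2' :
  step n B k r1 l1 R1 S1 S1' -> step n B k r2 l2 R2 S2 S2' ->
  (forall a, perm_eq (S1 a) (S2 a)) -> r1 = r2 /\ forall a, (a < r1)%N -> l1 a = l2 a.
Proof.
move=> st1 st2 SS.
have EE l a : first_sing (addcol k B) S1 l a = first_sing (addcol k B) S2 l a.
  rewrite /first_sing (perm_ssize (SS a)); congr ohead.
  by apply: eq_filter => i; rewrite /is_sing (perm_mem (SS a)) (vac_perm _ _ _ SS).
have E a : search (addcol k B) S1 k a = search (addcol k B) S2 k a.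
  by elim: a => //= a ->; case: ltnP => // _; case: (search _ _ _ _).
have EE' a : (if (a < r1)%N then Some (l1 a) else None) =
    (if (a < r2)%N then Some (l2 a) else None).
  by rewrite -(step_search _ st1) -(step_search _ st2).
have rr : r1 = r2.
  have := EE' r1; have := EE' r2; rewrite !ltnn.
  by case: ltnP => // h; case: ltnP => // h' _ _; lia.
split=> // a ar; have := EE' a; rewrite -rr ar; by case.
Qed.

Lemma step_det B k r1 l1 R1 S1 S1' r2 l2 R2 S2 S2' :
  step n B k r1 l1 R1 S1 S1' -> step n B k r2 l2 R2 S2 S2' ->
  (forall a, perm_eq (S1 a) (S2 a)) -> forall a, perm_eq (S1' a) (S2' a).
Proof.
move=> st1 st2 SS; have [rr ll] := step_rank_inj st1 st2 SS.
have ps1 := st_pre st1; have ps2 := st_pre st2 => a; subst r2.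
have [ar|ar] := boolP (k <= a < r1)%N; last first.
  by rewrite (permPl (ps_S0' ps1 ar)) -(permPl (ps_S0 ps1 ar)) (permPl (SS a))
             (permPl (ps_S0 ps2 ar)) perm_sym (ps_S0' ps2 ar).
have k0 := ps_k ps1; have ar' : (a < r1)%N by lia.
rewrite (permPl (ps_S' ps1 ar)) perm_sym (permPl (ps_S' ps2 ar)) perm_sym.
rewrite !(ps_vac ps1) ?(ps_vac ps2) -?ll //; try by lia.
have HH b i : reached r1 l1 b i = reached r1 l2 b i.
  by rewrite /reached; case: ltnP => //= br; rewrite ll.
rewrite !HH (vac_perm _ _ _ SS) perm_cat2l.
have := ps_S ps1 ar; rewrite (permPl (SS a)) => h; have := ps_S ps2 ar.
by rewrite (permPl h) -ll // -(vac_perm _ _ _ SS) perm_cons.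
Qed.

(** Otherwise the string of length [l2 a - 1], singular after the second step, lies in the range
    that [step_nonsing'] forbids for the first. *)
Lemma step_up_le B k r l1 R1 S1 S1' l2 R2 S2 S2' a :
  step n B k r l1 R1 S1 S1' -> step n B k r l2 R2 S2 S2' ->
  (forall a, perm_eq (S1' a) (S2' a)) -> (k <= a < r)%N ->
  ((a.+1 < r)%N -> l1 a.+1 = l2 a.+1) -> (l2 a <= l1 a)%N.
Proof.
move=> st1 st2 SS ar ll; have ps1 := st_pre st1; have ps2 := st_pre st2.
rewrite leqNgt; apply/negP => lt12.
have k0 := ps_k ps1; have l0 := ps_lpos ps1 (a := a) ltac:(lia).
have l2gt : (1 < l2 a)%N by lia.
have := step_memS' st2 ar l2gt; rewrite -(vac_perm _ _ _ SS) -(perm_mem (SS a)) => xs.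
have ar1 : (k.-1 <= a < r)%N by lia.
have a0 : (0 < a)%N by lia.
have lle : (l1 a <= (l2 a).-1)%N by lia.
have /= := step_nonsing' st1 ar1 a0 xs lle; rewrite ltxx.
have H : (a.+1 < r)%N -> ((l2 a).-1 < l1 a.+1)%N.
  by move=> ar2; rewrite ll //; have := ps_mono ps2 ar2; lia.
by move=> /(_ H).
Qed.

Lemma step_up_det B k r l1 R1 S1 S1' l2 R2 S2 S2' :
  step n B k r l1 R1 S1 S1' -> step n B k r l2 R2 S2 S2' ->
  (forall a, perm_eq (S1' a) (S2' a)) -> forall a, perm_eq (S1 a) (S2 a).
Proof.
move=> st1 st2 SS; have ps1 := st_pre st1; have ps2 := st_pre st2.
have SS2 a : perm_eq (S2' a) (S1' a) by rewrite perm_sym.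
have k0 := ps_k ps1.
have ll a : (a < r)%N -> l1 a = l2 a.
  have [d] := ubnP (r - a); elim: d a => // d IH a dr ar.
  have [ak|ka] := ltnP a k; first by rewrite (ps_l1 ps1) // (ps_l1 ps2).
  have ar' : (k <= a < r)%N by lia.
  have IH' : (a.+1 < r)%N -> l1 a.+1 = l2 a.+1 by move=> ?; apply: IH; lia.
  have := step_up_le st1 st2 SS ar' IH'.
  have := step_up_le st2 st1 SS2 ar' (fun h => esym (IH' h)); lia.
move=> a; have [ar|ar] := boolP (k <= a < r)%N; last first.
  by rewrite (permPl (ps_S0 ps1 ar)) -(permPl (ps_S0' ps1 ar)) (permPl (SS a))
             (permPl (ps_S0' ps2 ar)) perm_sym (ps_S0 ps2 ar).
have ar' : (a < r)%N by lia.
have a0 : (0 < a)%N by lia.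
rewrite (permPl (ps_S ps1 ar)) perm_sym (permPl (ps_S ps2 ar)) perm_sym -ll //.
have HH b i : reached r l1 b i = reached r l2 b i.
  by rewrite /reached; case: ltnP => //= br; rewrite ll.
have -> : vac (addcol k B) S1 a (l1 a) = vac (addcol k B) S2 a (l1 a).
  have := ps_vac ps1 B (l1 a) a0; have := ps_vac ps2 B (l1 a) a0.
  rewrite (vac_perm _ _ _ SS) !HH; move: (vac _ _ _ _) (vac _ _ _ _) (vac _ _ _ _).
  by move=> *; lia.
rewrite perm_cons.
have := ps_S' ps1 ar; rewrite (permPl (SS a)) => h; have := ps_S' ps2 ar.
by rewrite (permPl h) -ll // (vac_perm _ _ _ SS) perm_cat2l.
Qed.

(** The search stops at the latest at the empty node [n]. A vacancy number decreases only between
    consecutive selected lengths, and by one, where minimality of the search excludes singular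
    strings. *)
Lemma step_down B k S : (0 < k <= n)%N -> valid_labels (addcol k B) S ->
  (forall a, ~~ (0 < a < n)%N -> S a = [::]) ->
  exists r l R S', step n B k r l R S S'.
Proof.
move=> kn vS Sout.
pose f a := search (addcol k B) S k a.
have fS a : (k <= a.+1)%N ->
    f a.+1 = if f a is Some l then first_sing (addcol k B) S l a.+1 else None.
  by move=> ka; rewrite /f /=; have -> : (a.+1 < k)%N = false by lia.
have f1 a : (a < k)%N -> f a = Some 1%N.
  by case: a => //= a ak; rewrite /f /= ak.
have fn : exists a, ~~ isSome (f a).
  exists n; case: (n) kn Sout => [|m] kn Sout; first by lia.
  rewrite fS; last by lia.
  case: (f m) => [l|//]; rewrite first_sing_none // => j _.
  by rewrite /is_sing Sout //; lia.
case: (ex_minnP fn) => r fr rmin.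
pose l a := odflt 1%N (f a).
have fl a : (a < r)%N -> f a = Some (l a).
  move=> ar; rewrite /l; case E: (f a) => [//|].
  by have := rmin a; rewrite E => /(_ isT); lia.
have kr : (k <= r)%N by rewrite leqNgt; apply/negP => /f1 E; rewrite E in fr.
have rn : (r <= n)%N.
  apply: rmin; case: (n) kn Sout => [|m] kn Sout; first by lia.
  rewrite fS; last by lia.
  case: (f m) => [l0|//]; rewrite first_sing_none // => j _.
  by rewrite /is_sing Sout //; lia.
have k0 : (0 < k)%N by lia.
have sel a : (k <= a < r)%N -> [/\ (l a.-1 <= l a)%N, is_sing (addcol k B) S a (l a)
    & forall j, (l a.-1 <= j < l a)%N -> ~~ is_sing (addcol k B) S a j].
  case: a => [|a] ar; first by lia.
  have := fS a ltac:(lia); rewrite !fl; try by lia.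
  by have := first_singP (addcol k B) S (l a) a.+1 => /[swap] <-.
have selr j : (l r.-1 <= j)%N -> ~~ is_sing (addcol k B) S r j.
  case E: r kr fr => [|r'] kr' fr'; first by lia.
  have := fS r' kr'; rewrite (fl r'); last by lia.
  have := first_singP (addcol k B) S (l r') r'.+1 => /[swap] <-.
  by case: (f r'.+1) fr' => //= _; apply.
have l1 a : (a < k)%N -> l a = 1%N by move=> ak; rewrite /l f1.
have lm a : (a.+1 < r)%N -> (l a <= l a.+1)%N.
  move=> ar; case: (ltnP a.+1 k) => ak; first by rewrite !l1 //; lia.
  by have [] := sel a.+1 ltac:(lia).
pose x a := vac (addcol k B) S a (l a).
pose y a := vac (addcol k B) S a (l a).-1 - (l a.-1 < l a)%N%:Z.
pose R a := if (k <= a < r)%N then rem (l a, x a) (S a) else S a.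
pose S' a := if (k <= a < r)%N then short (l a).-1 (y a) ++ R a else S a.
have pre : prestep n k r l x y R S S'.
  split=> // a ar; rewrite /S' /R ?ar ?(negPf ar) //.
  by apply: perm_to_rem; have [] := sel a ar.
have vac' a i := ps_vac pre B (a := a) i.
have y' a : (k <= a < r)%N -> y a = vac (addcol k.-1 B) S' a (l a).-1.
  move=> ar; rewrite vac'; last by lia.
  have l0 := ps_lpos pre (a := a) ltac:(lia).
  have -> : reached r l a (l a).-1 = false by rewrite /reached; lia.
  have -> : reached r l a.+1 (l a).-1 = false.
    by apply: contraTF isT => /(reachedS pre); rewrite /reached; lia.
  rewrite /y /reached; have -> : (a.-1 < r)%N by lia.
  by move: (vac _ _ _ _) => z; lia.
exists r, l, R, S'; split=> //.
  case: pre => *; split=> // a ar.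
  by rewrite -y' // /S' ar.
move=> a s sS'; have [a0|a0] := posnP a.
  by move: sS'; rewrite a0 /S' Sout //; have -> : (k <= 0 < r)%N = false by lia.
have [/and3P[ar la /eqP->]|sR] := ps_memS' pre sS'; first by rewrite y'.
have sS := ps_memR pre sR; have := vS _ _ sS; rewrite vac' //.
have [Ha|Ha] := boolP (reached r l a (len s)).
  move: (reached r l a.-1 _) (reached r l a.+1 _) => b1 b2.
  by move: (vac _ _ _ _) => z; lia.
have -> : reached r l a.+1 (len s) = false.
  by apply: contraNF Ha => /(reachedS pre).
have [Hb|Hb] := boolP (reached r l a.-1 (len s)); last first.
  by move: (vac _ _ _ _) => z; lia.
suff : lab s != vac (addcol k B) S a (len s) by move: (vac _ _ _ _) => z; lia.
have bad : is_sing (addcol k B) S a (len s) = false.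
  apply: negbTE; have [ak|ka] := ltnP a k.
    by move: Ha Hb; rewrite /reached !l1; lia.
  have [E|ne] := eqVneq a r.
    by rewrite E; apply: selr; move: Hb; rewrite /reached E; lia.
  have [|_ _] := sel a; first by move: Hb; rewrite /reached; lia.
  by apply; move: Ha Hb; rewrite /reached; lia.
apply: contraFN bad => /eqP E; rewrite /is_sing -E; by case: (s) sS.
Qed.

End Steps.

Fixpoint last_sing B (S : state) (a b : nat) : nat :=
  if b is b'.+1 then if is_sing B S a b then b else last_sing B S a b' else 0%N.

(** The recursion is on the distance [d] from the top node. The value 0 means that no singular
    string was found; a new string of length 1 is then created. *)
Fixpoint up_search B (S : state) (top d : nat) : nat :=
  last_sing B S (top - d)
    (if d is d'.+1 then up_search B S top d' else ssize (S top)).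

Lemma last_singP B S a b :
  [/\ (last_sing B S a b <= b)%N,
      last_sing B S a b = 0%N \/ is_sing B S a (last_sing B S a b)
    & forall i, (last_sing B S a b < i <= b)%N -> ~~ is_sing B S a i].
Proof.
elim: b => [|b [IH1 IH2 IH3]] /=; first by split=> [||i]; [|left|lia].
case: ifP => sb; first by split=> [||i]; [|right|lia].
split=> [||i ib]; [by lia| done |].
by have [->|ne] := eqVneq i b.+1; [rewrite sb | apply: IH3; lia].
Qed.

Section Steps.
Variable n : nat.

(** Taking the longest singular strings leaves one obstruction, at node [k - 1], where vacancy
    numbers drop by one for all positive lengths below [l k] (for all positive lengths if [k = r]).
    The last hypothesis excludes singular strings there. It quantifies over every possible selection
    [s] because the lengths are only found in the proof. *)
Lemma step_up B k r S' : (0 < k <= r)%N -> (r <= n)%N ->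
  valid_labels (addcol k.-1 B) S' -> (forall a, ~~ (0 < a < n)%N -> S' a = [::]) ->
  (forall s : nat -> nat,
     (forall a, (k <= a < r)%N -> s a = 0%N \/ is_sing (addcol k.-1 B) S' a (s a)) ->
     (forall a, (k <= a)%N -> (a.+1 < r)%N -> (s a <= s a.+1)%N) ->
     forall i, (0 < i)%N -> ((k < r)%N -> (i <= s k)%N) ->
       ~~ is_sing (addcol k.-1 B) S' k.-1 i) ->
  exists l R S, step n B k r l R S S'.
Proof.
move=> kr rn vS' Sout extra.
pose s a := up_search (addcol k.-1 B) S' r.-1 (r.-1 - a).
have sP a : (a < r)%N -> [/\ (a.+1 < r -> s a <= s a.+1)%N,
    s a = 0%N \/ is_sing (addcol k.-1 B) S' a (s a)
    & forall i, (s a < i)%N -> ((a.+1 < r)%N -> (i <= s a.+1)%N) ->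
       ~~ is_sing (addcol k.-1 B) S' a i].
  move=> ar; pose b := if (a.+1 < r)%N then s a.+1 else ssize (S' a).
  have -> : s a = last_sing (addcol k.-1 B) S' a b.
    rewrite /s /b; case E: (r.-1 - a)%N => [|d] /=.
      have -> : (a.+1 < r)%N = false by lia.
      by rewrite subn0; have -> : r.-1 = a by lia.
    have -> : (a.+1 < r)%N by lia.
    rewrite /s; have -> : (r.-1 - a.+1)%N = d by lia.
    by have -> : (r.-1 - d.+1)%N = a by lia.
  have [lb ls ln] := last_singP (addcol k.-1 B) S' a b; split=> //.
    by move=> ar2; apply: leq_trans lb _; rewrite /b ar2.
  move=> i li ib; case: (leqP i b) => [ib'|bi]; first by apply: ln; rewrite li.
  move: bi; rewrite /b; case: ifP => ar2 bi; first by have := ib ar2; lia.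
  by apply/negP => /ssize_mem /=; lia.
have smono a : (k <= a)%N -> (a.+1 < r)%N -> (s a <= s a.+1)%N.
  by move=> _ ar; have [|h _ _] := sP a; [lia | apply: h].
have nonk := extra s (fun a ar => let: And3 _ h _ := sP a ltac:(lia) in h) smono.
pose l a := if (a < k)%N then 1%N else (s a).+1.
have l1 a : (a < k)%N -> l a = 1%N by rewrite /l => ->.
have ls a : (k <= a)%N -> l a = (s a).+1 by rewrite /l leqNgt => /negbTE->.
pose y a := vac (addcol k.-1 B) S' a (l a).-1.
pose x a := vac (addcol k.-1 B) S' a (l a) - 1 + (reached r l a.+1 (l a))%:Z.
pose R a := if (k <= a < r)%N then
  (if (1 < l a)%N then rem ((l a).-1, y a) (S' a) else S' a) else S' a.
pose S a := if (k <= a < r)%N then (l a, x a) :: R a else S' a.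
have pre : prestep n k r l x y R S S'.
  split=> //; try by lia.
  - move=> a ar; case: (ltnP a.+1 k) => ak; first by rewrite !l1 //; lia.
    case: (ltnP a k) => ak'; first by rewrite l1 // ls.
    by rewrite !ls //; have := smono a ak' ar; lia.
  - by move=> a ar; rewrite /S ar.
  - move=> a ar; rewrite /R ar; case: ltnP => la.
      have [|_ [sa|sa] _] := sP a; first by lia.
        by rewrite ls in la; lia.
      have E : (l a).-1 = s a by rewrite ls //; lia.
      rewrite -E in sa; apply: perm_trans (perm_to_rem sa) _.
      by move: (la); rewrite /y; case: (l a) => [|[|m]].
    by have -> : (l a).-1 = 0%N by lia.
  - by move=> a ar; rewrite /S /R (negbTE ar).
  - by move=> a ar; rewrite /S /R (negbTE ar).
have vac' a i := ps_vac pre B (a := a) i.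
have x' a : (k <= a < r)%N -> x a = vac (addcol k B) S a (l a).
  move=> ar; have a0 : (0 < a)%N by lia.
  have := vac' a (l a) a0; rewrite /x.
  have Ha : reached r l a (l a) by rewrite /reached; lia.
  have -> : reached r l a.-1 (l a) by apply: (reachedS pre); rewrite prednK.
  by rewrite Ha; move: (vac _ _ _ _) (vac _ _ _ _) => z1 z2; lia.
exists l, R, S; split=> //.
  case: pre => *; split=> // a ar.
  by rewrite -x' // /S ar.
move=> a t sS; have [a0|a0] := posnP a.
  by move: sS; rewrite a0 /S Sout //; have -> : (k <= 0 < r)%N = false by lia.
have [/andP[ar /eqP->]|sR] := ps_memS pre sS; first by rewrite /= x'.
have sS' := ps_memR' pre sR; have := vS' _ _ sS'; have := vac' a (len t) a0.
have [Ha|Ha] := boolP (reached r l a (len t)); last first.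
  have -> : reached r l a.+1 (len t) = false.
    by apply: contraNF Ha => /(reachedS pre).
  move: (vac _ _ _ _) (vac _ _ _ _) => z1 z2.
  by case: (reached _ _ _ _); lia.
have -> : reached r l a.-1 (len t) by apply: (reachedS pre); rewrite prednK.
have [Hb|Hb] := boolP (reached r l a.+1 (len t)).
  by move: (vac _ _ _ _) (vac _ _ _ _) => z1 z2; lia.
suff : lab t != vac (addcol k.-1 B) S' a (len t).
  by move: (vac _ _ _ _) (vac _ _ _ _) => z1 z2; lia.
have bad : is_sing (addcol k.-1 B) S' a (len t) = false.
  apply: negbTE; have [ak|ka] := ltnP a k.
    have E : a = k.-1.
      by apply/eqP; apply: contraNT Hb => ne; move: Ha; rewrite /reached !l1; lia.
    rewrite E; apply: nonk; first by move: Ha; rewrite /reached l1; lia.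
    move=> kr2; move: Hb; rewrite /reached E prednK; last by lia.
    by rewrite ls //; lia.
  have [|_ _ h] := sP a; first by move: Ha; rewrite /reached; lia.
  apply: h; first by move: Ha; rewrite /reached ls //; lia.
  by move: Hb; rewrite /reached ls; lia.
apply: contraFN bad => /eqP E; rewrite /is_sing -E; by case: (t) sS'.
Qed.

Definition lbS (k : nat) B (S : state) (a : nat) : seq string :=
  if (0 < a < k)%N then (1%N, vac (addcol k B) S a 1) :: S a else S a.

Lemma lbS_boxes k B S a i :
  boxes (lbS k B S a) i = boxes (S a) i + (0 < a < k)%N%:Z * (minn i 1)%:Z.
Proof.
rewrite /lbS; case: ifP => _; last by rewrite mul0r addr0.
by rewrite boxes_cons mul1r addrC.
Qed.

Lemma vac_lbS k B S a i : (1 < k)%N -> (0 < a)%N ->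
  vac (addcol 1 (addcol k.-1 B)) (lbS k B S) a i = vac (addcol k B) S a i.
Proof.
move=> k1 a0; rewrite /vac !lbS_boxes !fboxes_col.
move: (boxes (S a) i) (boxes (S a.-1) i) (boxes (S a.+1) i) (fboxes B a i).
move=> z1 z2 z3 z4.
by move: (minn i 1) => e; nia.
Qed.

(** The strings added by [lbS] are singular of length 1, so a search from node 1 selects and deletes
    them, and reaches node [k] with length 1. *)
Lemma step_lb B k r l R S S' : (1 < k)%N -> step n B k r l R S S' ->
  (forall a, ~~ (0 < a < n)%N -> S a = [::]) ->
  exists R', step n (addcol k.-1 B) 1 r l R' (lbS k B S) S'.
Proof.
move=> k1 st Sout; have ps := st_pre st; exists R.
have k0 := ps_k ps; have kr := ps_kr ps; have rn := ps_rn ps.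
split; last exact: st_val' st.
  split=> //; first by lia.
  - by move=> a a0; apply: (ps_l1 ps); lia.
  - exact: ps_mono ps.
  - move=> a ar; rewrite vac_lbS //; last by lia.
    rewrite /lbS; case: (ltnP a k) => ak; last first.
      by rewrite andbF; apply: (ps_S ps); lia.
    have -> : (0 < a)%N by lia.
    rewrite (ps_l1 ps) // perm_cons; apply: (ps_S0 ps); lia.
  - move=> a ar /=; case: (ltnP a k) => ak.
      by rewrite (ps_l1 ps) //=; apply: (ps_S0' ps); lia.
    by apply: (ps_S' ps); lia.
  - move=> a ar; rewrite /lbS; have -> : (0 < a < k)%N = false by lia.
    by apply: (ps_S0 ps); lia.
  - by move=> a ar; apply: (ps_S0' ps); lia.
move=> a s; case: (posnP a) => [->|a0]; first by rewrite /lbS Sout.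
rewrite vac_lbS // /lbS; case: ifP => _; last exact: (st_val st).
by rewrite inE => /predU1P[->|/(st_val st)].
Qed.

End Steps.

(** * Removing columns *)

Lemma sum_bool_gt0 (P : nat -> bool) u v : (0 < \sum_(u <= k < v) P k)%N ->
  exists2 k, (u <= k < v)%N & P k.
Proof.
rewrite lt0n sum_nat_seq_neq0 => /hasP[k]; rewrite mem_index_iota => uv.
by rewrite /= eqb0 negbK => Pk; exists k.
Qed.

Section Columns.
Variable n : nat.

Definition colsteps B r (e : nat -> nat) (l : nat -> nat -> nat)
    (R Y : nat -> state) : Prop :=
  forall k, (k < r)%N -> step n B k.+1 (e k) (l k) (R k) (Y k.+1) (Y k).

(** The string selected next at node [a + 1] is singular in [S1] and, by induction, at least as long
    as the one selected there before. By [step_nonsing'] it cannot be shorter than [l a.+2]. *)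
Lemma step_next B k e l R S e' l' R' S1 S2 : (0 < k)%N ->
  step n B k.+1 e l R S S1 -> step n B k e' l' R' S1 S2 ->
  forall a, (a < e')%N -> (a.+1 < e)%N /\ (l a.+1 <= l' a)%N.
Proof.
move=> k0 st st'; have ps := st_pre st; have ps' := st_pre st'.
have ke := ps_kr ps; elim=> [|a IH] ae'.
  by rewrite (ps_l1 ps) ?(ps_l1 ps') //; split=> //; lia.
case: (ltnP a.+1 k) => ak.
  by rewrite (ps_l1 ps) ?(ps_l1 ps') //; split=> //; lia.
have [ae lle] := IH ltac:(lia).
have ar' : (k <= a.+1 < e')%N by lia.
have ar : (k.+1.-1 <= a.+1 < e)%N by lia.
have lel : (l a.+1 <= l' a.+1)%N by have := ps_mono ps' ae'; lia.
have xs := step_memS st' ar'.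
have H : ~ ((a.+2 < e)%N -> (l' a.+1 < l a.+2)%N).
  by move=> h; have /= := step_nonsing' st ar isT xs lel h; rewrite ltxx.
split; first by rewrite ltnNge; apply/negP => h; apply: H; lia.
by rewrite leqNgt; apply/negP => h; apply: H.
Qed.

Section Shift.
Variables (B : seq factor) (r : nat) (e : nat -> nat) (l : nat -> nat -> nat).
Variables (R Y : nat -> state).
Hypothesis st : colsteps B r e l R Y.

Lemma col_shift k d a : (k + d < r)%N -> (a < e k)%N ->
  (a + d < e (k + d))%N /\ (l (k + d) (a + d) <= l k a)%N.
Proof.
elim: d => [|d IH] kdr ae; first by rewrite !addn0.
have [|ae' lle] := IH _ ae; first by lia.
have s1 := st kdr; have kdr' : (k + d < r)%N by lia.
have s2 := st kdr'; rewrite addnS in s1.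
by rewrite !addnS; have [] := step_next _ s1 s2 ae' => //; lia.
Qed.

Lemma col_mono k j a b : (k <= j < r)%N -> (a < e k)%N -> (b <= a + (j - k))%N ->
  (b < e j)%N /\ (l j b <= l k a)%N.
Proof.
move=> kj ae ba; have kjr : (k + (j - k) < r)%N by lia.
have := col_shift kjr ae; have -> : (k + (j - k) = j)%N by lia.
move=> [ae' lle]; split; first by lia.
have jr : (j < r)%N by lia.
by have := ps_le (st_pre (st jr)) ba ae'; lia.
Qed.

Lemma col_ranks k : (k.+1 < r)%N -> (e k < e k.+1)%N.
Proof.
move=> kr; have kr' : (k < r)%N by lia.
have ek := ps_kr (st_pre (st kr')).
by have [] := @col_mono k k.+1 (e k).-1 (e k) ltac:(lia) ltac:(lia) ltac:(lia).
Qed.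

End Shift.

(** * Two adjacent columns: weakly increasing rows *)

Section Pair.
Variables (B1 B2 : seq factor) (r s : nat).
Variables (e : nat -> nat) (l : nat -> nat -> nat) (R Y : nat -> state).
Variables (d : nat -> nat) (m : nat -> nat -> nat) (Q Z : nat -> state).
Hypothesis stY : colsteps B1 r e l R Y.
Hypothesis stZ : colsteps B2 r d m Q Z.
Hypothesis YZ : Y 0%N = Z r.
Hypothesis r0 : (0 < r)%N.
Hypothesis s0 : (0 < s)%N.
(** In the application [B1] begins with the factor of height [r] and width [s], and [addcol r B2] is
    obtained by splitting off its first column; this alters only node [r] at lengths below [s]. *)
Hypothesis B12 : forall a i, (a != r) || (s <= i)%N ->
  fboxes B1 a i = fboxes (addcol r B2) a i.

Let vac12 a i : (a != r) || (s <= i)%N ->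
  vac B1 (Y 0%N) a i = vac (addcol r B2) (Z r) a i.
Proof. by move=> h; rewrite /vac B12 // YZ. Qed.

Let rr : r = r.-1.+1. Proof. by rewrite prednK. Qed.

Section Forward.
Hypothesis nonsing : forall i, (0 < i <= s)%N -> ~~ is_sing (addcol r B1) (Y r) r i.

Let l_big k a : (k < r)%N -> (k < a < e k)%N -> (s < l k a)%N.
Proof.
move=> kr kae; have [re lle] : (r < e r.-1)%N /\ (l r.-1 r <= l k a)%N.
  by apply: (col_mono stY); lia.
apply: leq_trans lle; rewrite ltnNge; apply/negP => ls.
have rr1 : (r.-1 < r)%N by lia.
have st := stY rr1; have rin : (r.-1.+1 <= r < e r.-1)%N by lia.
have := step_memS st rin; rewrite -rr => h.
have l0 := ps_lpos (st_pre st) re.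
by have := nonsing (i := l r.-1 r); rewrite /is_sing h => /(_ ltac:(lia)).
Qed.

(* The strings shortened by the first column stay singular while the rest of  *)
(* this column is removed, so they bound the searches of the second column.   *)
Let countY j : (j <= r)%N -> forall a i, (0 < i)%N ->
  (\sum_(j <= k < r) ((k < a < e k) && (l k a == i.+1)) <=
   count_mem (i, vac (addcol j B1) (Y j) a i) (Y j a))%N.
Proof.
have [dd] := ubnP (r - j); elim: dd j => // dd IH j jd jr a i i0.
have [E|ne] := eqVneq j r; first by rewrite E big_geq.
have jr' : (j < r)%N by lia.
have {IH} := IH j.+1 ltac:(lia) ltac:(lia) a i i0.
have st := stY jr'; have ps := st_pre st.
rewrite (big_ltn jr'); set X := (X in (_ + X)%N) => XY.
have new : ((j < a < e j) && (l j a == i.+1) <=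
     count_mem (i, vac (addcol j B1) (Y j) a i) (short (l j a).-1
        (vac (addcol j B1) (Y j) a (l j a).-1)))%N.
  case: andP => // -[jae /eqP ->] /=.
  by case: (i) i0 => //= i' _; rewrite eqxx.
have [X0|X0] := posnP X.
  rewrite X0 addn0; case: (boolP (j < a < e j)%N) => jae //.
  rewrite jae in new.
  by apply: leq_trans new _; rewrite (permP (ps_S' ps jae)) count_cat leq_addr.
have [k jkr /andP[kae /eqP lka]] := sum_bool_gt0 X0.
have notreached b : (a <= b.+1)%N -> reached (e j) (l j) b i = false.
  move=> ab; apply/negP => /andP[be lb].
  have [_] : (a < e k)%N /\ (l k a <= l j b)%N by apply: (col_mono stY); lia.
  by rewrite lka; lia.
have vE : vac (addcol j B1) (Y j) a i = vac (addcol j.+1 B1) (Y j.+1) a i.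
  rewrite -[j]/(j.+1.-1) (ps_vac ps); last by lia.
  have -> : reached (e j) (l j) a i = false by apply: notreached; lia.
  have -> : reached (e j) (l j) a.-1 i = false by apply: notreached; lia.
  have -> : reached (e j) (l j) a.+1 i = false by apply: notreached; lia.
  by move: (vac _ _ _ _) => z; lia.
rewrite vE in new *; case: (boolP (j < a < e j)%N) => jae; last first.
  rewrite add0n (permP (ps_S0' ps jae)); apply: leq_trans XY _.
  by rewrite (permP (ps_S0 ps jae)).
rewrite (permP (ps_S' ps jae)) count_cat; apply: leq_add.
  by rewrite jae in new.
apply: leq_trans XY _; rewrite (permP (ps_S ps jae)) /= xpair_eqE.
suff -> : (l j a == i) = false by [].
have := notreached a (leqnSn a); rewrite /reached; lia.
Qed.

(** The string left at length [l j a.+1 - 1] by the first column is still singular and within reach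
    of the search, so that search cannot pass it. *)
Let below j a : (j < r)%N -> (a < e j)%N ->
    (forall a i, (0 < i)%N ->
       (\sum_(0 <= k < j.+1) ((k < a < e k) && (l k a == i.+1)) <=
        count_mem (i, vac (addcol j.+1 B2) (Z j.+1) a i) (Z j.+1 a))%N) ->
  (a < d j)%N /\ ((j < a)%N -> (m j a < l j a)%N).
Proof.
move=> jr ae cZ; have st := stZ jr; have ps := st_pre st; have jd := ps_kr ps.
elim: a ae => [|a IH] ae; first by split=> //; lia.
have [ad ml] := IH (ltnW ae).
have [aj|ja] := ltnP a j; first by split; lia.
have la : (s < l j a.+1)%N by apply: l_big; lia.
have i0 : (0 < (l j a.+1).-1)%N by lia.
have := cZ a.+1 _ i0; rewrite big_nat_recr //= prednK; last by lia.
have -> : (j < a.+1 < e j)%N by lia.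
rewrite eqxx addn1 => /(leq_ltn_trans (leq0n _)).
rewrite -has_count has_pred1 => xs.
have ar : (j.+1 <= a.+1 <= d j)%N by lia.
have lm : (m j a <= (l j a.+1).-1)%N.
  have := ps_mono (st_pre (stY jr)) ae.
  have [E|ne] := eqVneq a j.
    by move=> _; rewrite [m j a](ps_l1 ps) // E.
  have ja' : (j < a)%N by rewrite ltn_neqAle eq_sym ne ja.
  by move: (ml ja'); lia.
have H : ~ ((a.+1 < d j)%N -> ((l j a.+1).-1 < m j a.+1)%N).
  by move=> h; have /= := step_nonsing st ar xs lm h; rewrite ltxx.
split; first by rewrite ltnNge; apply/negP => h; apply: H; lia.
by move=> _; rewrite ltnNge; apply/negP => h; apply: H; lia.
Qed.

Lemma pair_le k0 : (k0 < r)%N -> (e k0 <= d k0)%N.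
Proof.
suff H j : (j <= r)%N ->
    (forall a i, (0 < i)%N ->
       (\sum_(0 <= k < j) ((k < a < e k) && (l k a == i.+1)) <=
        count_mem (i, vac (addcol j B2) (Z j) a i) (Z j a))%N).
  move=> kr; have := @below k0 (e k0).-1 kr _ (H k0.+1 kr).
  by have := ps_kr (st_pre (stY kr)); lia.
(* Each box of the second column may use up one string left by the first column, at most the one
   charged to its own index [j]. Counting with multiplicity covers equal lengths. *)
have [dd] := ubnP (r - j); elim: dd j => // dd IH j jd jr a i i0.
have [E|ne] := eqVneq j r.
  subst j; have XY := countY (leq0n r) a i0.
  have [->//|X0] := posnP (\sum_(0 <= k < r) ((k < a < e k) && (l k a == i.+1)))%N.
  have [k jkr /andP[kae /eqP lka]] := sum_bool_gt0 X0.
  by rewrite -vac12 -?YZ //; have := l_big (k := k) (a := a); lia.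
have jr' : (j < r)%N by lia.
have {IH} cZ := IH j.+1 ltac:(lia) ltac:(lia).
have bel a' := @below j a' jr' ^~ cZ.
have st := stZ jr'; have ps := st_pre st.
have := cZ a i i0; rewrite big_nat_recr //=.
set X := (\sum_(_ <= _ < _) _)%N => XY.
have [->//|X0] := posnP X.
have [k jkr /andP[kae /eqP lka]] := sum_bool_gt0 X0.
have mono b : (b <= a.+1)%N -> (b < e j)%N /\ (l j b <= i.+1)%N.
  by move=> ba; rewrite -lka; apply: (col_mono stY); lia.
have rea b : (b <= a.+1)%N -> reached (d j) (m j) b i.
  move=> ba; have [be lb] := mono b ba; have [bd mb] := bel b be.
  rewrite /reached bd /=; case: (ltnP j b) => jb; first by have := mb jb; lia.
  by rewrite (ps_l1 ps).
have vE : vac (addcol j B2) (Z j) a i = vac (addcol j.+1 B2) (Z j.+1) a i.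
  rewrite -[j]/(j.+1.-1) (ps_vac ps); last by lia.
  rewrite !rea; try by lia.
  by move: (vac _ _ _ _) => z; lia.
rewrite vE; have [bd mb] := bel a (mono a (leqnSn a)).1.
have [jad|jad] := boolP (j < a < d j)%N; last first.
  rewrite (permP (ps_S0' ps jad)) -(permP (ps_S0 ps jad)).
  by apply: leq_trans XY; apply: leq_addr.
rewrite (permP (ps_S' ps jad)) count_cat; apply: leq_trans (leq_addl _ _).
move: XY; rewrite (permP (ps_S ps jad)) /= xpair_eqE.
case: (eqVneq (m j a) i) => [E|_] /=; last first.
  by apply: leq_trans; apply: leq_addr.
have [ae la] := mono a (leqnSn a).
have -> : (j < a < e j)%N by lia.
have -> : l j a == i.+1 by have := mb ltac:(lia); lia.
rewrite E eqxx; lia.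
Qed.

End Forward.
Section Backward.
Hypothesis ed : forall k, (k < r)%N -> (e k <= d k)%N.
Hypothesis nonsing : forall i, (0 < i < s)%N -> ~~ is_sing (addcol r B2) (Z r) r i.

Let m_big k : (k < r)%N -> (r < d k)%N -> (s <= m k r)%N.
Proof.
move=> kr rd.
have [re lle] : (r < d r.-1)%N /\ (m r.-1 r <= m k r)%N.
  by apply: (col_mono stZ); lia.
apply: leq_trans lle; rewrite leqNgt; apply/negP => ls.
have rr1 : (r.-1 < r)%N by lia.
have st := stZ rr1; have rin : (r.-1.+1 <= r < d r.-1)%N by lia.
have := step_memS st rin; rewrite -rr => h.
have l0 := ps_lpos (st_pre st) re.
by have := nonsing (i := m r.-1 r); rewrite /is_sing h => /(_ ltac:(lia)).
Qed.

Let count_short i v x y : x != i -> count_mem (i, v) (short x y) = 0%N.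
Proof. by case: x => //= x xi; rewrite xpair_eqE (negbTE xi). Qed.

(* Read upwards: the strings selected by the second column stay singular      *)
(* while its remaining boxes are added, and bound those of the first column.  *)
Let countZ j : (j <= r)%N -> forall a i,
  (\sum_(0 <= k < j) ((k < a < d k) && (m k a == i)) <=
   count_mem (i, vac (addcol j B2) (Z j) a i) (Z j a))%N.
Proof.
elim: j => [|j IH] jr a i; first by rewrite big_geq.
have {IH} XY := IH (ltnW jr) a i.
have st := stZ jr; have ps := st_pre st.
rewrite big_nat_recr //=; move: XY.
set X := (\sum_(_ <= _ < _) _)%N => XY.
have new : ((j < a < d j) && (m j a == i) <=
    count_mem (i, vac (addcol j.+1 B2) (Z j.+1) a i) (Z j.+1 a))%N.
  case: (boolP (j < a < d j)%N) => //= jad; rewrite (permP (ps_S ps jad)) /=.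
  by case: eqVneq => // ->; rewrite eqxx.
have [X0|X0] := posnP X; first by rewrite X0.
have [k jkr /andP[kae /eqP mka]] := sum_bool_gt0 X0.
have mono b : (b <= a.+1)%N -> (b < d j)%N /\ (m j b <= i)%N.
  by move=> ba; rewrite -mka; apply: (col_mono stZ); lia.
have rea b : (b <= a.+1)%N -> reached (d j) (m j) b i.
  by move=> ba; have [bd mb] := mono b ba; rewrite /reached bd.
have vE : vac (addcol j B2) (Z j) a i = vac (addcol j.+1 B2) (Z j.+1) a i.
  rewrite -[j]/(j.+1.-1) (ps_vac ps); last by lia.
  rewrite !rea; try by lia.
  by move: (vac _ _ _ _) => z; lia.
rewrite vE in XY.
have [jad|jad] := boolP (j < a < d j)%N; last first.
  by rewrite (permP (ps_S0 ps jad)) -(permP (ps_S0' ps jad)) addn0.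
have [ad ma] := mono a (leqnSn a).
have m0 := ps_lpos ps ad.
move: XY; rewrite (permP (ps_S' ps jad)) count_cat count_short; last by lia.
rewrite (permP (ps_S ps jad)) /= xpair_eqE.
by case: (eqVneq (m j a) i) => [->|_]; rewrite ?eqxx /=; lia.
Qed.

(** If [l j a <= m j a], the string still singular at length [m j a] would lie in the range
    forbidden by [step_nonsing']; this is shown by descending induction on the node. The strict
    inequality then keeps the remaining strings singular when the next box is restored. *)
Let above j : (j <= r)%N ->
  (forall a i, (0 < i)%N ->
    (\sum_(j <= k < r) ((k < a < d k) && (m k a == i)) <=
     count_mem (i, vac (addcol j B1) (Y j) a i) (Y j a))%N)
  /\ (forall k a, (k < j)%N -> (k < a < e k)%N -> (m k a < l k a)%N).
Proof.
elim: j => [|j IH] jr.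
  split=> // a i i0; have XY := countZ (leqnn r) a i.
  have [->//|X0] := posnP (\sum_(0 <= k < r) ((k < a < d k) && (m k a == i)))%N.
  have [k jkr /andP[kae /eqP lka]] := sum_bool_gt0 X0.
  rewrite vac12 ?YZ //; have [ar|//] := eqVneq a r.
  by rewrite -lka ar; apply: m_big; lia.
have [cY ml] := IH (ltnW jr).
have st := stY jr; have ps := st_pre st.
have ej := ps_kr ps.
have mlj a : (j < a < e j)%N -> (m j a < l j a)%N.
  have [dd] := ubnP (e j - a); elim: dd a => // dd IHa a ad jae.
  rewrite ltnNge; apply/negP => lm.
  have m0 := ps_lpos (st_pre (stZ jr)) (a := a) ltac:(by have := ed jr; lia).
  have := cY a (m j a) m0; rewrite big_ltn // eqxx.
  have -> : (j < a < d j)%N by have := ed jr; lia.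
  move=> /(leq_trans (leq_addr _ _)); rewrite -has_count has_pred1 => xs.
  have ar : (j.+1.-1 <= a < e j)%N by lia.
  have a0 : (0 < a)%N by lia.
  have H : (a.+1 < e j)%N -> (m j a < l j a.+1)%N.
    move=> ae; have := IHa a.+1 ltac:(lia) ltac:(lia).
    have aed : (a.+1 < d j)%N by have := ed jr; lia.
    by have := ps_mono (st_pre (stZ jr)) aed; lia.
  by have /= := step_nonsing' st ar a0 xs lm H; rewrite ltxx.
split; last first.
  move=> k a; rewrite ltnS leq_eqVlt => /predU1P[->|kj] kae; first exact: mlj.
  exact: ml.
move=> a i i0; have := cY a i i0; rewrite (big_ltn jr).
set X := (\sum_(_ <= _ < _) _)%N => XY.
have [->//|X0] := posnP X.
have [k jkr /andP[kae /eqP mka]] := sum_bool_gt0 X0.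
have mono b : (a <= b.+1)%N -> (b < d j)%N -> (i <= m j b)%N.
  move=> ab bd; have [_] : (a < d k)%N /\ (m k a <= m j b)%N.
    by apply: (col_mono stZ); lia.
  by rewrite mka.
have notreached b : (a <= b.+1)%N -> (b < e j)%N -> (j < b)%N -> (i < l j b)%N.
  move=> ab be jb; have bd : (b < d j)%N by have := ed jr; lia.
  by have := mono b ab bd; have := mlj b ltac:(lia); lia.
have nr b : (a <= b.+1)%N -> (b <= a.+1)%N -> reached (e j) (l j) b i = false.
  move=> ab ba; rewrite /reached; case: (ltnP b (e j)) => //= be.
  by have := notreached b ab be ltac:(lia); lia.
have vE : vac (addcol j B1) (Y j) a i = vac (addcol j.+1 B1) (Y j.+1) a i.
  rewrite -[j]/(j.+1.-1) (ps_vac ps); last by lia.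
  have -> : reached (e j) (l j) a i = false by apply: nr; lia.
  have -> : reached (e j) (l j) a.-1 i = false by apply: nr; lia.
  have -> : reached (e j) (l j) a.+1 i = false by apply: nr; lia.
  by move: (vac _ _ _ _) => z; lia.
rewrite -vE.
have [jae|jae] := boolP (j < a < e j)%N; last first.
  rewrite (permP (ps_S0 ps jae)) -(permP (ps_S0' ps jae)).
  by apply: leq_trans XY; apply: leq_addl.
rewrite (permP (ps_S ps jae)) [count _ (_ :: _)]/= ; apply: leq_trans (leq_addl _ _).
have [E|ne] := eqVneq (l j a).-1 i; last first.
  move: XY; rewrite (permP (ps_S' ps jae)) count_cat count_short //.
  by apply: leq_trans; apply: leq_addl.
have ad : (a < d j)%N by have := ed jr; lia.
have mE : m j a = i.
  by have := mono a (leqnSn a) ad; have := mlj a jae; lia.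
move: XY; have -> : (j < a < d j)%N by lia.
rewrite mE eqxx (permP (ps_S' ps jae)) count_cat E.
have : (count_mem (i, vac (addcol j B1) (Y j) a i)
   (short i (vac (addcol j.+1.-1 B1) (Y j) a i)) <= 1)%N.
  by case: (i) => //= i'; rewrite addn0 leq_b1.
move: (count_mem _ _) (count_mem _ _) => u v; lia.
Qed.

(** The search at node [r] starts at length 1 and either fails or stops at a length exceeding
    [m r.-1 r >= s]. *)
Lemma pair_nonsing i : (0 < i <= s)%N -> ~~ is_sing (addcol r B1) (Y r) r i.
Proof.
move=> is_; apply/negP => xs.
have rr1 : (r.-1 < r)%N by lia.
have st := stY rr1; have ps := st_pre st; have er := ps_kr ps.
rewrite -rr in st.
have ar : (r <= r <= e r.-1)%N by lia.
have l1 : (l r.-1 r.-1 <= i)%N by rewrite (ps_l1 (st_pre st)); lia.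
have H : (r < e r.-1)%N -> (i < l r.-1 r)%N.
  move=> re; have [_ ml] := above (leqnn r).
  have := ml r.-1 r rr1 ltac:(lia).
  by have := m_big rr1 ltac:(by have := ed rr1; lia); lia.
by have /= := step_nonsing st ar xs l1 H; rewrite ltxx.
Qed.

End Backward.
End Pair.
End Columns.

(** * Paths and states *)

Section Rel.
Variable n : nat.

Lemma rc_ext B c c' S : c =1 c' -> rc n B c S -> rc n B c' S.
Proof.
move=> cc [o le sz an va ch]; split=> //; first by move=> a; rewrite -cc.
  by move=> a; rewrite -!cc.
by apply: (chain_mono ch) => q; rewrite !cc.
Qed.

(** Supplies the last hypothesis of [step_up] for the next entry of a strictly increasing column. By
    descending induction on the node, [s a] stays below the length [l' a.-1] selected by the
    previous box. *)
Lemma step_extra B k e' l' R' S1 S2 e (s : nat -> nat) :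
  step n B k e' l' R' S1 S2 -> (e' < e)%N ->
  (forall a, (k.+1 <= a < e)%N -> s a = 0%N \/ is_sing (addcol k B) S1 a (s a)) ->
  (forall a, (k.+1 <= a)%N -> (a.+1 < e)%N -> (s a <= s a.+1)%N) ->
  forall i, (0 < i)%N -> ((k.+1 < e)%N -> (i <= s k.+1)%N) ->
    ~~ is_sing (addcol k B) S1 k i.
Proof.
move=> st ee sing mono i i0 ik; have ps := st_pre st.
have ke := ps_kr ps; have k0 := ps_k ps.
have small a : (k.+1 <= a <= e')%N -> (s a < l' a.-1)%N.
  have [dd] := ubnP (e' - a); elim: dd a => // dd IH a ad ka.
  have l0 := ps_lpos ps (a := a.-1) ltac:(lia).
  rewrite ltnNge; apply/negP => ls.
  have [||sa] := sing a; [lia | lia |].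
  have ar : (k <= a <= e')%N by lia.
  have H : (a < e')%N -> (s a < l' a)%N.
    move=> ae; have := IH a.+1 ltac:(lia) ltac:(lia).
    by have := mono a ltac:(lia) ltac:(lia); rewrite /=; lia.
  by have /= := step_nonsing st ar sa ls H; rewrite ltxx.
apply/negP => si; have ar : (k <= k <= e')%N by lia.
have l1 : (l' k.-1 <= i)%N by rewrite (ps_l1 ps); lia.
have H : (k < e')%N -> (i < l' k)%N.
  by move=> ke'; have := small k.+1 ltac:(lia); have := ik ltac:(lia); rewrite /=; lia.
by have /= := step_nonsing st ar si l1 H; rewrite ltxx.
Qed.

Lemma column_up B c0 S0 r col0 : rc n B c0 S0 -> is_column n r col0 ->
  exists l R Y, [/\ colsteps n B r (nth 0%N col0) l R Y, Y 0%N = S0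
    & rc n (addcol r B) (fun a => c0 a + count (ltn a) col0)%N (Y r)].
Proof.
move=> rc0 /and3P[/eqP sz so an].
suff H j : (j <= r)%N -> exists l R Y, [/\ colsteps n B j (nth 0%N col0) l R Y,
    Y 0%N = S0 & rc n (addcol j B) (fun a => c0 a + count (ltn a) (take j col0))%N (Y j)].
  by have := H r (leqnn r); rewrite -{3}sz take_size.
elim: j => [|j IH] jr.
  exists (fun _ _ => 0%N), (fun _ _ => [::]), (fun _ => S0); split=> //.
  by apply: rc_ext rc0 => a; rewrite take0 addn0.
have [l [R [Y [st Y0 rcY]]]] := IH (ltnW jr).
set e := nth 0%N col0 j.
have eP : (0 < e <= n)%N by apply: (allP an); rewrite mem_nth ?sz.
have eprev i : (i < j)%N -> (nth 0%N col0 i < e)%N.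
  move=> ij; apply: (sorted_ltn_nth ltn_trans) => //; rewrite inE sz; lia.
have je : (j < e)%N.
  case: (j) st eprev => [|j'] st eprev; first by lia.
  have := eprev j' (ltnSn _); have := ps_kr (st_pre (st j' (ltnSn _))); lia.
have [|||||l1 [R1 [S1 st1]]] := @step_up n B j.+1 e (Y j).
- by rewrite je.
- by lia.
- exact: rc_val rcY.
- exact: rc_out rcY.
- move=> s sing mono i i0 ij.
  case: (posnP j) => [j0|j0].
    by rewrite /is_sing (rc_out rcY) // j0.
  have jj : (j.-1 < j)%N by lia.
  have stj := st _ jj; rewrite prednK // in stj.
  exact: (step_extra stj (eprev _ jj) sing mono i0 ij).
exists (fun k => if (k < j)%N then l k else l1), (fun k => if (k < j)%N then R k else R1),
  (fun k => if (k <= j)%N then Y k else S1); split=> //.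
  move=> k kj; have [kj'|kj'] := ltnP k j.
    by rewrite (ltnW kj'); apply: st.
  have -> : k = j by lia.
  by rewrite leqnn.
rewrite ltnn; apply: rc_ext (rc_up st1 rcY) => a.
by rewrite (take_nth 0%N) ?sz // -cats1 count_cat /= addn0 addnA.
Qed.

Lemma column_down B c r S : (r <= n)%N -> rc n (addcol r B) c S ->
  exists e l R Y c0, [/\ colsteps n B r e l R Y, Y r = S & rc n B c0 (Y 0%N)].
Proof.
elim: r c S => [|r IH] c S rn rcS.
  by exists (fun _ => 0%N), (fun _ _ => 0%N), (fun _ _ => [::]), (fun _ => S), c.
have rn' : (0 < r.+1 <= n)%N by [].
have [e1 [l1 [R1 [S1 st1]]]] := step_down rn' (rc_val rcS) (rc_out rcS).
have [e [l [R [Y [c0 [st Yr rc0]]]]]] := IH _ _ (ltnW rn) (rc_down st1 rcS).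
exists (fun k => if (k < r)%N then e k else e1),
  (fun k => if (k < r)%N then l k else l1), (fun k => if (k < r)%N then R k else R1),
  (fun k => if (k <= r)%N then Y k else S), c0; split=> //; last by rewrite ltnn.
move=> k kr; have [kr'|kr'] := ltnP k r; first by rewrite (ltnW kr'); apply: st.
have -> : k = r by lia.
by rewrite leqnn Yr.
Qed.

Lemma colsteps_column B r e l R Y : colsteps n B r e l R Y ->
  is_column n r (mkseq e r).
Proof.
move=> st; rewrite /is_column size_mkseq eqxx /=; apply/andP; split.
  apply/(sortedP 0%N) => i; rewrite size_mkseq => ir.
  by have h := col_ranks st ir; rewrite !nth_mkseq //; lia.
apply/allP => x /mapP[k]; rewrite mem_iota => kr ->.
have kr' : (k < r)%N by lia.
have := ps_kr (st_pre (st k kr')); have := ps_rn (st_pre (st k kr')); lia.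
Qed.

Lemma colsteps_ext B r e e' l R Y : (forall k, (k < r)%N -> e k = e' k) ->
  colsteps n B r e l R Y -> colsteps n B r e' l R Y.
Proof. by move=> ee st k kr; rewrite -ee //; apply: st. Qed.

Lemma colsteps_det B r e1 l1 R1 Y1 e2 l2 R2 Y2 :
  colsteps n B r e1 l1 R1 Y1 -> colsteps n B r e2 l2 R2 Y2 ->
  (forall a, perm_eq (Y1 r a) (Y2 r a)) ->
  (forall k, (k < r)%N -> e1 k = e2 k) /\ forall a, perm_eq (Y1 0%N a) (Y2 0%N a).
Proof.
elim: r => [|r IH] st1 st2 YY; first by split.
have s1 := st1 r (ltnSn r); have s2 := st2 r (ltnSn r).
have [er _] := step_rank_inj s1 s2 YY.
have [|||e0 Y0] := IH.
- by move=> k kr; apply: st1; lia.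
- by move=> k kr; apply: st2; lia.
- exact: step_det s1 s2 YY.
split=> // k; rewrite ltnS leq_eqVlt => /predU1P[->//|]; exact: e0.
Qed.

Lemma colsteps_up_det B r e l1 R1 Y1 l2 R2 Y2 :
  colsteps n B r e l1 R1 Y1 -> colsteps n B r e l2 R2 Y2 ->
  (forall a, perm_eq (Y1 0%N a) (Y2 0%N a)) ->
  forall a, perm_eq (Y1 r a) (Y2 r a).
Proof.
move=> st1 st2 YY; elim: r st1 st2 => // r IH st1 st2.
apply: (step_up_det (st1 r (ltnSn r)) (st2 r (ltnSn r))).
by apply: IH => k kr; [apply: st1 | apply: st2]; lia.
Qed.

(** The graph of the maps on states. In [Rel2] the state of the wide factor is that of the split
    one, as [ls_rc] is the identity; [valid_labels] adds the bounds of the unsplit factor. *)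
Inductive Rel : seq factor -> tpath -> state -> Prop :=
| Rel0 S : (forall a, S a = [::]) -> Rel [::] [::] S
| Rel1 B r c b l R Y : size c = r -> colsteps n B r (nth 0%N c) l R Y ->
    Rel B b (Y 0%N) -> Rel ((r, 1%N) :: B) ([:: c] :: b) (Y r)
| Rel2 B r s c T b l R Y : size c = r ->
    colsteps n ((r, s.+1) :: B) r (nth 0%N c) l R Y ->
    Rel ((r, s.+1) :: B) (T :: b) (Y 0%N) ->
    valid_labels ((r, s.+2) :: B) (Y r) ->
    Rel ((r, s.+2) :: B) ((c :: T) :: b) (Y r).

Definition cweight (b : tpath) (a : nat) : nat := count (ltn a) (flatten (flatten b)).

Lemma fboxes_merge B r s a i : (0 < r)%N ->
  fboxes ((r, s.+2) :: B) a i + ((a == r) && (0 < i <= s.+1))%N%:Z =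
  fboxes (addcol r ((r, s.+1) :: B)) a i.
Proof.
move=> r0; rewrite fboxes_col r0 /fboxes !big_cons /= [a == r]eq_sym.
move: (\sum_(_ <- _ | _) _) => z.
by case: (r =P a) => [_|_] /=; lia.
Qed.

Lemma vac_merge B r s S a i : (0 < r)%N ->
  vac ((r, s.+2) :: B) S a i + ((a == r) && (0 < i <= s.+1))%N%:Z =
  vac (addcol r ((r, s.+1) :: B)) S a i.
Proof. by move=> r0; rewrite /vac -fboxes_merge //; lia. Qed.

Lemma rc_split B r s c S : (0 < r)%N -> rc n ((r, s.+2) :: B) c S ->
  rc n (addcol r ((r, s.+1) :: B)) c S.
Proof.
move=> r0 [o le sz an va ch]; split=> //.
  move=> a; rewrite -sz deficit_col /deficit !big_cons /=.
  by move: (\sum_(_ <- _) _)%N => z; lia.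
by move=> a t tS; rewrite -vac_merge //; have := va _ _ tS; lia.
Qed.

(** Merging the column lowers the vacancy numbers by one exactly at node [r] and lengths 1 to
    [s + 1]. *)
Lemma rc_merge B r s c S : (0 < r)%N -> rc n (addcol r ((r, s.+1) :: B)) c S ->
  (forall i, (0 < i <= s.+1)%N -> ~~ is_sing (addcol r ((r, s.+1) :: B)) S r i) ->
  rc n ((r, s.+2) :: B) c S.
Proof.
move=> r0 [o le sz an va ch] ns; split=> //.
  move=> a; rewrite -sz deficit_col /deficit !big_cons /=.
  by move: (\sum_(_ <- _) _)%N => z; lia.
move=> a t tS; have := va _ _ tS; rewrite -vac_merge //.
have [/andP[/eqP ar il]|_] := boolP ((a == r) && (0 < len t <= s.+1)%N); last by lia.
subst a; suff : lab t != vac (addcol r ((r, s.+1) :: B)) S r (len t).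
  by rewrite -vac_merge // eqxx il; lia.
apply: contraNN (ns _ il) => /eqP E; rewrite /is_sing -E; by case: (t) tS.
Qed.

Lemma rel_head B r s T b S : (0 < r)%N -> Rel ((r, s.+1) :: B) (T :: b) S ->
  exists c T' l R Z B2, [/\ T = c :: T' /\ size c = r,
    colsteps n B2 r (nth 0%N c) l R Z, S = Z r,
    forall a i, (a != r) || (s.+1 <= i)%N ->
      fboxes ((r, s.+1) :: B) a i = fboxes (addcol r B2) a i
    & valid_labels ((r, s.+1) :: B) S ->
      forall i, (0 < i < s.+1)%N -> ~~ is_sing (addcol r B2) S r i].
Proof.
move=> r0 H; inversion H; subst.
  exists c, [::], l, R, Y, B; split=> // [a i _|_ i].
    by rewrite fboxes_col r0 /= /fboxes big_cons /=; case: (_ == _); lia.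
  by lia.
exists c, T0, l, R, Y, ((size c, s0.+1) :: B); split=> // [a i ai|vY i is_].
  rewrite -fboxes_merge // -[LHS]addr0; congr (_ + _).
  by have -> : (a == size c) && (0 < i <= s0.+1)%N = false by lia.
apply/negP => /vY /=; rewrite -vac_merge // eqxx.
have -> : (0 < i <= s0.+1)%N by lia.
by rewrite /=; lia.
Qed.

Lemma rel_exists B b : valid n B -> is_path n B b ->
  exists S, Rel B b S /\ rc n B (cweight b) S.
Proof.
elim: B b => [|[r s] B IH] [|T b] //=.
  move=> _ _; exists (fun _ => [::]); split; first exact: Rel0.
  by split=> // a; rewrite /ssize /deficit !big_nil.
move=> /andP[/andP[/= /andP[r0 rn] s0] vB] /andP[tT pb].
case: s s0 tT => // s _.
elim: s T => [|s IHs] T.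
  case: T => [|c [|c' T]] //.
  rewrite /is_tableau /= => /andP[/andP[colc _] _].
  have [S0 [rel0 rc0]] := IH _ vB pb.
  have [l [R [Y [st Y0 rcY]]]] := column_up rc0 colc.
  exists (Y r); split.
    by apply: (Rel1 _ st); [case/and3P: colc => /eqP | rewrite Y0].
  case: (r) r0 rcY => // r' _; apply: rc_ext => a.
  by rewrite /cweight /= count_cat addnC.
case: T => // c T /and3P[/= szT /andP[colc colT] soT].
have tT : is_tableau n r s.+1 T.
  by rewrite /is_tableau colT -eqSS szT (path_sorted soT).
have [S0 [rel0 rc0]] := IHs _ tT.
have [l [R [Y [st Y0 rcY]]]] := column_up rc0 colc.
have szc : size c = r by case/and3P: colc => /eqP.
have [c2 [T2 [m [Q [Z [B2 [[TE szc2] stZ S0Z B12 ns]]]]]]] := rel_head r0 rel0.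
have YZ : Y 0%N = Z r by rewrite Y0.
have ed k : (k < r)%N -> (nth 0 c k <= nth 0 c2 k)%N.
  move: soT; rewrite TE /= => /andP[+ _]; rewrite all2E => /andP[_ /allP h] kr.
  have := h (nth 0%N c k, nth 0%N c2 k); apply.
  rewrite -nth_zip ?szc ?szc2 //; apply: mem_nth.
  by rewrite size_zip szc szc2 minnn.
have ns' i : (0 < i < s.+1)%N -> ~~ is_sing (addcol r B2) (Z r) r i.
  by rewrite -S0Z; apply: ns; apply: rc_val rc0.
have nsY := pair_nonsing st stZ YZ r0 (ltn0Sn s) B12 ed ns'.
have rcm := rc_merge r0 rcY nsY.
exists (Y r); split.
  by apply: (Rel2 szc st); [rewrite Y0 | apply: rc_val rcm].
apply: rc_ext rcm => a.
by rewrite /cweight /= count_cat addnC.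
Qed.

Lemma rc_nil c S a : rc n [::] c S -> S a = [::].
Proof.
move=> rcS; have c0 b : c b = 0%N.
  elim: b => [|b IH]; last by have := rc_anti rcS b; lia.
  by rewrite -(rc_size rcS) (rc_out rcS) // /ssize /deficit !big_nil.
case E: (S a) => [//|t s0].
have tS : t \in S a by rewrite E mem_head.
by have := ssize_mem tS; have := rc_len rcS tS; have := rc_size rcS a; rewrite c0; lia.
Qed.

Lemma rel_path B c S : valid n B -> rc n B c S ->
  exists b, is_path n B b /\ Rel B b S.
Proof.
elim: B c S => [|[r s] B IH] c S /=.
  move=> _ rcS; exists [::]; split=> //; apply: Rel0 => a.
  exact: rc_nil rcS.
move=> /andP[/andP[/= /andP[r0 rn] s0] vB].
case: s s0 => // s _.
suff H : forall c S, rc n ((r, s.+1) :: B) c S -> exists T b,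
    [/\ is_tableau n r s.+1 T, is_path n B b & Rel ((r, s.+1) :: B) (T :: b) S].
  by move=> /H[T [b [tT pb rel]]]; exists (T :: b); rewrite /= tT pb.
elim: s {c S} => [|s IHs] c S rcS.
  have rcS' : rc n (addcol r B) c S by case: (r) r0 rcS.
  have [e [l [R [Y [c0 [st Yr rc0]]]]]] := column_down (ltnW rn) rcS'.
  have [b [pb rel]] := IH _ _ vB rc0.
  have colc := colsteps_column st.
  exists [:: mkseq e r], b; split=> //.
    by rewrite /is_tableau /= colc.
  rewrite -Yr; apply: (Rel1 (size_mkseq _ _)) rel.
  by apply: colsteps_ext st => k kr; rewrite nth_mkseq.
have rcS' := rc_split r0 rcS.
have [e [l [R [Y [c0 [st Yr rc0]]]]]] := column_down (ltnW rn) rcS'.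
have [T [b [tT pb rel]]] := IHs _ _ rc0.
have [c2 [T2 [m [Q [Z [B2 [[TE szc2] stZ S0Z B12 _]]]]]]] := rel_head r0 rel.
have nsY i : (0 < i <= s.+1)%N -> ~~ is_sing (addcol r ((r, s.+1) :: B)) (Y r) r i.
  move=> is_; apply/negP; rewrite Yr => /[dup] si /(rc_val rcS) /=.
  by rewrite -vac_merge // eqxx is_ /=; lia.
have ed := pair_le st stZ S0Z r0 (ltn0Sn s) B12 nsY.
have colc := colsteps_column st.
exists (mkseq e r :: T), b; split=> //.
  move: tT => /and3P[szT colT soT]; rewrite /is_tableau /= eqSS szT colc colT /=.
  move: soT; rewrite TE /= => ->; rewrite andbT all2E size_mkseq szc2 eqxx /=.
  apply/allP => x /(nthP (0, 0)%N)[k]; rewrite size_zip size_mkseq szc2 minnn => kr <-.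
  by rewrite nth_zip ?size_mkseq // nth_mkseq //=; apply: ed.
rewrite -Yr; apply: (Rel2 (size_mkseq _ _)) rel _; last first.
  by rewrite Yr; apply: rc_val rcS.
by apply: colsteps_ext st => k kr; rewrite nth_mkseq.
Qed.

Lemma rel_det B b S1 S2 : Rel B b S1 -> Rel B b S2 ->
  forall a, perm_eq (S1 a) (S2 a).
Proof.
move=> H1; elim: H1 S2 => {B b S1}.
- move=> S1 S1E S2 H; inversion H as [? S2E| |]; subst => a.
  by rewrite S1E S2E.
- move=> B r c b l R Y sz st rel IH S2 H; inversion H; subst.
  by apply: (colsteps_up_det st); [eassumption | apply: IH].
- move=> B r s c T b l R Y sz st rel IH va S2 H; inversion H; subst.
  by apply: (colsteps_up_det st); [eassumption | apply: IH].
Qed.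

Lemma rel_inj B b1 b2 S1 S2 : Rel B b1 S1 -> Rel B b2 S2 ->
  (forall a, perm_eq (S1 a) (S2 a)) -> b1 = b2.
Proof.
move=> H1; elim: H1 b2 S2 => {B b1 S1}.
- by move=> S1 _ b2 S2 H; inversion H.
- move=> B r c b l R Y sz st rel IH b2 S2 H YY.
  inversion H as [|? ? c' b' ? ? ? sz' st' rel'|]; subst.
  have [ee YY0] := colsteps_det st st' YY.
  congr ([:: _] :: _); last exact: IH rel' YY0.
  by apply: (@eq_from_nth _ 0%N) => // k /ee.
- move=> B r s c T b l R Y sz st rel IH va b2 S2 H YY.
  inversion H as [| |? ? ? c' T' b' ? ? ? sz' st' rel' va']; subst.
  have [ee YY0] := colsteps_det st st' YY.
  have [<- <-] := IH _ _ rel' YY0; congr ((_ :: _) :: _).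
  by apply: (@eq_from_nth _ 0%N) => // k /ee.
Qed.

End Rel.

(** * Eliminating the tableaux t *)

Lemma sum_count (T : Type) (s : seq T) (Q : pred T) :
  \sum_(j <- s) (Q j)%:Z = (count Q s)%:Z.
Proof. by elim: s => [|x s IH]; rewrite ?big_nil // big_cons IH /=. Qed.

Section Potential.
Variables (n : nat) (S : state) (c : nat -> nat).
Hypothesis Sout : forall a, ~~ (0 < a < n)%N -> S a = [::].
Hypothesis c_anti : forall a, (c a.+1 <= c a)%N.
Hypothesis lenc : forall a s, s \in S a -> (len s <= c a)%N.
Let Lam q := (c q - c q.+1)%N.

Let inS a s : s \in S a -> (0 < a < n)%N.
Proof. by move=> sS; apply: contraTT sS => /Sout ->. Qed.

(** [f k i] models the number of entries at most [i] in column [k] of t. A left chain is worth at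
    least [f q j - j], and evaluating at [c q] closes the chain. *)
Lemma potential_chain (f : nat -> nat -> nat) :
  (forall k, f k 0%N = 0%N) -> (forall k, {homo f k : i j / (i <= j)%N}) ->
  (forall k i j, (f k j <= f k i + (j - i))%N) ->
  (forall k, (0 < k < n)%N -> f k.+1 (c k) = c k.+1) ->
  (forall a s, s \in S a -> (f a.+1 (len s))%:Z <= (f a (len s))%:Z + lab s) ->
  chain_cond S Lam.
Proof.
move=> f0 fm fl fc fs.
have low q g : lfun S q g -> forall j, (f q j)%:Z - j%:Z <= g j.
  elim=> {q g} [q j|q g s _ IH sS j]; first by have := fl q 0%N j; rewrite f0; lia.
  have := IH (len s); have := fs _ _ sS; have := fl q.+1 (len s) j.
  have := fm q.+1 j (len s); lia.
move=> q g s lP sS; have := low _ _ lP (len s); have := fs _ _ sS.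
have := fl q.+1 (len s) (c q); rewrite (fc _ (inS sS)).
by have := lenc sS; rewrite /Lam; lia.
Qed.

Let minval (s : seq int) : int := foldr Num.min 0 s.

Let minval_le s x : x \in s -> minval s <= x.
Proof.
elim: s => //= y s IH; rewrite inE ge_min => /predU1P[->|/IH ->].
  by rewrite lexx.
by rewrite orbT.
Qed.

Let minval_in s : minval s = 0 \/ minval s \in s.
Proof.
elim: s => [|y s IH] /=; first by left.
rewrite inE; case: (leP y (minval s)) => _; first by right; rewrite eqxx.
by case: IH => [->|->]; [left|right; rewrite orbT].
Qed.

(* The least value at j of a left chain ending at node q. *)
Fixpoint hmin (q j : nat) : int :=
  if q is q'.+1 then
    minval [seq hmin q' (len s) + lab s + (len s - j)%N%:Z | s <- S q']
  else 0.

Let hmin_le q g j : lfun S q g -> hmin q j <= g j.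
Proof.
move=> lP; elim: lP j => {q g} [q|q g s _ IH sS] j /=.
  case: q => //= q; elim: (S q) => //= s s0 IH.
  by rewrite ge_min IH orbT.
apply: le_trans (minval_le _) _; first by apply/mapP; exists s.
by have := IH (len s); lia.
Qed.

Let hmin_in q j : exists2 g, lfun S q g & hmin q j = g j.
Proof.
elim: q j => [|q IH] j; first by exists (fun _ => 0) => //; exact: Lfun0.
rewrite /=; case: (minval_in [seq hmin q (len s) + lab s + (len s - j)%N%:Z | s <- S q]).
  by move=> ->; exists (fun _ => 0) => //; exact: Lfun0.
move=> /mapP[s sS ->]; have [g lP ->] := IH (len s).
by exists (fun j => g (len s) + lab s + (len s - j)%N%:Z) => //; exact: LfunS.
Qed.

(** Shortest-path potential: [f k j] is [hmin k j + j] truncated at [c k]. Prolonging a minimal left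
    chain by one string gives the label inequality, and the chain condition gives the boundary value
    at [c k]. *)
Lemma chain_potential : chain_cond S Lam -> exists f : nat -> nat -> nat,
  [/\ forall k, f k 0%N = 0%N,
      forall k i, (f k i <= f k i.+1 <= (f k i).+1)%N,
      forall k, f k.+1 (c k) = c k.+1 & f 1%N (c 1%N) = c 1%N] /\
  (forall a s, s \in S a -> (f a.+1 (len s))%:Z <= (f a (len s))%:Z + lab s).
Proof.
move=> ok.
have h0 q j : hmin q j <= 0 by apply: (hmin_le j (Lfun0 S q)).
have hj q j : 0 <= hmin q j + j%:Z.
  have [g [q1|q1 g' s lP sS] ->] := hmin_in q j; first by lia.
  by have := ok _ _ _ lP sS; lia.
have slope q g j : lfun S q g -> g j.+1 <= g j <= g j.+1 + 1.
  by case=> {q g} [q|q g s _ _]; lia.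
have hs q j : hmin q j.+1 <= hmin q j <= hmin q j.+1 + 1.
  have [g lP gE] := hmin_in q j; have [g' lP' gE'] := hmin_in q j.+1.
  have := hmin_le j.+1 lP; have := hmin_le j lP'.
  by have := slope _ _ j lP; have := slope _ _ j lP'; lia.
pose f k j : nat := minn (c k) (absz (hmin k j + j%:Z)).
have fE k j : (f k j)%:Z = Num.min (c k)%:Z (hmin k j + j%:Z).
  by rewrite /f; have := hj k j; lia.
exists f; split; first split.
- by move=> k; have := fE k 0%N; have := hj k 0%N; have := h0 k 0%N; lia.
- move=> k i; have := fE k i; have := fE k i.+1; have := hs k i; lia.
- move=> k; have := fE k.+1 (c k); suff : (c k.+1)%:Z <= hmin k.+1 (c k) + (c k)%:Z by lia.
  have [g lP ->] := hmin_in k.+1 (c k).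
  move: lP; move E : k.+1 => k1 lP; case: lP E => {k1 g} [q|q g s lP sS] E.
    by have := c_anti k; rewrite -E; lia.
  have := ok _ _ _ lP sS; have := c_anti k; case: E => ->.
  by rewrite /Lam; lia.
- have := fE 1%N (c 1%N); rewrite /= Sout //=; lia.
move=> a s sS; have := fE a (len s); have := fE a.+1 (len s).
have := lenc sS; have [g lP gE] := hmin_in a (len s).
have := hmin_le (len s) (LfunS lP sS); rewrite -gE subnn.
have := h0 a (len s); lia.
Qed.

End Potential.

(** A function with increments 0 or 1 counts its own jumps, so a potential can be turned back into a
    column. *)
Lemma jumps_count (F : nat -> nat) N : F 0%N = 0%N ->
  (forall i, (F i <= F i.+1 <= (F i).+1)%N) ->
  forall i, (i <= N)%N ->
    count (fun x => x <= i)%N [seq j <- iota 1 N | (F j.-1 < F j)%N] = F i.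
Proof.
move=> F0 Fs; elim: N => [|N IH] i iN; first by have -> : i = 0%N by lia.
rewrite -(addn1 N) iotaD filter_cat count_cat add1n /=.
have [E|ne] := eqVneq i N.+1; last first.
  rewrite IH; last by lia.
  by case: ifP => _ /=; rewrite ?addn0 //; lia.
subst i; have := Fs N.
have -> : count (fun x => x <= N.+1)%N [seq j <- iota 1 N | (F j.-1 < F j)%N]
    = count (fun x => x <= N)%N [seq j <- iota 1 N | (F j.-1 < F j)%N].
  apply: eq_in_count => x; rewrite mem_filter mem_iota; lia.
rewrite IH //; case: ltnP => /= h; last by rewrite addn0; lia.
by rewrite leqnn; lia.
Qed.

Section Tableau.
Variables (n : nat) (lambda : n.-tuple nat).

Definition tail_weight (a : nat) : nat := (\sum_(a <= j < n) nth 0 lambda j)%N.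

Lemma colheightE k : colheight lambda k = tail_weight (maxn k 1).
Proof. by rewrite /colheight /tail_weight -[n in RHS]/(n.+1.-1) big_add1. Qed.

Lemma tail_weightS a : (a < n)%N -> tail_weight a = (nth 0 lambda a + tail_weight a.+1)%N.
Proof. by move=> an; rewrite /tail_weight big_ltn. Qed.

Lemma tail_weight_ge a : (n <= a)%N -> tail_weight a = 0%N.
Proof. by move=> na; rewrite /tail_weight big_geq. Qed.

Lemma tail_weight_anti a : (tail_weight a.+1 <= tail_weight a)%N.
Proof.
case: (ltnP a n) => an; first by rewrite (tail_weightS an) leq_addl.
by rewrite !tail_weight_ge //; lia.
Qed.

Let tcol (t : nat -> nat -> nat) k := [seq t j k | j <- iota 1 (colheight lambda k)].

Lemma lowboundE t a i : lowbound lambda t a i =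
  (count (fun x => x <= i)%N (tcol t a.+1))%:Z - (count (fun x => x <= i)%N (tcol t a))%:Z.
Proof.
rewrite /lowbound addrC /tcol !count_map -!sum_count.
by rewrite /index_iota !subSS !subn0.
Qed.

Lemma count_interval (s : seq nat) i j : uniq s ->
  (count (fun x => x <= j) s <= count (fun x => x <= i) s + (j - i))%N.
Proof.
move=> us; pose p := [seq x <- s | (i < x <= j)%N].
have : (size p <= size (iota i.+1 (j - i)))%N.
  apply: uniq_leq_size; first exact: filter_uniq.
  by move=> x; rewrite mem_filter mem_iota; lia.
rewrite size_iota size_filter => h.
apply: leq_trans (_ : count (fun x => x <= i)%N s + count (fun x => i < x <= j)%N s <= _)%N; last by lia.
rewrite -count_predUI; apply: leq_trans (leq_addr _ _).
by apply: sub_count => x /=; lia.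
Qed.

Lemma admissible_chain (S : state) :
  (forall a, ~~ (0 < a < n)%N -> S a = [::]) ->
  (forall a s, s \in S a -> (len s <= tail_weight a)%N) ->
  (exists2 t, admissible lambda t &
     forall a s, s \in S a -> lowbound lambda t a (len s) <= lab s) <->
  chain_cond S (fun q => tail_weight q - tail_weight q.+1)%N.
Proof.
move=> Sout lenc; split.
  move=> [t adm low].
  pose f k i := if (0 < k < n)%N then count (fun x => x <= i)%N (tcol t k) else 0%N.
  have fE k i : (0 < k)%N -> f k i = count (fun x => x <= i)%N (tcol t k).
    move=> k0; rewrite /f k0; case: ltnP => //= nk.
    by rewrite /tcol colheightE tail_weight_ge //; lia.
  have tu k : (0 < k < n)%N -> uniq (tcol t k).
    move=> kn; have [_ dec] := adm _ kn.
    have : sorted gtn (tcol t k).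
      apply/(sortedP 0%N) => i; rewrite size_map size_iota => ih.
      rewrite !(nth_map 0%N) ?size_iota //; last by lia.
      by rewrite !nth_iota //; [apply: dec; lia | lia].
    apply: sorted_uniq; first by move=> x y z /=; lia.
    by move=> x /=; lia.
  apply: (@potential_chain n S _ Sout lenc f).
  - move=> k; rewrite /f; case: ifP => // kn; apply/eqP; rewrite -leqn0 leqNgt -has_count.
    apply/hasPn => x /mapP[j]; rewrite mem_iota => jh ->.
    by have [pos _] := adm _ kn; have := pos j; lia.
  - move=> k i j ij; rewrite /f; case: ifP => // kn.
    by apply: sub_count => x /=; lia.
  - by move=> k i j; rewrite /f; case: ifP => // kn; apply: count_interval; apply: tu.
  - move=> k kn; rewrite fE //.
    have -> : tail_weight k.+1 = size (tcol t k.+1).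
      by rewrite size_map size_iota colheightE; congr tail_weight; lia.
    apply/eqP; rewrite -all_count; apply/allP => x /mapP[j]; rewrite mem_iota => jh ->.
    have [kn'|kn'] := ltnP k.+1 n.
      have [pos _] := adm k.+1 kn'; have := pos j; rewrite /= [colheight _ k]colheightE.
      have -> : maxn k 1 = k by lia.
      by lia.
    by move: jh; rewrite colheightE tail_weight_ge //; lia.
  - move=> a s sS; have := low _ _ sS; rewrite lowboundE.
    have a0 : (0 < a < n)%N by apply: contraTT sS => /Sout ->.
    by rewrite !fE //; lia.
move=> /(chain_potential Sout tail_weight_anti lenc)[f [[f0 fs fc f1] fl]].
(* The jumps of [f k] are the entries of column [k], reversed below because columns of t
   decrease. *)
pose T k := [seq j <- iota 1 (colheight lambda k.-1) | (f k j.-1 < f k j)%N].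
have fT k i : (i <= colheight lambda k.-1)%N -> count (fun x => x <= i)%N (T k) = f k i.
  by apply: jumps_count.
have szT k : (0 < k)%N -> size (T k) = colheight lambda k.
  move=> k0; transitivity (f k (colheight lambda k.-1)).
    rewrite -fT //; apply/esym/eqP; rewrite -all_count; apply/allP => x.
    by rewrite mem_filter mem_iota; lia.
  rewrite !colheightE; case: k k0 => // -[|k] _ /=; first exact: f1.
  have -> : maxn k.+1 1 = k.+1 by lia.
  have -> : maxn k.+2 1 = k.+2 by lia.
  exact: fc.
have soT k : sorted ltn (T k).
  by apply: sorted_filter; [exact: ltn_trans | exact: iota_ltn_sorted].
pose t j k := nth 0%N (rev (T k)) j.-1.
have tT k : (0 < k)%N -> tcol t k = rev (T k).
  move=> k0; apply: (@eq_from_nth _ 0%N).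
    by rewrite size_map size_iota size_rev szT.
  move=> i; rewrite size_map size_iota => ih.
  by rewrite (nth_map 0%N) ?size_iota // nth_iota //.
exists t.
  move=> k kn; have k0 : (0 < k)%N by lia.
  have szr : size (rev (T k)) = colheight lambda k by rewrite size_rev szT.
  split=> j jh.
    have : t j k \in rev (T k) by rewrite /t mem_nth // szr; lia.
    by rewrite mem_rev mem_filter mem_iota; lia.
  rewrite /t; have -> : j.+1.-1 = j.-1.+1 by lia.
  have so : sorted gtn (rev (T k)) by rewrite rev_sorted.
  by apply: (sortedP 0%N so); rewrite szr; lia.
move=> a s sS; have a0 : (0 < a < n)%N by apply: contraTT sS => /Sout ->.
have := fl _ _ sS; rewrite lowboundE !tT //; last by lia.
rewrite !count_rev !fT; [lia| |].
  rewrite colheightE; apply: leq_trans (lenc _ _ sS) _.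
  have [E|ne] := eqVneq a 1%N; first by rewrite E.
  have -> : a = a.-1.+1 by lia.
  have -> : maxn a.-1.+1.-1 1 = a.-1 by lia.
  exact: tail_weight_anti.
have E : maxn a 1 = a by lia.
by rewrite colheightE /= E; apply: lenc.
Qed.

End Tableau.

(** * States and rigged configurations *)

(** Sorting picks the canonical listing, so that equality of [rep] is equality of multisets at every
    node. *)
Definition rep (S : state) : rigged :=
  Rigged (fun a => sort geq (map len (S a)))
         (fun a i => sort >=%R [seq lab s | s <- S a & len s == i]).

Lemma geq_total : total geq. Proof. by move=> x y; apply: leq_total. Qed.
Lemma geq_trans : transitive geq. Proof. by move=> x y z /= h1 h2; apply: leq_trans h2 h1. Qed.
Lemma geq_anti : antisymmetric geq.
Proof. by move=> x y; rewrite andbC => /anti_leq. Qed.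

Lemma ger_total : total (>=%R : rel int). Proof. by move=> x y; apply: le_total. Qed.
Lemma ger_trans : transitive (>=%R : rel int).
Proof. by move=> x y z /= h1 h2; apply: le_trans h2 h1. Qed.
Lemma ger_anti : antisymmetric (>=%R : rel int).
Proof. by move=> x y; rewrite andbC => /le_anti. Qed.

Lemma rep_ext S S' : (forall a, perm_eq (S a) (S' a)) -> rep S = rep S'.
Proof.
move=> SS; congr Rigged; apply: functional_extensionality => a.
  by apply/(perm_sortP geq_total geq_trans geq_anti); apply: perm_map.
apply: functional_extensionality => i.
apply/(perm_sortP ger_total ger_trans ger_anti); apply: perm_map.
exact: perm_filter.
Qed.

Lemma count_J S a i y : count_mem y (J (rep S) a i) = count_mem (i, y) (S a).
Proof.
rewrite /= (permP (permEl (perm_sort _ _))) count_map count_filter.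
by apply: eq_count => -[j z] /=; rewrite xpair_eqE andbC.
Qed.

Lemma rep_inj S S' : rep S = rep S' -> forall a, perm_eq (S a) (S' a).
Proof. by move=> E a; apply/allP => -[i y] _ /=; rewrite -!count_J E. Qed.

Lemma mem_J S a i y : (y \in J (rep S) a i) = ((i, y) \in S a).
Proof. by rewrite -!has_pred1 !has_count count_J. Qed.

Lemma parts_multE S a i : parts_mult (nu (rep S)) a i = smult (S a) i.
Proof. by rewrite /parts_mult /= (permP (permEl (perm_sort _ _))) count_map. Qed.

Lemma sum_undup (V : nmodType) (T : eqType) (s : seq T) (Q : pred T) (F : T -> V) :
  \sum_(j <- undup s | Q j) F j *+ count_mem j s = \sum_(j <- s | Q j) F j.
Proof. exact: big_undup_iterop_count. Qed.

Lemma sum_mult_array (V : nmodType) (B : seq factor) (Q : pred factor) (F : factor -> V) :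
  \sum_(h <- finsupp (mult_array B) | Q h) F h *+ mult_array B h = \sum_(h <- B | Q h) F h.
Proof.
rewrite -[RHS]sum_undup /mult_array; under eq_bigr do rewrite mset_seqE.
rewrite (perm_big (undup B)) //=; apply: uniq_perm; rewrite ?undup_uniq ?fset_uniq // => h.
by rewrite mem_undup mem_finsupp mset_seqE -lt0n -has_count has_pred1.
Qed.

Lemma sum_parts (V : nmodType) (S : state) a (F : nat -> V) :
  \sum_(j <- undup (nu (rep S) a)) F j *+ parts_mult (nu (rep S)) a j
  = \sum_(t <- S a) F (len t).
Proof.
rewrite sum_undup /= (perm_big _ (permEl (perm_sort _ _))) /=.
by rewrite big_map.
Qed.

Section Bridge.
Variable n : nat.

Lemma sum_delta (g : nat -> int) c : (forall a, ~~ (0 < a < n)%N -> g a = 0) ->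
  \sum_(1 <= b < n) (b == c)%:Z * g b = g c.
Proof.
move=> g0; have [cn|cn] := boolP (0 < c < n)%N; last first.
  rewrite g0 // big1_seq // => b /andP[_]; rewrite mem_index_iota => bn.
  by case: eqP => [E|_]; rewrite ?mul0r //; rewrite E in bn; rewrite bn in cn.
rewrite (bigD1_seq c) ?mem_index_iota ?iota_uniq //= eqxx mul1r big1 ?addr0 //.
by move=> b /negbTE ->; rewrite mul0r.
Qed.

Lemma vacancyE B S a i : (forall b, ~~ (0 < b < n)%N -> S b = [::]) -> (0 < a)%N ->
  vacancy n (mult_array B) (nu (rep S)) a i = vac B S a i.
Proof.
move=> Sout a0; rewrite /vacancy /vac.
have -> : \sum_(h <- finsupp (mult_array B) | h.1 == a)
    (minn i h.2 * mult_array B h)%N%:Z = fboxes B a i.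
  rewrite /fboxes.
  rewrite -[RHS](sum_mult_array B (fun h => h.1 == a) (fun h => (minn i h.2)%:Z)).
  by apply: eq_bigr => h _; rewrite PoszM -mulr_natr natz.
have g0 b : ~~ (0 < b < n)%N -> boxes (S b) i = 0.
  by move=> bn; rewrite Sout // /boxes big_nil.
have -> : \sum_(1 <= b < n) \sum_(j <- undup (nu (rep S) b))
      cartan a b * (minn i j * parts_mult (nu (rep S)) b j)%N%:Z
   = \sum_(1 <= b < n) (2 * ((b == a)%:Z * boxes (S b) i)
       - (b == a.+1)%:Z * boxes (S b) i - (b == a.-1)%:Z * boxes (S b) i).
  apply: eq_bigr => b _.
  transitivity (cartan a b * boxes (S b) i).
    rewrite /boxes -(sum_parts S b (fun j => (minn i j)%:Z)) big_distrr /=.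
    by apply: eq_bigr => j _; rewrite PoszM -[in RHS]mulr_natr natz.
  rewrite /cartan; move: (boxes _ _) => z.
  have -> : (a == b) = (b == a) by rewrite eq_sym.
  have -> : (a == b.+1) = (b == a.-1) by lia.
  have [->|ba] := eqVneq b a.
    have -> : (a == a.+1) = false by lia.
    have -> : (a == a.-1) = false by lia.
    by rewrite /=; lia.
  have [->|ba1] := eqVneq b a.-1.
    have -> : (a.-1 == a.+1) = false by lia.
    by rewrite /=; lia.
  by case: eqP => _ /=; lia.
rewrite !sumrB -big_distrr /= !sum_delta //; lia.
Qed.

Lemma fundwtE h (j : 'I_n) : fundwt n h 0 j = (j < h)%N%:Z.
Proof.
rewrite /fundwt summxE; under eq_bigr => k _ do rewrite mxE.
elim: h => [|h IH]; first by rewrite big_geq.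
by rewrite big_nat_recr //= IH; case: (ltngtP j h); lia.
Qed.

(** The coordinates of the weight equation are the successive differences of the size equations,
    which are recovered by summing down from node [n]. *)
Lemma config_sizeE B S (lambda : n.-tuple nat) : valid n B ->
  (forall b, ~~ (0 < b < n)%N -> S b = [::]) ->
  (\sum_(1 <= a < n) \sum_(i <- undup (nu (rep S) a))
          alpha n a *+ (i * parts_mult (nu (rep S)) a i)
      = \sum_(h <- finsupp (mult_array B)) fundwt n h.1 *+ (h.2 * mult_array B h)
        - wtvec lambda)
  <-> (forall a, (ssize (S a) + deficit B a)%N = tail_weight lambda a).
Proof.
move=> vB Sout.
have g0 b : ~~ (0 < b < n)%N -> (ssize (S b))%:Z = 0.
  by move=> bn; rewrite Sout // /ssize big_nil.
have coord (j : 'I_n) :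
    (\sum_(1 <= a < n) \sum_(i <- undup (nu (rep S) a))
        alpha n a *+ (i * parts_mult (nu (rep S)) a i)) 0 j
    = (ssize (S j.+1))%:Z - (ssize (S j))%:Z.
  rewrite summxE; transitivity (\sum_(1 <= a < n) ((a == j.+1)%:Z * (ssize (S a))%:Z
      - (a == j)%:Z * (ssize (S a))%:Z)).
    apply: eq_bigr => a _; rewrite -mulrBl.
    transitivity ((alpha n a *+ ssize (S a)) 0 j).
      congr (_ _ _); rewrite /ssize -sumrMnr -(sum_parts S a (fun i => alpha n a *+ i)).
      by under eq_bigr => i _ do rewrite mulrnA.
    by rewrite mulmxnE /alpha !mxE -[LHS]mulr_natr natz; congr (_ * _); lia.
  by rewrite sumrB !(sum_delta _ g0).
have coordR (j : 'I_n) : (\sum_(h <- finsupp (mult_array B))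
     fundwt n h.1 *+ (h.2 * mult_array B h) - wtvec lambda) 0 j
   = (\sum_(h <- B) (j < h.1) * h.2)%N%:Z - (nth 0%N lambda j)%:Z.
  rewrite !mxE (tnth_nth 0%N); congr (_ - _).
  have -> : \sum_(h <- finsupp (mult_array B)) fundwt n h.1 *+ (h.2 * mult_array B h)
      = \sum_(h <- B) fundwt n h.1 *+ h.2.
    rewrite -[RHS](sum_mult_array B xpredT (fun h => fundwt n h.1 *+ h.2)).
    by under eq_bigr do rewrite mulrnA.
  rewrite summxE -[RHS]natz natr_sum; apply: eq_bigr => h _.
  by rewrite mulmxnE fundwtE natrM -[LHS]mulr_natr !natz.
have defS j : deficit B j = (deficit B j.+1 + \sum_(h <- B) (j < h.1) * h.2)%N.
  rewrite /deficit -big_split; apply: eq_bigr => h _ /=.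
  by rewrite -mulnDl; congr (_ * _)%N; lia.
have def0 a : (n <= a)%N -> deficit B a = 0%N.
  move=> na; rewrite /deficit big1_seq // => -[h1 h2] /andP[_ /(allP vB) /= /andP[hn _]].
  by have -> : (h1 - a = 0)%N by lia.
split=> [E|sz].
  have step a : (a < n)%N -> (ssize (S a.+1))%:Z - (ssize (S a))%:Z =
      (\sum_(h <- B) (a < h.1) * h.2)%N%:Z - (nth 0%N lambda a)%:Z.
    move=> an; have := congr1 (fun M : 'rV[int]_n => M 0 (Ordinal an)) E.
    by rewrite coord coordR.
  move=> a; have [d] := ubnP (n - a); elim: d a => // d IH a ad.
  have [na|an] := leqP n a.
    by rewrite def0 // tail_weight_ge // Sout ?/ssize ?big_nil //; lia.
  have := IH a.+1 ltac:(lia); have := step _ an; rewrite (defS a) (tail_weightS lambda an).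
  by move: (\sum_(_ <- _) _)%N => z; lia.
apply/rowP => j; rewrite coord coordR.
have := sz j; have := sz j.+1; rewrite (defS j) (tail_weightS lambda (ltn_ord j)).
by move: (\sum_(_ <- _) _)%N => z; lia.
Qed.

Lemma is_rc_rep B S (lambda : n.-tuple nat) : valid n B ->
  (forall b, ~~ (0 < b < n)%N -> S b = [::]) ->
  (forall a s, s \in S a -> (0 < len s)%N) ->
  is_rc (mult_array B) lambda (rep S) <-> rc n B (tail_weight lambda) S.
Proof.
move=> vB Sout Slen.
have inS a s : s \in S a -> (0 < a < n)%N by move=> sS; apply: contraTT sS => /Sout ->.
split.
  move=> [[_ _ /(config_sizeE _ vB Sout) sz] _ [t adm qp]].
  have lenc a s : s \in S a -> (len s <= tail_weight lambda a)%N.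
    by move=> sS; rewrite -sz; have := ssize_mem sS; lia.
  have labs a s : s \in S a ->
      lowbound lambda t a (len s) <= lab s <= vac B S a (len s).
    move=> sS; have an := inS _ _ sS.
    have /and3P[_ _ /allP] := qp _ _ an (Slen _ _ sS).
    rewrite vacancyE //; last by lia.
    by apply; rewrite mem_J; case: (s) sS.
  split=> //; first exact: tail_weight_anti.
    by move=> a s /labs/andP[].
  by apply/(admissible_chain Sout lenc); exists t => // a s /labs/andP[].
move=> [_ _ sz _ va ch].
have lenc a s : s \in S a -> (len s <= tail_weight lambda a)%N.
  by move=> sS; rewrite -sz; have := ssize_mem sS; lia.
have [t adm low] := (admissible_chain Sout lenc).2 ch.
split.
- split.
  + move=> a an; rewrite /is_partition /= (sort_sorted geq_total) mem_sort.
    by apply/mapP => -[s /Slen + E]; rewrite -E.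
  + by move=> a an; rewrite /= Sout.
  + exact/config_sizeE.
- move=> a i; rewrite negb_and => /orP[an|i0]; first by rewrite /= Sout.
  rewrite /= [filter _ _](_ : _ = [::]) //; apply/eqP; rewrite -[_ == _]negbK -has_filter.
  by apply/hasPn => s /Slen; lia.
exists t => // a i an i0; rewrite /quasipartition size_sort size_map size_filter.
rewrite parts_multE eqxx (sort_sorted ger_total) /=; apply/allP => y.
rewrite (mem_J S a i y) => yS; have := low _ _ yS; have := va _ _ yS.
by rewrite vacancyE //= => [-> ->//|]; lia.
Qed.

Lemma filter_flatten_pairs (s : seq nat) (F : nat -> seq int) j : uniq s ->
  [seq lab t | t <- flatten [seq [seq (i, y) | y <- F i] | i <- s] & len t == j]
  = if j \in s then F j else [::].
Proof.
elim: s => //= i s IH /andP[is_ us]; rewrite filter_cat map_cat IH // inE eq_sym.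
have E : [seq lab t | t <- [seq (i, y) | y <- F i] & len t == j] =
    if i == j then F j else [::].
  rewrite filter_map -map_comp; case: eqP => [->|ne].
    by rewrite (@eq_filter _ _ predT) ?filter_predT ?map_id // => y /=; rewrite eqxx.
  rewrite (@eq_filter _ _ pred0) ?filter_pred0 // => y /=; exact/eqP.
rewrite E; case: eqP => [<-|_] //=; by rewrite (negbTE is_) cats0.
Qed.

Lemma is_rc_repr L (lambda : n.-tuple nat) x : is_rc L lambda x ->
  exists S, [/\ x = rep S, forall b, ~~ (0 < b < n)%N -> S b = [::]
    & forall a s, s \in S a -> (0 < len s)%N].
Proof.
move=> [[part nuout _] Jout [t _ qp]].
pose S a := flatten [seq [seq (i, y) | y <- J x a i] | i <- undup (nu x a)].
have Sout b : ~~ (0 < b < n)%N -> S b = [::] by move=> bn; rewrite /S nuout.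
have nu0 a i : i \in nu x a -> (0 < a < n)%N && (0 < i)%N.
  move=> iS; have an : (0 < a < n)%N by apply: contraTT iS => /nuout ->.
  have /andP[_] := part _ an; rewrite an; case: i iS => // ->; by [].
have szJ a i : size (J x a i) = count_mem i (nu x a).
  have [/andP[an i0]|out] := boolP ((0 < a < n)%N && (0 < i)%N).
    by have /and3P[/eqP -> _ _] := qp _ _ an i0.
  rewrite Jout //; apply/esym/count_memPn; apply: contraNN out; exact: nu0.
exists S; split=> //; last first.
  move=> a s /flattenP[s0 /mapP[i]]; rewrite mem_undup => /nu0/andP[_ i0] ->.
  by move=> /mapP[y _ ->].
case: x part nuout Jout qp @S Sout nu0 szJ => nu0 J0 part nuout Jout qp S Sout nup szJ.
rewrite /= in part nuout Jout qp nup szJ.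
rewrite /rep; congr Rigged; apply: functional_extensionality => a.
  have [an|an] := boolP (0 < a < n)%N; last by rewrite Sout // nuout.
  have /andP[so _] := part _ an; rewrite -[LHS](sorted_sort geq_trans so).
  apply/(perm_sortP geq_total geq_trans geq_anti); rewrite perm_sym.
  apply: perm_trans (perm_count_undup _); rewrite /S map_flatten -map_comp.
  rewrite (@eq_map _ _ _ (fun i => nseq (count_mem i (nu0 a)) i)) // => i /=.
  by rewrite -map_comp -szJ; elim: (J0 a i) => //= y s ->.
apply: functional_extensionality => i.
have [an|an] := boolP (0 < a < n)%N; last first.
  by rewrite Sout // Jout // (negbTE an).
rewrite /S filter_flatten_pairs ?undup_uniq // mem_undup.
case: ifP => [/nup/andP[_ i0]|ni].
  by have /and3P[_ so _] := qp _ _ an i0; rewrite (sorted_sort ger_trans).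
by apply/eqP; rewrite -size_eq0 szJ; apply/eqP/count_memPn; rewrite ni.
Qed.

End Bridge.

(** * The maps [delta] and [lb_rc] on states *)

Lemma perm_rem_cons (T : eqType) (x : T) s t : perm_eq s (x :: t) -> perm_eq (rem x s) t.
Proof.
move=> st; have xs : x \in s by rewrite (perm_mem st) mem_head.
by rewrite -(perm_cons x) -(permPl (perm_to_rem xs)).
Qed.

Lemma rem_sort_ge (x : int) s t : perm_eq s (x :: t) ->
  rem x (sort >=%R s) = sort >=%R t.
Proof.
move=> st; apply: (sorted_eq ger_trans ger_anti).
- by apply: (subseq_sorted ger_trans (rem_subseq _ _)); apply: sort_sorted ger_total _.
- exact: sort_sorted ger_total _.
- rewrite perm_sym perm_sort perm_sym; apply: perm_rem_cons.
  by rewrite perm_sort.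
Qed.

Lemma labs_short i y j :
  [seq lab s | s <- short i y & len s == j] = if (0 < i)%N && (i == j) then [:: y] else [::].
Proof. by case: i => [|i] //=; case: eqP. Qed.

Lemma perm_sort_ge (s t : seq int) : perm_eq s t -> sort >=%R s = sort >=%R t.
Proof. by move/(perm_sortP ger_total ger_trans ger_anti). Qed.

Lemma perm_sort_geq (s t : seq nat) : perm_eq s t -> sort geq s = sort geq t.
Proof. by move/(perm_sortP geq_total geq_trans geq_anti). Qed.

Section Final.
Variable n : nat.

Lemma ell_search B S a : (forall b, ~~ (0 < b < n)%N -> S b = [::]) ->
  ell n (mult_array ((1, 1)%N :: B)) (rep S) a = search (addcol 1 B) S 1 a.
Proof.
move=> Sout; elim: a => //= a ->; case: (search _ _ _ _) => //= l.
rewrite /first_sing; congr ohead.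
have -> : sumn (sort geq (map len (S a.+1))) = ssize (S a.+1).
  by rewrite (perm_sumn (permEl (perm_sort _ _))) sumnE big_map.
rewrite -[LHS]/(filter _ (iota l (ssize (S a.+1)).+1)).
apply: eq_filter => i; rewrite /singular vacancyE // /is_sing.
exact: mem_J.
Qed.

Lemma delta_rep B r l R S S' : (forall b, ~~ (0 < b < n)%N -> S b = [::]) ->
  (forall a s, s \in S a -> (0 < len s)%N) ->
  step n B 1 r l R S S' ->
  delta n (mult_array ((1, 1)%N :: B)) (rep S) = rep S'.
Proof.
move=> Sout Slen st; have ps := st_pre st; have rn := ps_rn ps.
have S'out b : ~~ (0 < b < n)%N -> S' b = [::].
  move=> bn; have ar : ~~ (1 <= b < r)%N by lia.
  apply: perm_nilP; rewrite (permPl (ps_S0' ps ar)) -(permPl (ps_S0 ps ar)).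
  by rewrite Sout.
have sel a : selected n (mult_array ((1, 1)%N :: B)) (rep S) a =
    if (0 < a < r)%N then Some (l a) else None.
  rewrite /selected ell_search // (step_search _ st); case: (posnP a) => //= a0.
  by case: (ltnP a n) => //; case: ltnP => //; lia.
have lens a : perm_eq (map len (short (l a).-1 (vac (addcol 0 B) S' a (l a).-1)))
    [seq i <- [:: (l a).-1] | (0 < i)%N].
  by case: (l a) => [|[|m]].
have Rlen a : [seq i <- map len (R a) | (0 < i)%N] = map len (R a).
  apply/all_filterP/allP => i /mapP[s /(ps_memR ps)/Slen s0 ->]; exact: s0.
(* The new labels are vacancy numbers of the new shape, so the partitions are identified first. *)
have nuE : (fun a => if selected n (mult_array ((1, 1)%N :: B)) (rep S) a is Some l
    then remove_box l (nu (rep S) a) else nu (rep S) a) = nu (rep S').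
  apply: functional_extensionality => a; rewrite sel; case: ifP => ar; last first.
    apply: perm_sort_geq; apply: perm_map; move/negbT: ar => ar.
    by rewrite (permPl (ps_S0 ps ar)) perm_sym (ps_S0' ps ar).
  apply: perm_sort_geq; rewrite perm_sym.
  apply: perm_trans (perm_map _ (ps_S' ps ar)) _; rewrite map_cat -[_ :: rem _ _]cat1s filter_cat.
  apply: perm_cat; first exact: lens.
  rewrite -Rlen; apply: perm_filter; rewrite perm_sym; apply: perm_rem_cons.
  by rewrite perm_sort; apply: perm_map (ps_S ps ar).
rewrite /delta nuE; congr Rigged.
apply: functional_extensionality => a; apply: functional_extensionality => i.
rewrite sel; case: ifP => ar; last first.
  apply: perm_sort_ge; apply: perm_map; apply: perm_filter; move/negbT: ar => ar.
  by rewrite (permPl (ps_S0 ps ar)) perm_sym (ps_S0' ps ar).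
have a0 : (0 < a)%N by lia.
have l0 : (0 < l a)%N by apply: (ps_lpos ps); lia.
pose labs s := [seq lab t | t <- s & len t == i].
have pS : perm_eq (labs (S a)) ((if l a == i then [:: vac (addcol 1 B) S a (l a)] else [::]) ++ labs (R a)).
  apply: perm_trans (perm_map _ (perm_filter _ (ps_S ps ar))) _.
  by rewrite /=; case: eqP.
have pS' : perm_eq (labs (S' a)) ((if (0 < (l a).-1)%N && ((l a).-1 == i)
     then [:: vac B S' a (l a).-1] else [::]) ++ labs (R a)).
  apply: perm_trans (perm_map _ (perm_filter _ (ps_S' ps ar))) _.
  by rewrite filter_cat map_cat labs_short.
have [E|ne] := eqVneq i (l a).
  rewrite vacancyE //; apply: rem_sort_ge; apply: perm_trans pS _.
  rewrite -E eqxx /= perm_cons perm_sym; apply: perm_trans pS' _.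
  by have -> : (0 < (l a).-1)%N && ((l a).-1 == i) = false by lia.
case: ifP => [/andP[i0 /eqP E]|nE].
  rewrite lh_multE vacancyE //; apply: perm_sort_ge; rewrite perm_sym.
  apply: perm_trans pS' _; rewrite -E i0 eqxx /= perm_cons perm_sym perm_sort.
  by apply: perm_trans pS _; rewrite eq_sym (negbTE ne).
apply: perm_sort_ge; apply: perm_trans pS _; rewrite eq_sym (negbTE ne) perm_sym.
apply: perm_trans pS' _.
by have -> : (0 < (l a).-1)%N && ((l a).-1 == i) = false by lia.
Qed.

Lemma lb_rep B k S : (forall b, ~~ (0 < b < n)%N -> S b = [::]) -> (1 < k <= n)%N ->
  lb_rc n k (mult_array ((k, 1)%N :: B)) (rep S) = rep (lbS k B S).
Proof.
move=> Sout k1.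
have lout b : ~~ (0 < b < n)%N -> lbS k B S b = [::].
  by move=> bn; rewrite /lbS Sout //; have -> : (0 < b < k)%N = false by lia.
have nuE : (fun a => if (0 < a < k)%N then sort geq (1%N :: nu (rep S) a) else nu (rep S) a)
    = nu (rep (lbS k B S)).
  apply: functional_extensionality => a; rewrite /= /lbS; case: ifP => // _.
  by apply: perm_sort_geq; rewrite /= perm_cons perm_sort.
rewrite /lb_rc nuE; congr Rigged.
apply: functional_extensionality => a; apply: functional_extensionality => i.
rewrite /= /lbS; case: ifP => [/andP[ak /eqP ->]|]; last first.
  case: ifP => //= ak; rewrite eq_sym => /negbT; by rewrite eq_sym => /negbTE ->.
rewrite ak lb_multE vacancyE //; last by lia.
have -> : vac ((1, 1)%N :: (k.-1, 1)%N :: B) (lbS k B S) a 1 = vac (addcol k B) S a 1.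
  by rewrite -(@vac_lbS k B S a 1) //; [case: (k) k1 => // -[] | lia | lia].
by apply: perm_sort_ge; rewrite /= perm_cons perm_sort.
Qed.

End Final.

(** * The bijection *)

Section Family.
Variable n : nat.

Lemma tail_weight_inj (lambda mu : n.-tuple nat) :
  tail_weight lambda =1 tail_weight mu -> lambda = mu.
Proof.
move=> E; apply: eq_from_tnth => j; rewrite !(tnth_nth 0%N).
have := E j; have := E j.+1; rewrite (tail_weightS lambda (ltn_ord j)).
by rewrite (tail_weightS mu (ltn_ord j)); lia.
Qed.

Lemma path_letters B b : is_path n B b ->
  all (fun x => 0 < x <= n)%N (flatten (flatten b)).
Proof.
elim: B b => [|f B IH] [|T b] //= /andP[/and3P[_ colT _] /IH pb].
rewrite flatten_cat all_cat pb andbT.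
elim: T colT => //= c T IHT /andP[/and3P[_ _ ac] /IHT aT].
by rewrite all_cat ac.
Qed.

Lemma cweight_wt B b : is_path n B b -> cweight b =1 tail_weight (wt n b).
Proof.
move=> /path_letters; rewrite /cweight; set s := flatten _ => sn a.
have nthw j : (j < n)%N -> nth 0%N (wt n b) j = count_mem j.+1 s.
  by move=> jn; rewrite -(tnth_nth _ _ (Ordinal jn)) tnth_mktuple.
have [na|an] := leqP n a.
  rewrite tail_weight_ge //; apply/eqP; rewrite -leqn0 leqNgt -has_count.
  by apply/hasPn => x /(allP sn); rewrite /=; lia.
have [d] := ubnP (n - a); elim: d a an => // d IH a an ad.
rewrite tail_weightS // nthw //.
have -> : count (ltn a) s = (count_mem a.+1 s + count (ltn a.+1) s)%N.
  rewrite -count_predUI [X in (_ + X)%N](_ : _ = 0%N) ?addn0.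
    by apply: eq_count => x /=; lia.
  by apply/eqP; rewrite -leqn0 leqNgt -has_count; apply/hasPn => x _ /=; lia.
congr (_ + _)%N; have [na|an'] := leqP n a.+1; last by apply: IH => //; lia.
rewrite tail_weight_ge //; apply/eqP; rewrite -leqn0 leqNgt -has_count.
by apply/hasPn => x /(allP sn); rewrite /=; lia.
Qed.

Lemma rel_rc B b c S : valid n B -> is_path n B b -> Rel n B b S ->
  rc n B c S -> c =1 cweight b.
Proof.
move=> vB pb rel rcS a; have [S' [rel' rcS']] := rel_exists vB pb.
by rewrite -(rc_size rcS) -(rc_size rcS') (perm_ssize (rel_det rel rel' a)).
Qed.

Definition image_of B (lambda : n.-tuple nat) (b : tpath) (x : rigged) : Prop :=
  exists S, [/\ x = rep S, Rel n B b S & rc n B (tail_weight lambda) S].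

Lemma image_rc B lambda b x : valid n B -> image_of B lambda b x ->
  is_rc (mult_array B) lambda x.
Proof.
move=> vB [S [-> _ rcS]].
by apply/(is_rc_rep _ vB (rc_out rcS) (rc_len rcS)).
Qed.

Lemma image_exists B (vB : valid n B) (lambda : n.-tuple nat) (b : P B lambda) :
  exists x : RC (mult_array B) lambda, image_of B lambda (sval b) (sval x).
Proof.
case: b => b /= /andP[pb /eqP wb].
have [S [rel rcS]] := rel_exists vB pb.
have im : image_of B lambda b (rep S).
  exists S; split=> //; apply: rc_ext rcS => a.
  by rewrite (cweight_wt pb) wb.
by exists (exist _ (rep S) (image_rc vB im)).
Qed.

Lemma image_det B lambda mu b x y : image_of B lambda b x -> image_of B mu b y -> x = y.
Proof.
move=> [S [-> relS _]] [S' [-> relS' _]].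
by apply: rep_ext; apply: rel_det relS relS'.
Qed.

Lemma image_inj B lambda mu b b' x : image_of B lambda b x -> image_of B mu b' x -> b = b'.
Proof.
move=> [S [-> relS _]] [S' [E relS' _]].
by apply: (rel_inj relS relS'); apply: rep_inj.
Qed.

Lemma image_surj B lambda x : valid n B -> is_rc (mult_array B) lambda x ->
  exists2 b, is_path n B b && (wt n b == lambda) & image_of B lambda b x.
Proof.
move=> vB xP; have [S [E Sout Slen]] := is_rc_repr xP; subst x.
have rcS := (is_rc_rep _ vB Sout Slen).1 xP.
have [b [pb rel]] := rel_path vB rcS; exists b; last by exists S.
rewrite pb /=; apply/eqP; apply: tail_weight_inj => a.
by rewrite -(cweight_wt pb) (rel_rc vB pb rel rcS).
Qed.

Definition Phi0 : map_family n := fun B vB lambda b =>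
  sval (constructive_indefinite_description _ (image_exists vB b)).

Lemma Phi0P B (vB : valid n B) lambda (b : P B lambda) :
  image_of B lambda (sval b) (sval (Phi0 vB b)).
Proof. by rewrite /Phi0; case: constructive_indefinite_description. Qed.

Lemma Phi0_compatible : compatible Phi0.
Proof.
split.
- move=> v lambda b; have [S [-> rel _]] := Phi0P v b.
  have SE a : perm_eq (S a) [::].
    by apply: (rel_det rel (S2 := fun _ => [::])); case: b rel => -[|T b] //= _ _; apply: Rel0.
  by rewrite (rep_ext (S' := fun _ => [::])).
- move=> B' v v' lambda b; have [S [-> rel rcS]] := Phi0P v b.
  have [S0 [-> rel0 _]] := Phi0P v' (lh b).
  case: b rel rel0 => b pb /= rel rel0.
  inversion rel as [|? ? c b' l R Y szc st relY|]; subst.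
  have st0 := st 0%N (ltn0Sn 0).
  rewrite (delta_rep (rc_out rcS) (rc_len rcS) st0).
  exact/rep_ext/(rel_det relY rel0).
- move=> r s B' v v' lambda b; have [S [-> rel rcS]] := Phi0P v b.
  have [S0 [-> rel0 _]] := Phi0P v' (ls b).
  case: b rel rel0 => b pb /= rel rel0; apply: rep_ext; move: rel0.
  inversion rel as [| |? ? ? c T b' l R Y szc st relY va]; subst => rel0.
  exact: (rel_det (Rel1 erefl st relY) rel0).
- move=> r B' v v' lambda b; have [S [-> rel rcS]] := Phi0P v b.
  have [S0 [-> rel0 _]] := Phi0P v' (lb b).
  have rn : (1 < r.+2 <= n)%N by case/andP: v => /andP[/= ? _] _; lia.
  rewrite (lb_rep _ (rc_out rcS) rn); apply: rep_ext.
  case: b rel rel0 => b pb /= rel rel0; move: rel0.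
  inversion rel as [|? ? c b' l R Y szc st relY|]; subst.
  case: c szc st {pb rel} => // x c [szc] st rel0; rewrite /= in rel0.
  have r1 : (1 < r.+2)%N by [].
  have [R' st'] := step_lb r1 (st r.+1 (ltnSn _)) (rc_out rcS).
  (* After [lb] the bottom entry is a box of its own: it is removed by the single step of [step_lb],
     and the other steps of the column are unchanged. *)
  pose Z k := if k is 0 then Y r.+1 else lbS r.+2 B' (Y r.+2).
  have nthb k : (k < r.+1)%N -> nth 0%N (x :: c) k = nth 0%N (belast x c) k.
    by move=> kr; rewrite lastI nth_rcons size_belast szc kr.
  have stZ : colsteps n ((r.+1, 1)%N :: B') 1 (nth 0%N [:: last x c])
      (fun _ => l r.+1) (fun _ => R') Z.
    move=> [|//] _ /=; move: st'; rewrite /Z.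
    by rewrite lastI nth_rcons size_belast szc ltnn eqxx.
  have stY : colsteps n B' r.+1 (nth 0%N (belast x c)) l R Y.
    by move=> k kr; rewrite -nthb //; apply: st; lia.
  apply: (rel_det (Rel1 (erefl : size [:: last x c] = 1%N) stZ _) rel0).
  by apply: (Rel1 _ stY relY); rewrite size_belast.
Qed.

(** * Uniqueness of the family *)

Definition split_measure (B : seq factor) : nat := (\sum_(f <- B) (2 * (f.1 * f.2)).-1)%N.

(** With the weight fixed, source sizes are known, so the image reveals the rank; [step_up_det] then
    recovers the source. *)
Lemma delta_inj B (lambda : n.-tuple nat) x y : valid n ((1, 1)%N :: B) ->
  is_rc (mult_array ((1, 1)%N :: B)) lambda x -> is_rc (mult_array ((1, 1)%N :: B)) lambda y ->
  delta n (mult_array ((1, 1)%N :: B)) x = delta n (mult_array ((1, 1)%N :: B)) y -> x = y.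
Proof.
move=> vB xP yP; have [S [E Sout Slen]] := is_rc_repr xP; subst x.
have [T [E Tout Tlen]] := is_rc_repr yP; subst y.
have rcS := (is_rc_rep _ vB Sout Slen).1 xP.
have rcT := (is_rc_rep _ vB Tout Tlen).1 yP.
have n1 : (0 < 1 <= n)%N by case/andP: vB => /andP[/= /ltnW].
have [r [l [R [S' st]]]] := step_down n1 (rc_val rcS : valid_labels (addcol 1 B) S) Sout.
have [r2 [l2 [R2 [T' st2]]]] := step_down n1 (rc_val rcT : valid_labels (addcol 1 B) T) Tout.
rewrite (delta_rep Sout Slen st) (delta_rep Tout Tlen st2) => /rep_inj ST.
have rr a : (1 <= a < r)%N = (1 <= a < r2)%N.
  have := ps_ssize (st_pre st) a; have := ps_ssize (st_pre st2) a.
  rewrite (perm_ssize (ST a)); have := rc_size rcS a; have := rc_size rcT a.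
  by case: (1 <= a < r)%N; case: (1 <= a < r2)%N => //=; lia.
have E : r = r2.
  have := ps_kr (st_pre st); have := ps_kr (st_pre st2).
  by have := rr r; have := rr r2; lia.
subst r2; apply: rep_ext; exact: step_up_det st st2 ST.
Qed.

Lemma lb_inj B k (lambda : n.-tuple nat) x y : (1 < k <= n)%N ->
  is_rc (mult_array ((k, 1)%N :: B)) lambda x -> is_rc (mult_array ((k, 1)%N :: B)) lambda y ->
  lb_rc n k (mult_array ((k, 1)%N :: B)) x = lb_rc n k (mult_array ((k, 1)%N :: B)) y ->
  x = y.
Proof.
move=> kn /is_rc_repr[S [-> Sout _]] /is_rc_repr[T [-> Tout _]].
rewrite !lb_rep // => /rep_inj ST; apply: rep_ext => a.
have bE b i : boxes (S b) i = boxes (T b) i.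
  by have := perm_boxes i (ST b); rewrite !lbS_boxes; lia.
have := ST a; rewrite /lbS /vac !bE; case: ifP => // _.
by rewrite perm_cons.
Qed.

(** An r by s factor has measure 2rs - 1, so each of [lh], [ls], [lb] lowers the total by one; the
    corresponding map on rigged configurations is injective and transfers the equality back. *)
Lemma compatible_unique (n_ge2 : (2 <= n)%N) (Phi Psi : map_family n) :
  compatible Phi -> compatible Psi ->
  forall B (v : valid n B) lambda (b : P B lambda), Phi B v lambda b = Psi B v lambda b.
Proof.
move=> [phi0 phi1 phi2 phi3] [psi0 psi1 psi2 psi3] B.
have [d] := ubnP (split_measure B); elim: d B => // d IH B Bd v lambda b.
suff : sval (Phi B v lambda b) = sval (Psi B v lambda b).
  case: (Phi B v lambda b) (Psi B v lambda b) => x xP [y yP] /= E; subst y.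
  by rewrite (proof_irrelevance _ xP yP).
case: B Bd v b => [|[r s] B] Bd v b; first by rewrite phi0 psi0.
have v0 := v; move: v0; rewrite /= => /andP[/andP[/andP[r0 rn] s0] vB].
have mE : split_measure ((r, s) :: B) = ((2 * (r * s)).-1 + split_measure B)%N.
  by rewrite /split_measure big_cons.
rewrite mE in Bd; case: s s0 v b Bd mE => [//|[|s]] _ v b Bd mE; last first.
  have v' : valid n ((r, 1)%N :: (r, s.+1) :: B) by rewrite /= r0 rn.
  have := phi2 _ _ _ v v' _ b; have := psi2 _ _ _ v v' _ b; rewrite /ls_rc => -> ->.
  rewrite IH //; move: Bd; rewrite /split_measure !big_cons /= muln1 !mulnS.
  by move: (r * s)%N (\sum_(_ <- B) _)%N => u w; lia.
case: r r0 rn v b Bd mE => [//|[|r]] _ rn v b Bd mE.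
  have := phi1 _ v vB _ b; have := psi1 _ v vB _ b; rewrite (IH B); last by lia.
  move=> <-; apply: (delta_inj v); exact: svalP.
have v' : valid n ((1, 1)%N :: (r.+1, 1)%N :: B).
  by rewrite /= vB !andbT; lia.
have := phi3 _ _ v v' _ b; have := psi3 _ _ v v' _ b.
rewrite (IH ((1, 1)%N :: (r.+1, 1)%N :: B)); last first.
  by move: Bd; rewrite /split_measure !big_cons /=; lia.
by move=> <-; apply: lb_inj; [lia | exact: svalP | exact: svalP].
Qed.

End Family.

Theorem proposition4p7 (n : nat) (n_ge2 : (2 <= n)%N) :
  (exists! Phi : map_family n, compatible Phi) /\
  (forall Phi : map_family n, compatible Phi ->
   forall (B : seq factor) (vB : valid n B) (lambda : n.-tuple nat),
     bijective (@Phi B vB lambda)).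
Proof.
have [Phi0 Phi0P Phi0c] : exists2 Phi0 : map_family n,
    (forall B (v : valid n B) lambda (b : P B lambda),
       image_of B lambda (sval b) (sval (Phi0 B v lambda b))) & compatible Phi0.
  by exists (@Phi0 n); [move=> *; exact: Phi0P | exact: Phi0_compatible].
have uniq Phi : compatible Phi -> Phi0 = Phi.
  move=> Phic; apply: functional_extensionality_dep => B.
  apply: functional_extensionality_dep => v.
  apply: functional_extensionality_dep => lambda.
  apply: functional_extensionality_dep => b.
  exact: compatible_unique.
split; first by exists Phi0; split.
move=> Phi /uniq <- B vB lambda.
have surj (x : RC (mult_array B) lambda) : exists b : P B lambda, Phi0 B vB lambda b = x.
  case: x => x xP; have [b bP im] := image_surj vB xP.
  exists (exist _ b bP); have := Phi0P _ vB _ (exist _ b bP).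
  case: (Phi0 _ _ _ _) => y yP /= im'; have E := image_det im' im; subst y.
  by rewrite (proof_irrelevance _ xP yP).
exists (fun x => sval (constructive_indefinite_description _ (surj x))).
  move=> b; case: constructive_indefinite_description => b' /= E.
  have := Phi0P _ vB _ b'; rewrite E => im'.
  have := image_inj im' (Phi0P _ vB _ b); case: b b' {E im'} => [b bP] [b' bP'] /= E.
  by subst b'; rewrite (bool_irrelevance bP bP').
by move=> x; case: constructive_indefinite_description.
Qed.
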